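(* Let $p\in\{1,2,\ldots,\infty\}$, let $Q=\mathbf M^{n\times n}_+$ with its stratification $\mathcal A_+$, and let $m$ be the depth of $\mathcal A_+$. Let $f:\mathbf M^{n\times n}\to\mathbf{R}$ and $\varepsilon:\mathbf M^{n\times n}\to(0,\infty)$ be continuous functions, let $V_1$ be any neighborhood of the support of $f$, and let $V_2$ be any neighborhood of $M_0\cup\cdots\cup M_{n-1}$. Then there exists a function $g:\mathbf M^{n\times n}\to\mathbf{R}$ satisfying all of the following properties. (1) $|f(X)-g(X)|<\varepsilon(X)$ for all $X\in\mathbf M^{n\times n}$. (2) $g$ is $C^p$-smooth. Moreover, if $f$ is Lipschitz continuous, then so is $g$, and $\operatorname{lip} g\le 11^{m+1}\operatorname{lip} f$. (3) Each stratum $M\in\mathcal A_+$ has a neighborhood $U$ such that $g(X)=g(P_M(X))$ for all $X\in U$. (4) The support of $g$ is contained in $V_1$. (5) If $f$ is $C^p$-smooth, then $g$ coincides with $f$ outside of $V_2$. (6) The mapping $X\mapsto\langle X^{\mp},\nabla g(X)\rangle$ is continuous.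
   Context: $\mathbf M^{n\times n}$ is the Euclidean space of real $n\times n$ matrices with trace inner product $\langle X,Y\rangle=\operatorname{tr}(X^\top Y)$ and Frobenius norm; gradients, Lipschitz constants and metric projections are with respect to this structure. $\operatorname{lip} f:=\sup_{X\ne Y}\frac{|f(X)-f(Y)|}{\|X-Y\|_F}$, and $f$ is Lipschitz continuous if this is finite. $P_S(X)$ is the set of nearest points of $S$ to $X$, identified with its element when it is a singleton (each manifold below has a neighborhood on which its projection is single-valued). $\mathbf M^{n\times n}_+:=\{X\in\mathbf M^{n\times n}:\det X\ge0\}$. Its stratification is $\mathcal A_+:=\{M_0,\ldots,M_{n-1},M_{n+}\}$, where $M_k:=\{X\in\mathbf M^{n\times n}:\operatorname{rk}X=k\}$ and $M_{n+}:=\{X\in\mathbf M^{n\times n}:\det X>0\}$; the elements of $\mathcal A_+$ are $C^\infty$ manifolds called strata. Write $L\prec M\iff L\subset(\operatorname{cl}M)\setminus M$ for $L,M\in\mathcal A_+$. The depth of $\mathcal A_+$ is the maximal integer $m$ such that there exist strata $N_1\prec N_2\prec\cdots\prec N_m$ in $\mathcal A_+$. For $x\in\mathbf{R}^n$ define $x^+\in\mathbf{R}^n$ by $x_i^+=1/x_i$ if $x_i\ne0$ and $x_i^+=0$ otherwise. If $X=U\operatorname{Diag}(x)V^\top$ with $U,V$ orthogonal, the Moore–Penrose inverse is $X^+=V\operatorname{Diag}(x^+)U^\top$, and $X^{\mp}:=(X^+)^\top=(X^\top)^+$. *)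

(* Defs.v *)
From HB Require Import structures.
From mathcomp Require Import all_boot all_order all_algebra.
From mathcomp Require Import all_classical all_reals all_analysis.
Set Implicit Arguments.
Unset Strict Implicit.
Unset Printing Implicit Defensive.
Import Order.TTheory GRing.Theory Num.Theory numFieldNormedType.Exports.
Local Open Scope classical_set_scope.
Local Open Scope ring_scope.

(* The library norm on 'M[R]_n is the max norm.  It only provides the topology
   and the differential below, which do not depend on the choice of the norm;
   metric notions (lip, metric_proj) use the Frobenius norm. *)

Definition mxdot (R : realType) (n : nat) (X Y : 'M[R]_n) : R :=
  \tr (X^T *m Y).

Definition frobenius (R : realType) (n : nat) (X : 'M[R]_n) : R :=
  Num.sqrt (mxdot X X).

Definition lip (R : realType) (n : nat) (f : 'M[R]_n -> R) : \bar R :=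
  ereal_sup [set (`|f XY.1 - f XY.2| / frobenius (XY.1 - XY.2))%:E
            | XY in [set XY : 'M[R]_n * 'M[R]_n | XY.1 <> XY.2]].

Definition lipschitz_continuous (R : realType) (n : nat) (f : 'M[R]_n -> R) :=
  (lip f < +oo)%E.

Definition supp (R : realType) (n : nat) (f : 'M[R]_n -> R) : set 'M[R]_n :=
  closure [set X | f X <> 0].

(* The differential is Fréchet, so a function is C^k.+1 iff it is
   differentiable and all its directional derivatives are C^k. *)
Fixpoint Cfin (R : realType) (n k : nat) (f : 'M[R]_n -> R) : Prop :=
  if k is k'.+1 then
    (forall X, differentiable f X) /\
    (forall V : 'M[R]_n, Cfin k' (fun X => 'D_V f X))
  else continuous f.

(* None stands for infinity. *)
Definition Csmooth (R : realType) (n : nat) (p : option nat)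
    (f : 'M[R]_n -> R) : Prop :=
  if p is Some k then Cfin k f else forall k, Cfin k f.

(* The representer of the differential for the trace inner product; see
   gradientP. *)
Definition gradient (R : realType) (n : nat) (f : 'M[R]_n -> R) (X : 'M[R]_n) :
    'M[R]_n :=
  xget 0 [set G : 'M[R]_n | forall H : 'M[R]_n, 'd f X H = mxdot G H].

Definition metric_proj (R : realType) (n : nat) (S : set 'M[R]_n) (X : 'M[R]_n) :
    set 'M[R]_n :=
  [set Y | S Y /\ forall Z, S Z -> frobenius (X - Y) <= frobenius (X - Z)].

Definition Mplus (R : realType) (n : nat) : set 'M[R]_n :=
  [set X | 0 <= \det X].

Definition Mrank (R : realType) (n k : nat) : set 'M[R]_n :=
  [set X | \rank X = k].

Definition Mpos (R : realType) (n : nat) : set 'M[R]_n := [set X | 0 < \det X].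

Arguments Mplus : clear implicits.
Arguments Mrank : clear implicits.
Arguments Mpos : clear implicits.

Definition Aplus (R : realType) (n : nat) : set (set 'M[R]_n) :=
  [set M | (exists2 k, (k < n)%N & M = Mrank R n k) \/ M = Mpos R n].

Arguments Aplus : clear implicits.

Definition prec (R : realType) (n : nat) (L M : set 'M[R]_n) : Prop :=
  L `<=` closure M `\` M.

(* N 0, ..., N m.-1 are the members of a chain of m strata. *)
Definition has_chain (R : realType) (n : nat) (A : set (set 'M[R]_n))
    (m : nat) : Prop :=
  exists N : nat -> set 'M[R]_n,
    (forall i, (i < m)%N -> A (N i)) /\
    (forall i, (i.+1 < m)%N -> prec (N i) (N i.+1)).

Definition is_depth (R : realType) (n : nat) (A : set (set 'M[R]_n))
    (m : nat) : Prop :=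
  has_chain A m /\ forall m', has_chain A m' -> (m' <= m)%N.

Definition orthogonal_mx (R : realType) (n : nat) (U : 'M[R]_n) : Prop :=
  U^T *m U = 1%:M.

Definition pinv_row (R : realType) (n : nat) (x : 'rV[R]_n) : 'rV[R]_n :=
  \row_i (if x 0 i == 0 then 0 else 1 / x 0 i).

Definition is_mpinv (R : realType) (n : nat) (X Y : 'M[R]_n) : Prop :=
  exists (U V : 'M[R]_n) (x : 'rV[R]_n),
    [/\ orthogonal_mx U, orthogonal_mx V, X = U *m diag_mx x *m V^T
      & Y = V *m diag_mx (pinv_row x) *m U^T].

(* Every X has a singular value decomposition, and all of them yield the same
   Y, so the default value is never used and the choice is immaterial. *)
Definition mpinv (R : realType) (n : nat) (X : 'M[R]_n) : 'M[R]_n :=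
  xget 0 [set Y | is_mpinv X Y].

Definition mpinvT (R : realType) (n : nat) (X : 'M[R]_n) : 'M[R]_n :=
  (mpinv X)^T.

Lemma mxdotE (R : realType) (n : nat) (X Y : 'M[R]_n) :
  mxdot X Y = \sum_i \sum_j X i j * Y i j.
Proof.
rewrite /mxdot /mxtrace exchange_big /=; apply: eq_bigr => j _.
by rewrite mxE; apply: eq_bigr => i _; rewrite mxE.
Qed.

Lemma gradientP (R : realType) (n : nat) (f : 'M[R]_n -> R) (X H : 'M[R]_n) :
  'd f X H = mxdot (gradient f X) H.
Proof.
suff /(xgetPex 0) : exists G : 'M[R]_n, forall H : 'M[R]_n, 'd f X H = mxdot G H.
  exact.
exists (\matrix_(i, j) 'd f X (delta_mx i j)) => {}H.
rewrite mxdotE {1}[H]matrix_sum_delta linear_sum; apply: eq_bigr => i _.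
rewrite linear_sum; apply: eq_bigr => j _.
by rewrite linearZ mxE mulrC.
Qed.

Lemma bigcup_Aplus (R : realType) (n : nat) :
  \bigcup_(M in Aplus R n) M = Mplus R n.
Proof.
apply/seteqP; split => [X [M [[k kn ->]|->]] /=|X /=].
- rewrite /Mplus /Mrank /= => rX; suff -> : \det X = 0 by [].
  apply/eqP; apply: contraTT kn => dX.
  have uX : X \in unitmx by rewrite unitmxE unitfE.
  by rewrite -rX mxrank_unit// ltnn.
- by rewrite /Mpos /Mplus /=; exact: ltW.
rewrite /Mplus /= le_eqVlt => /orP[/eqP d0|d0]; last first.
  by exists (Mpos R n) => //; right.
exists (Mrank R n (\rank X)) => //; left; exists (\rank X) => //.
rewrite ltn_neqAle rank_leq_row andbT.
apply/negP => rX; have : X \in unitmx by rewrite -row_free_unit.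
by rewrite unitmxE unitfE -d0 eqxx.
Qed.

(* Main.v *)
(* Let phi_t be a smooth odd function that vanishes on [-t, t] and is the
   identity outside [-2t, 2t].  Applying phi_t to the singular values gives a
   smooth map Theta_t of the matrix space that is Lipschitz with a constant
   independent of t and at distance O(t) from the identity.  Near a matrix of
   rank k, the projection onto the matrices of rank k only kills the singular
   values below t, so Theta_t factors through it; and the derivative of Theta_t
   along the transposed Moore-Penrose inverse divides singular values by
   themselves, so it is smooth again.  Hence g_j = f_j o Theta_(t_j), with f_j
   a mollification of f (or f itself), has all the required properties on a
   ball, provided that t_j is small enough there.  The g_j are glued along
   S = |Theta_1|^2, which is proper and has the same invariance properties:
   g = g_0 + sum_j step(S - j) (g_(j+1) - g_j).  On the j-th shell g_(j+1) - g_j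
   is so small that the gluing costs only lip f, whence
   lip g <= (23 + 1) lip f <= 11^2 lip f.

   Smoothness of matrix functions is obtained from multiple operator integrals:
   the derivatives of A |-> f(A) on symmetric matrices are sums, over tuples of
   spectral projections of A, weighted by divided differences of f. *)
Require Import Defs.
From HB Require Import structures.
From mathcomp Require Import all_boot all_order all_algebra.
From mathcomp Require Import all_classical all_reals all_analysis.
From mathcomp Require Import complex ring lra.
Set Implicit Arguments.
Unset Strict Implicit.
Unset Printing Implicit Defensive.
Import Order.TTheory GRing.Theory Num.Theory numFieldNormedType.Exports.
Local Open Scope classical_set_scope.
Local Open Scope ring_scope.

(** * The singular value decomposition *)

(** Properties (3) and (6) are exact, so they must survive every smoothing: f is mollified first and
    composed with [Theta] afterwards, and the gluing functions depend on X only through [Theta 1 X].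
    No single t serves the whole space, because [eps], V1 and V2 may tighten at infinity; on a ball,
    compactness yields one. All strata are treated by the same map, so no induction over the
    stratification takes place and the depth enters only through m >= 1. The constant 23 exceeds 1 +
    2 * 32 / 3, a bound for the derivative of phi_t that is free of t because phi_t(s) = t phi_1(s /
    t). For smoothness, eigenvectors cannot be differentiated where eigenvalues meet; sums over
    spectral projections weighted by divided differences remain meaningful there and satisfy
    perturbation identities whose error terms are of the same kind. *)

Section LinAlg.
Context {R : realType}.

Lemma orthogonal_mxC n (U : 'M[R]_n) : orthogonal_mx U -> U *m U^T = 1%:M.
Proof. exact: mulmx1C. Qed.

Lemma orthogonal_tr n (U : 'M[R]_n) : orthogonal_mx U -> orthogonal_mx U^T.
Proof. by move=> oU; rewrite /orthogonal_mx trmxK orthogonal_mxC. Qed.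

Lemma orthogonal_mul n (U V : 'M[R]_n) :
  orthogonal_mx U -> orthogonal_mx V -> orthogonal_mx (U *m V).
Proof.
rewrite /orthogonal_mx => oU oV.
by rewrite trmx_mul mulmxA -(mulmxA V^T) oU mulmx1.
Qed.

Lemma mx11_mulE n (u : 'rV[R]_n) (v : 'cV[R]_n) :
  (u *m v) 0 0 = \sum_i u 0 i * v i 0.
Proof. by rewrite mxE. Qed.

Lemma cV_sqr_eq0 n (v : 'cV[R]_n) : v^T *m v = 0 -> v = 0.
Proof.
move=> /matrixP/(_ 0 0); rewrite mx11_mulE mxE => /eqP.
rewrite psumr_eq0; last by move=> i _; rewrite mxE -expr2 sqr_ge0.
move=> /allP v0; apply/matrixP => i j; rewrite ord1 !mxE.
by have := v0 i (mem_index_enum _); rewrite mxE /= -expr2 sqrf_eq0 => /eqP.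
Qed.

(* The reflection exchanging v and the first basis vector. *)
Lemma orthogonal_with_first_col n (v : 'cV[R]_(1 + n)) : v^T *m v = 1%:M ->
  exists2 Q : 'M[R]_(1 + n), orthogonal_mx Q & Q *m delta_mx 0 0 = v.
Proof.
move=> v1; pose e : 'cV[R]_(1 + n) := delta_mx 0 0.
have e1 : e^T *m e = 1%:M.
  apply/matrixP => i j; rewrite !ord1 mx11_mulE (bigD1 0) //= big1 => [|k k0].
    by rewrite !mxE !eqxx addr0 mulr1.
  by rewrite !mxE (negbTE k0) mulr0.
have [->|ve] := eqVneq v e.
  by exists 1%:M; rewrite ?mul1mx// /orthogonal_mx trmx1 mul1mx.
pose w := v - e; pose c := (w^T *m w) 0 0.
have wc : w^T *m w = c%:M by apply/matrixP => i j; rewrite !ord1 [RHS]mxE eqxx mulr1n.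
have c0 : c != 0.
  apply: contra ve => /eqP c0; rewrite -subr_eq0; apply/eqP/cV_sqr_eq0.
  by rewrite -/w wc c0 raddf0.
pose d := (v^T *m e) 0 0.
have vde : v^T *m e = d%:M by apply/matrixP => i j; rewrite !ord1 [RHS]mxE eqxx mulr1n.
have edv : e^T *m v = d%:M by rewrite -[e^T *m v]trmxK trmx_mul trmxK vde tr_scalar_mx.
have cd : c = 2 - 2 * d.
  have : w^T *m w = (2 - 2 * d)%:M.
    rewrite /w [(v - e)^T]raddfB /= mulmxBl !mulmxBr v1 e1 vde edv -!raddfB/=.
    by congr (_%:M); ring.
  by move/matrixP/(_ 0 0); rewrite [RHS]mxE eqxx mulr1n.
exists (1%:M - (2 / c) *: (w *m w^T)).
  rewrite /orthogonal_mx [(1%:M - _)^T]raddfB /= linearZ /= trmx_mul trmxK trmx1.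
  rewrite mulmxBl mul1mx mulmxBr mulmx1 -scalemxAl -scalemxAr -mulmxA (mulmxA w^T) wc.
  rewrite mul_scalar_mx -scalemxAr !scalerA.
  have -> : 2 / c * (2 / c * c) = 2 / c + 2 / c by field.
  by rewrite scalerDl opprB addrK subrK.
rewrite -/e mulmxBl mul1mx -scalemxAl -mulmxA.
have -> : w^T *m e = (d - 1)%:M by rewrite /w [(v - e)^T]raddfB /= mulmxBl vde e1 -raddfB.
rewrite mul_mx_scalar scalerA.
have -> : 2 / c * (d - 1) = - 1.
  by move: c0; rewrite cd => c0; field.
by rewrite scaleN1r opprK /w addrC subrK.
Qed.

Lemma trmx_nz m n (A : 'M[R]_(m, n)) : A != 0 -> A^T != 0.
Proof. by rewrite trmx_eq0. Qed.

Lemma cV_normalize n (v : 'cV[R]_n) : v != 0 ->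
  exists2 c : R, c != 0 & (c *: v)^T *m (c *: v) = 1%:M.
Proof.
move=> v0; pose c := (v^T *m v) 0 0.
have vc : v^T *m v = c%:M.
  by apply/matrixP => i j; rewrite !ord1 [RHS]mxE eqxx mulr1n.
have c0 : 0 < c.
  rewrite lt_def; apply/andP; split.
    by apply: contra v0 => /eqP c0; apply/eqP/cV_sqr_eq0; rewrite vc c0 raddf0.
  by rewrite /c mxE sumr_ge0// => i _; rewrite !mxE -expr2 sqr_ge0.
have sc0 : Num.sqrt c != 0 by rewrite sqrtr_eq0 -ltNge.
exists (Num.sqrt c)^-1; first by rewrite invr_eq0.
rewrite [(_ *: v)^T]linearZ /= -scalemxAl -scalemxAr vc !scale_scalar_mx.
by congr (_%:M); rewrite -{3}[c]sqr_sqrtr ?ltW//; field.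
Qed.

(** An eigenvalue exists over the algebraically closed field of complex numbers, and pairing its
    eigenvector with the conjugate shows that it is real. *)
Lemma symmetric_eigenvector n (A : 'M[R]_n.+1) : A^T = A ->
  exists l : R, exists2 v : 'cV[R]_n.+1, v^T *m v = 1%:M & A *m v = l *: v.
Proof.
move=> sA.
pose C := (complex R : numClosedFieldType).
pose iC : {rmorphism R -> C} := real_complex R.
pose A' : 'M[C]_n.+1 := map_mx iC A.
have conjiC x : (iC x)^* = iC x.
  by rewrite /iC; apply: conjc_real.
have [a] := eigenvalue_closed A' (ltn0Sn n).
move=> /[dup] ea /eigenvalueP[v vA v0].
have sA' : map_mx Num.conj (A'^T) = A'.
  apply/matrixP => i j; rewrite !mxE conjiC.
  by move/matrixP/(_ i j) : sA; rewrite mxE => ->.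
pose v' := map_mx Num.conj (v^T).
have vv0 : (v *m v') 0 0 != 0.
  rewrite mxE; apply: contra v0; rewrite psumr_eq0; last first.
    by move=> i _; rewrite !mxE mul_conjC_ge0.
  move=> /allP vi; apply/eqP/matrixP => i j; rewrite ord1 [RHS]mxE.
  by have /= := vi j (mem_index_enum _); rewrite !mxE mul_conjC_eq0 => /eqP.
have aa : a^* = a.
  apply: (mulIf vv0).
  have Av' : A' *m v' = a^* *: v'.
    have := congr1 (fun M => map_mx Num.conj M^T) vA.
    by rewrite /= trmx_mul map_mxM sA' linearZ /= map_mxZ.
  have : v *m A' *m v' = v *m (A' *m v') by rewrite mulmxA.
  rewrite vA Av' -scalemxAl -scalemxAr.
  by move/matrixP/(_ 0 0); rewrite !mxE => ->.
have [l al] : exists l, a = iC l.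
  case: a aa {ea vA} => x y /= [] /eqP.
  rewrite eq_sym -subr_eq0 opprK -mulr2n mulrn_eq0 /= => /eqP ->.
  by exists x.
(* The complex eigenvector need not be real. Instead, l is a root of the real characteristic
   polynomial, which provides a real eigenvector. *)
have : eigenvalue A l.
  rewrite eigenvalue_root_char -(fmorph_root iC) map_char_poly.
  by rewrite -eigenvalue_root_char -al.
move=> /eigenvalueP[u uA u0].
have [c c0 c1] : exists2 c : R, c != 0 & (c *: u^T)^T *m (c *: u^T) = 1%:M.
  by apply: cV_normalize; rewrite trmx_eq0.
exists l; exists (c *: u^T) => //.
rewrite -scalemxAr; have := congr1 trmx uA.
by rewrite trmx_mul sA linearZ /= => ->; rewrite !scalerA mulrC.
Qed.

(** The deflation step of the two inductions on the size below. *)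
Lemma block_of_first_row_col n (A : 'M[R]_(1 + n)) (a b : R) :
  A *m delta_mx 0 0 = a *: delta_mx 0 0 :> 'cV_(1 + n) ->
  A^T *m delta_mx 0 0 = b *: delta_mx 0 0 :> 'cV_(1 + n) ->
  A = block_mx a%:M 0 0 (drsubmx A).
Proof.
rewrite -!colE => cA rA; rewrite -[LHS]submxK; congr block_mx.
- apply/matrixP => i j; rewrite !ord1 !mxE eqxx mulr1n.
  have -> : lshift n (0 : 'I_1) = 0 by exact: val_inj.
  by move/matrixP/(_ 0 0) : cA; rewrite !mxE eqxx mulr1.
- apply/matrixP => i j; rewrite !ord1 !mxE.
  have -> : lshift n (0 : 'I_1) = 0 by exact: val_inj.
  by move/matrixP/(_ (rshift 1 j) 0) : rA; rewrite !mxE /= mulr0.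
- apply/matrixP => i j; rewrite !ord1 !mxE.
  have -> : lshift n (0 : 'I_1) = 0 by exact: val_inj.
  by move/matrixP/(_ (rshift 1 i) 0) : cA; rewrite !mxE /= mulr0.
Qed.

Lemma orthogonal_block n (U : 'M[R]_n) : orthogonal_mx U ->
  orthogonal_mx (block_mx (1%:M : 'M[R]_(1)) 0 0 U).
Proof.
move=> oU; rewrite /orthogonal_mx tr_block_mx mulmx_block !trmx0 trmx1.
by rewrite !mul0mx !mulmx0 mul1mx !addr0 !add0r oU -scalar_mx_block.
Qed.

Lemma block_diag_conj n (U V : 'M[R]_n) (d : 'rV[R]_n) (a : R) :
  block_mx a%:M 0 0 (U *m diag_mx d *m V^T) =
  block_mx (1%:M : 'M[R]_(1)) 0 0 U *m diag_mx (row_mx a%:M d)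
    *m (block_mx (1%:M : 'M[R]_(1)) 0 0 V)^T.
Proof.
have -> : diag_mx (row_mx (a%:M : 'M[R]_(1)) d) = block_mx a%:M 0 0 (diag_mx d).
  rewrite diag_mx_row; congr block_mx.
  by apply/matrixP => i j; rewrite !ord1 !mxE.
rewrite tr_block_mx !trmx0 trmx1 !mulmx_block !mul0mx !mulmx0 !mul1mx !mulmx1.
by rewrite ?(addr0, add0r, mul0mx, mulmx0).
Qed.

Theorem spectral_theorem n (A : 'M[R]_n) : A^T = A ->
  exists (U : 'M[R]_n) (d : 'rV[R]_n),
    orthogonal_mx U /\ A = U *m diag_mx d *m U^T.
Proof.
elim: n A => [|n IH] A sA.
  exists 1%:M, 0; split; first by rewrite /orthogonal_mx trmx1 mul1mx.
  by apply/matrixP => -[].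
have [l [v v1 Av]] := symmetric_eigenvector sA.
have [Q oQ Qv] := orthogonal_with_first_col v1.
have Qtv : Q^T *m v = delta_mx 0 0 by rewrite -Qv mulmxA oQ mul1mx.
pose B := Q^T *m A *m Q.
have sB : B^T = B by rewrite /B !trmx_mul trmxK sA mulmxA.
have Be : B *m delta_mx 0 0 = l *: delta_mx 0 0 :> 'cV_(1 + n).
  by rewrite /B -mulmxA Qv -mulmxA Av -scalemxAr Qtv.
have Bb : B = block_mx l%:M 0 0 (drsubmx B).
  by apply: (@block_of_first_row_col n B l l) => //; rewrite sB.
have sB' : (drsubmx B)^T = drsubmx B by rewrite trmx_drsub sB.
have [U [d [oU UB]]] := IH _ sB'.
exists (Q *m block_mx (1%:M : 'M[R]_(1)) 0 0 U), (row_mx (l%:M : 'M[R]_(1)) d); split.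
  exact/orthogonal_mul/orthogonal_block.
rewrite trmx_mul !mulmxA -2!(mulmxA Q) -block_diag_conj -UB -Bb.
by rewrite /B !mulmxA (orthogonal_mxC oQ) mul1mx -mulmxA (orthogonal_mxC oQ) mulmx1.
Qed.

(** For a unit eigenvector v of X^T X and u the normalization of X v, the matrix X^T sends u back to
    a multiple of v, so X splits in bases starting with u and v. The entries of x are neither
    ordered nor made nonnegative; this is harmless because only odd functions are applied to
    them. *)
Theorem singular_value_decomposition n (X : 'M[R]_n) :
  exists (U V : 'M[R]_n) (x : 'rV[R]_n),
    [/\ orthogonal_mx U, orthogonal_mx V & X = U *m diag_mx x *m V^T].
Proof.
elim: n X => [|n IH] X.
  exists 1%:M, 1%:M, 0; split; rewrite /orthogonal_mx ?trmx1 ?mul1mx//.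
  by apply/matrixP => -[].
have sXX : (X^T *m X)^T = X^T *m X by rewrite trmx_mul trmxK.
have [l [v v1 XXv]] := symmetric_eigenvector sXX.
have [u [a [b [u1 Xv Xu]]]] : exists (u : 'cV[R]_(1 + n)) (a b : R),
    [/\ u^T *m u = 1%:M, X *m v = a *: u & X^T *m u = b *: v].
  have [Xv0|Xv0] := eqVneq (X *m v) 0.
    (* If X kills v, then X is singular and u is taken from its left kernel, so that X^T u = 0. *)
    have /det0P[w w0 wX] : \det X == 0.
      apply/negPn/negP => dX.
      have uX : X \in unitmx by rewrite unitmxE unitfE.
      have v0 : v = 0 by rewrite -[v](mulKmx uX) Xv0 mulmx0.
      move: v1; rewrite v0 mulmx0 => /matrixP/(_ 0 0); rewrite !mxE eqxx.
      by move/eqP; rewrite eq_sym oner_eq0.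
    have [c c0 c1] := @cV_normalize _ w^T (trmx_nz w0).
    exists (c *: w^T), 0, 0; split => //; first by rewrite scale0r.
    by rewrite -scalemxAr -trmx_mul wX trmx0 scaler0 scale0r.
  have [c c0 c1] := cV_normalize Xv0.
  exists (c *: (X *m v)), c^-1, (c * l); split => //.
    by rewrite scalerA mulVf// scale1r.
  by rewrite -scalemxAr mulmxA XXv scalerA.
have [Qu oQu Que] := orthogonal_with_first_col u1.
have [Qv oQv Qve] := orthogonal_with_first_col v1.
have Qtu : Qu^T *m u = delta_mx 0 0 by rewrite -Que mulmxA oQu mul1mx.
have Qtv : Qv^T *m v = delta_mx 0 0 by rewrite -Qve mulmxA oQv mul1mx.
pose B := Qu^T *m X *m Qv.
have Bb : B = block_mx a%:M 0 0 (drsubmx B).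
  apply: (@block_of_first_row_col n B a b).
    by rewrite /B -mulmxA Qve -mulmxA Xv -scalemxAr Qtu.
  by rewrite /B !trmx_mul trmxK -!mulmxA Que Xu -scalemxAr Qtv.
have [U [V [d [oU oV UB]]]] := IH (drsubmx B).
exists (Qu *m block_mx (1%:M : 'M[R]_(1)) 0 0 U), (Qv *m block_mx (1%:M : 'M[R]_(1)) 0 0 V).
exists (row_mx (a%:M : 'M[R]_(1)) d); split.
- exact/orthogonal_mul/orthogonal_block.
- exact/orthogonal_mul/orthogonal_block.
rewrite trmx_mul !mulmxA -2!(mulmxA Qu) -block_diag_conj -UB -Bb.
by rewrite /B !mulmxA (orthogonal_mxC oQu) mul1mx -mulmxA (orthogonal_mxC oQv) mulmx1.
Qed.

End LinAlg.

(** * Trace inner product and Frobenius norm *)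

Section Frobenius.
Context {R : realType}.

(** Lagrange's identity: the defect is half the sum of the squares (a_i b_j - a_j b_i)^2. *)
Lemma cauchy_schwarz_sum (I : finType) (a b : I -> R) :
  (\sum_i a i * b i) ^+ 2 <= (\sum_i a i ^+ 2) * (\sum_i b i ^+ 2).
Proof.
rewrite -subr_ge0.
have -> : (\sum_i a i ^+ 2) * (\sum_i b i ^+ 2) - (\sum_i a i * b i) ^+ 2 =
    2^-1 * \sum_i \sum_j (a i * b j - a j * b i) ^+ 2.
  have sqE : \sum_i \sum_j (a i * b j - a j * b i) ^+ 2 =
     (\sum_i a i ^+ 2) * (\sum_i b i ^+ 2) + (\sum_i b i ^+ 2) * (\sum_i a i ^+ 2)
     - 2 * (\sum_i a i * b i) ^+ 2.
    rewrite expr2 !big_distrlr /= mulr_sumr -big_split /= -sumrB.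
    apply: eq_bigr => i _; rewrite mulr_sumr -big_split /= -sumrB.
    by apply: eq_bigr => j _; ring.
  by rewrite sqE; field.
by rewrite mulr_ge0 ?invr_ge0// sumr_ge0// => i _; rewrite sumr_ge0// => j _; exact: sqr_ge0.
Qed.

Context {n : nat}.
Implicit Types X Y Z U V : 'M[R]_n.

Lemma mxdotC X Y : mxdot X Y = mxdot Y X.
Proof. by rewrite !mxdotE; do 2 apply: eq_bigr => ? _; rewrite mulrC. Qed.

Lemma mxdotDr X Y Z : mxdot X (Y + Z) = mxdot X Y + mxdot X Z.
Proof. by rewrite /mxdot mulmxDr raddfD. Qed.

Lemma mxdotZr X a Y : mxdot X (a *: Y) = a * mxdot X Y.
Proof. by rewrite /mxdot -scalemxAr mxtraceZ. Qed.

Lemma mxdotDl X Y Z : mxdot (Y + Z) X = mxdot Y X + mxdot Z X.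
Proof. by rewrite mxdotC mxdotDr !(mxdotC X). Qed.

Lemma mxdot_sqr X : mxdot X X = \sum_i \sum_j X i j ^+ 2.
Proof. by rewrite mxdotE. Qed.

Lemma mxdot_ge0 X : 0 <= mxdot X X.
Proof. by rewrite mxdot_sqr; do 2 (apply: sumr_ge0 => ? _); exact: sqr_ge0. Qed.

Lemma frobenius_ge0 X : 0 <= frobenius X.
Proof. exact: sqrtr_ge0. Qed.

Lemma frobenius_sqr X : frobenius X ^+ 2 = mxdot X X.
Proof. by rewrite sqr_sqrtr// mxdot_ge0. Qed.

Lemma frobenius_coord X i j : `|X i j| <= frobenius X.
Proof.
rewrite -(ler_sqr (normr_ge0 _) (frobenius_ge0 _)) frobenius_sqr real_normK ?num_real//.
rewrite mxdot_sqr (bigD1 i)//= (bigD1 j)//= -addrA lerDl addr_ge0//.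
  by apply: sumr_ge0 => ? _; exact: sqr_ge0.
by do 2 (apply: sumr_ge0 => ? _); exact: sqr_ge0.
Qed.

Lemma mxdot_cauchy_schwarz X Y : `|mxdot X Y| <= frobenius X * frobenius Y.
Proof.
rewrite -(ler_sqr (normr_ge0 _)) ?nnegrE ?mulr_ge0 ?frobenius_ge0//.
rewrite exprMn !frobenius_sqr real_normK ?num_real// !mxdotE !pair_big /=.
exact: (@cauchy_schwarz_sum _ (fun p => X p.1 p.2) (fun p => Y p.1 p.2)).
Qed.

Lemma frobeniusD X Y : frobenius (X + Y) <= frobenius X + frobenius Y.
Proof.
rewrite -ler_sqr ?nnegrE ?addr_ge0 ?frobenius_ge0// frobenius_sqr.
rewrite mxdotDr !mxdotDl sqrrD !frobenius_sqr (mxdotC Y X).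
have := mxdot_cauchy_schwarz X Y; have := ler_norm (mxdot X Y); lra.
Qed.

Lemma frobeniusZ a X : frobenius (a *: X) = `|a| * frobenius X.
Proof.
by rewrite /frobenius mxdotZr mxdotC mxdotZr mulrA -expr2 sqrtrM ?sqr_ge0// sqrtr_sqr.
Qed.

Lemma frobeniusN X : frobenius (- X) = frobenius X.
Proof. by rewrite -scaleN1r frobeniusZ normrN1 mul1r. Qed.

Lemma frobenius_distC X Y : frobenius (X - Y) = frobenius (Y - X).
Proof. by rewrite -frobeniusN opprB. Qed.

Lemma frobenius0 : frobenius (0 : 'M[R]_n) = 0.
Proof. by rewrite -(scale0r (0 : 'M[R]_n)) frobeniusZ normr0 mul0r. Qed.

Lemma frobenius_eq0 X : (frobenius X == 0) = (X == 0).
Proof.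
apply/idP/idP => [/eqP X0|/eqP ->]; last by rewrite frobenius0.
apply/eqP/matrixP => i j; rewrite mxE; apply/eqP; rewrite -normr_eq0.
by rewrite eq_le normr_ge0 andbT -X0 frobenius_coord.
Qed.

Lemma frobenius_gt0 X : (0 < frobenius X) = (X != 0).
Proof. by rewrite lt_def frobenius_eq0 frobenius_ge0 andbT. Qed.

Lemma frobenius_sum (I : Type) (r : seq I) (P : pred I) (F : I -> 'M[R]_n) :
  frobenius (\sum_(i <- r | P i) F i) <= \sum_(i <- r | P i) frobenius (F i).
Proof.
elim/big_ind2 : _ => [|x1 y1 x2 y2 h1 h2|//]; first by rewrite frobenius0.
by rewrite (le_trans (frobeniusD _ _))// lerD.
Qed.

Lemma frobeniusM X Y : frobenius (X *m Y) <= frobenius X * frobenius Y.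
Proof.
rewrite -ler_sqr ?nnegrE ?mulr_ge0 ?frobenius_ge0// exprMn !frobenius_sqr.
rewrite !mxdot_sqr [X in _ <= _ * X]exchange_big /=.
rewrite big_distrlr /=; apply: ler_sum => i _; apply: ler_sum => j _.
by rewrite mxE; exact: cauchy_schwarz_sum.
Qed.

Lemma frobenius_tr X : frobenius X^T = frobenius X.
Proof.
rewrite /frobenius !mxdot_sqr exchange_big /=; congr Num.sqrt.
by do 2 apply: eq_bigr => ? _; rewrite mxE.
Qed.

Lemma frobenius_orthogonal_l U X : orthogonal_mx U -> frobenius (U *m X) = frobenius X.
Proof.
by move=> oU; rewrite /frobenius /mxdot trmx_mul mulmxA -(mulmxA X^T) oU mulmx1.
Qed.

Lemma frobenius_orthogonal_r U X : orthogonal_mx U -> frobenius (X *m U) = frobenius X.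
Proof.
by move=> oU; rewrite -frobenius_tr trmx_mul frobenius_orthogonal_l ?frobenius_tr//; exact: orthogonal_tr.
Qed.

(** Together with [mx_norm_le_frobenius] it lets the topology of the max norm be described by
    Frobenius balls. *)
Lemma frobenius_le_mx_norm X : frobenius X <= n%:R * `|X|.
Proof.
rewrite -ler_sqr ?nnegrE ?mulr_ge0 ?frobenius_ge0// frobenius_sqr mxdot_sqr.
have XE i j : X i j ^+ 2 <= `|X| ^+ 2.
  rewrite -[X in X <= _]real_normK ?num_real// ler_sqr ?nnegrE//.
  rewrite [leRHS]/Num.norm /= mx_normrE.
  by have := le_bigmax 0 (fun ij : (_ * _)%type => `|X ij.1 ij.2|) (i, j).
apply: (@le_trans _ _ (\sum_(i < n) \sum_(j < n) `|X| ^+ 2)).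
  by do 2 (apply: ler_sum => ? _).
by rewrite !sumr_const !card_ord exprMn (expr2 n%:R) -mulrA !mulr_natl.
Qed.

Lemma mx_norm_le_frobenius X : `|X| <= frobenius X.
Proof.
rewrite [leLHS]/Num.norm /= mx_normrE; apply: bigmax_le; first exact: frobenius_ge0.
by move=> [i j] _ /=; exact: frobenius_coord.
Qed.

Lemma orthogonal_row_sqr U i : orthogonal_mx U -> \sum_j U i j ^+ 2 = 1.
Proof.
move=> /orthogonal_mxC/matrixP/(_ i i); rewrite !mxE eqxx => e; apply: etrans e.
by apply: eq_bigr => j _; rewrite mxE.
Qed.

Lemma orthogonal_col_sqr U j : orthogonal_mx U -> \sum_i U i j ^+ 2 = 1.
Proof.
move=> /matrixP/(_ j j); rewrite !mxE eqxx => e; apply: etrans e.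
by apply: eq_bigr => i _; rewrite mxE.
Qed.

Lemma diag_mxE (d : 'rV[R]_n) i j : diag_mx d i j = d 0 i * (i == j)%:R.
Proof. by rewrite mxE mulr_natr. Qed.

Lemma mul_mx_diagE X (d : 'rV[R]_n) i j : (X *m diag_mx d) i j = X i j * d 0 j.
Proof. by rewrite mul_mx_diag mxE. Qed.

Lemma mul_diag_mxE X (d : 'rV[R]_n) i j : (diag_mx d *m X) i j = d 0 i * X i j.
Proof. by rewrite mul_diag_mx mxE. Qed.

End Frobenius.

Section Quadratic.
Context {R : realType}.

Lemma is_derive_cvg (V W : normedModType R) (f : V -> W) (x v : V) (l : W) :
  h^-1 *: (f (h *: v + x) - f x) @[h --> 0^'] --> l -> is_derive x v f l.
Proof.
move=> fl; apply: DeriveDef; first by apply/cvg_ex; exists l.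
by rewrite /derive; apply/cvg_lim.
Qed.

(** The source of derivatives at the flat point of [expflat] and from [moi_taylor]. The estimate is
    asked for |h| <= 1 only, because the constants of the latter are local. *)
Lemma is_derive_quadratic (V : normedModType R) (F : V -> R) (x v : V) (l C : R) :
  (forall h, `|h| <= 1 -> `|F (h *: v + x) - F x - h * l| <= C * h ^+ 2) ->
  is_derive x v F l.
Proof.
move=> FC; apply: is_derive_cvg; apply/cvgrPdist_le => e e0.
have C0 : 0 <= C.
  have := FC 1; rewrite normr1 expr1n mulr1 => /(_ (lexx _)).
  exact: le_trans.
near=> h.
have h0 : h != 0 by near: h; exact: nbhs_dnbhs_neq.
have h1 : `|h| <= 1.
  by near: h; apply: dnbhs0_le.
have hC : `|h| <= e / (C + 1).
  by near: h; apply: dnbhs0_le; rewrite divr_gt0// ltr_wpDl.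
have -> : l - h^-1 *: (F (h *: v + x) - F x) = - (h^-1 * (F (h *: v + x) - F x - h * l)).
  by rewrite /GRing.scale /=; field.
rewrite normrN normrM normfV ler_pdivrMl ?normr_gt0//.
apply: le_trans (FC _ h1) _.
rewrite -(real_normK (num_real h)) expr2 mulrCA ler_wpM2l//.
move: hC; rewrite ler_pdivlMr; last by rewrite ltr_wpDl.
have := normr_ge0 h; nra.
Unshelve. all: by end_near. Qed.

End Quadratic.

(** * Smooth functions of one real variable *)

Section Smooth1.
Context {R : realType}.
Implicit Types f g : R -> R.

(** Level 0 does not even ask for continuity. In [smooth1] every derivative is continuous anyway,
    being differentiable. *)
Fixpoint C1 (k : nat) f : Prop :=
  if k is k'.+1 then (forall x : R, derivable f x 1) /\ C1 k' (derive1 f) else True.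

Definition smooth1 f := forall k, C1 k f.

Lemma C1_is_derive k f : C1 k.+1 f -> forall x : R, is_derive x 1 f ((derive1 f) x).
Proof. by move=> [df _] x; rewrite derive1E; exact/derivableP. Qed.

Lemma is_derive_derive1 f g : (forall x : R, is_derive x 1 f (g x)) -> (derive1 f) = g.
Proof. by move=> df; apply/funext => x; rewrite derive1E derive_val. Qed.

Lemma C1_intro k f g : (forall x : R, is_derive x 1 f (g x)) -> C1 k g -> C1 k.+1 f.
Proof.
move=> df Cg; split; first by move=> x; exact: ex_derive.
by rewrite (is_derive_derive1 df).
Qed.

Lemma C1S k f : C1 k.+1 f -> C1 k f.
Proof. by elim: k f => [//|k IH] f [df Cf]; split=> //; exact: IH. Qed.

Lemma smooth1_is_derive f : smooth1 f -> forall x : R, is_derive x 1 f ((derive1 f) x).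
Proof. by move=> /(_ 1%N); exact: C1_is_derive. Qed.

Lemma smooth1_derive1 f : smooth1 f -> smooth1 (derive1 f).
Proof. by move=> sf k; have [] := sf k.+1. Qed.

Lemma smooth1_derive1n f m : smooth1 f -> smooth1 (derive1n m f).
Proof. by move=> sf; elim: m => [//|m IH]; rewrite derive1nS; exact: smooth1_derive1. Qed.

Lemma is_derive_continuous f g : (forall x : R, is_derive x 1 f (g x)) -> continuous f.
Proof.
move=> df x; apply: differentiable_continuous; apply/derivable1_diffP.
exact: ex_derive.
Qed.

Lemma smooth1_continuous f : smooth1 f -> continuous f.
Proof. by move=> /smooth1_is_derive; exact: is_derive_continuous. Qed.

Lemma smooth1_is_derive1n f m : smooth1 f ->
  forall x : R, is_derive x 1 (derive1n m f) (derive1n m.+1 f x).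
Proof.
by move=> sf x; rewrite derive1nS; apply: smooth1_is_derive; exact: smooth1_derive1n.
Qed.

Lemma C1_cst k (c : R) : C1 k (fun=> c).
Proof. by elim: k c => [//|k IH] c; apply: (C1_intro (g := fun=> 0)). Qed.

Lemma C1D k f g : C1 k f -> C1 k g -> C1 k (fun x => f x + g x).
Proof.
elim: k f g => [//|k IH] f g Cf Cg.
apply: (C1_intro (g := fun x => (derive1 f) x + (derive1 g) x)) => [x|].
  by apply: (@is_deriveD _ _ _ f g); [exact: (C1_is_derive Cf)|exact: (C1_is_derive Cg)].
by apply: IH; [case: Cf|case: Cg].
Qed.

Lemma C1M k f g : C1 k f -> C1 k g -> C1 k (fun x => f x * g x).
Proof.
elim: k f g => [//|k IH] f g Cf Cg.
apply: (C1_intro (g := fun x => f x * (derive1 g) x + g x * (derive1 f) x)) => [x|].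
  by apply: (@is_deriveM _ _ f g); [exact: (C1_is_derive Cf)|exact: (C1_is_derive Cg)].
by apply: C1D; apply: IH; (exact: C1S || (by case: Cf) || (by case: Cg)).
Qed.

Lemma C1Z k f c : C1 k f -> C1 k (fun x => c * f x).
Proof. by move=> Cf; apply: C1M => //; exact: C1_cst. Qed.

Lemma C1N k f : C1 k f -> C1 k (fun x => - f x).
Proof. by move=> Cf; under eq_fun do rewrite -mulN1r; exact: C1Z. Qed.

Lemma C1_id k : C1 k id.
Proof.
case: k => [//|k]; apply: (C1_intro (g := fun=> 1)); last exact: C1_cst.
Qed.

Lemma is_derive1_affine f (df a b x : R) : is_derive (a * x + b) 1 f df ->
  is_derive x 1 (fun y => f (a * y + b)) (a * df).
Proof.
move=> Hf; rewrite mulrC; apply: (@is_derive1_comp _ f (fun y => a * y + b) x df a) => //.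
by apply: is_derive_eq; rewrite addr0 /GRing.scale /= mulr1.
Qed.

Lemma C1_affine k f a b : C1 k f -> C1 k (fun x => f (a * x + b)).
Proof.
elim: k f => [//|k IH] f Cf.
apply: (C1_intro (g := fun x => a * (derive1 f) (a * x + b))) => [x|].
  by apply: is_derive1_affine; exact: (C1_is_derive Cf).
by apply: C1Z; apply: IH; case: Cf.
Qed.

Lemma C1V k f : (forall x, f x != 0) -> C1 k f -> C1 k (fun x => (f x)^-1).
Proof.
move=> f0; elim: k => [//|k IH] Cf.
apply: (C1_intro (g := fun x => - ((f x)^-1 * (f x)^-1 * (derive1 f) x))) => [x|].
  have Hf := C1_is_derive Cf x.
  apply: DeriveDef; first exact: derivableV.
  by rewrite deriveV// derive_val /GRing.scale /= expr2 invfM mulNr.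
apply: C1N; apply: C1M; last by case: Cf.
by apply: C1M; apply: IH; exact: C1S.
Qed.

End Smooth1.

Section Step.
Context {R : realType}.

(** The powers of 1/x are carried along because the derivatives of exp(-1/x) are linear combinations
    of these functions, so one induction over all m gives smoothness. *)
Definition expflat (m : nat) (x : R) : R :=
  if x <= 0 then 0 else x^-1 ^+ m * expR (- x^-1).

Lemma expflat_le0 m x : x <= 0 -> expflat m x = 0.
Proof. by rewrite /expflat => ->. Qed.

Lemma expflat_gt0E m x : 0 < x -> expflat m x = x^-1 ^+ m * expR (- x^-1).
Proof. by rewrite /expflat leNgt => ->. Qed.

Lemma expflat_ge0 m x : 0 <= expflat m x.
Proof.
rewrite /expflat; case: (ltP 0 x) => [x0|_]; last exact: lexx.
by rewrite mulr_ge0 ?expR_ge0// exprn_ge0// invr_ge0 ltW.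
Qed.

Lemma expflat_gt0 m x : 0 < x -> 0 < expflat m x.
Proof.
by move=> x0; rewrite expflat_gt0E// mulr_gt0 ?expR_gt0// exprn_gt0// invr_gt0.
Qed.

Lemma expRN_pow_le k (z : R) : 0 <= z -> z ^+ k.+1 * expR (- z) <= (k.+1)`!%:R.
Proof.
move=> z0; rewrite expRN ler_pdivrMr ?expR_gt0// mulrC -ler_pdivrMr ?ltr0n ?fact_gt0//.
by apply: le_trans (expR_ge1Dxn k z0); rewrite lerDr.
Qed.

(** Quadratic flatness at 0, which yields the derivative 0 there. *)
Lemma expflat_le m x : `|expflat m x| <= (m.+2)`!%:R * x ^+ 2.
Proof.
rewrite ger0_norm ?expflat_ge0//; have [x0|x0] := leP x 0.
  by rewrite expflat_le0// mulr_ge0 ?sqr_ge0.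
rewrite expflat_gt0E//.
have xV0 : 0 <= x^-1 by rewrite invr_ge0 ltW.
have := expRN_pow_le m.+1 xV0.
rewrite -(ler_pM2r (_ : 0 < x ^+ 2)) ?exprn_gt0//; apply: le_trans.
rewrite mulrAC ler_wpM2r ?expR_ge0// -addn2 exprD -mulrA -exprMn mulVf ?gt_eqF//.
by rewrite expr1n mulr1.
Qed.

Lemma is_derive_expflat m (x : R) :
  is_derive x 1 (expflat m) (expflat m.+2 x - m%:R * expflat m.+1 x).
Proof.
have [x0|x0|x0] := ltgtP x 0.
- rewrite !expflat_le0 ?(ltW x0)// mulr0 subr0.
  apply: (near_eq_is_derive (f := fun=> 0)).
  by near=> y; rewrite expflat_le0// ltW//; near: y; exact: lt_nbhsl.
- rewrite !expflat_gt0E//.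
  apply: (near_eq_is_derive (f := fun y : R => y^-1 ^+ m * expR (- y^-1))).
    by near=> y; rewrite expflat_gt0E//; near: y; exact: lt_nbhsr.
  have dV : is_derive x 1 (fun y : R => y^-1) (- (x^-1 ^+ 2)).
    apply: DeriveDef; first by apply: derivableV; rewrite ?gt_eqF.
    by rewrite deriveV ?gt_eqF// derive_id exprVn /GRing.scale /= mulr1.
  have dN : is_derive x 1 (fun y : R => - y^-1) (x^-1 ^+ 2).
    by rewrite -[X in is_derive _ _ _ X]opprK; apply: is_deriveN.
  have dE : is_derive x 1 (fun y : R => expR (- y^-1)) (expR (- x^-1) * x^-1 ^+ 2).
    exact: (@is_derive1_comp _ expR (fun y => - y^-1)).
  have dX : is_derive x 1 (fun y : R => y^-1 ^+ m) (m%:R * x^-1 ^+ m.-1 * - (x^-1 ^+ 2)).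
    rewrite -(exprfctE (fun y : R => y^-1)); exact: (@is_deriveX _ _ (fun y : R => y^-1) m x 1).
  apply: (is_derive_eq (is_deriveM dX dE)).
  rewrite /GRing.scale /=; case: m {dX} => [|m] /=; first by rewrite !mul0r; ring.
  by rewrite !exprS; ring.
- rewrite x0 !expflat_le0// mulr0 subr0.
  apply: (@is_derive_quadratic _ _ _ _ _ _ ((m.+2)`!%:R)) => h _.
  by rewrite addr0 /GRing.scale /= mulr1 mulr0 (expflat_le0 _ (lexx 0)) !subr0 expflat_le.
Unshelve. all: by end_near. Qed.

Lemma smooth1_expflat m : smooth1 (expflat m).
Proof.
move=> k; elim: k m => [//|k IH] m.
apply: C1_intro (is_derive_expflat m) _.
by apply: C1D => //; apply: C1N; exact: C1Z.
Qed.

Definition step (x : R) : R := expflat 0 x / (expflat 0 x + expflat 0 (1 - x)).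

(** The derivative of [step] in a closed form that shows its sign; [expflat 2] is the derivative of
    [expflat 0]. *)
Definition step' (x : R) : R :=
  (expflat 2 x * expflat 0 (1 - x) + expflat 0 x * expflat 2 (1 - x))
   / (expflat 0 x + expflat 0 (1 - x)) ^+ 2.

Lemma step_den_gt0 x : 0 < expflat 0 x + expflat 0 (1 - x).
Proof.
have [x0|x0] := leP x 0.
  by rewrite ltr_wpDl ?expflat_ge0// expflat_gt0//; lra.
by rewrite ltr_pwDl ?expflat_ge0// expflat_gt0.
Qed.

Lemma smooth1_step : smooth1 step.
Proof.
move=> k; apply: C1M; first exact: smooth1_expflat.
apply: C1V => [x|]; first by rewrite gt_eqF// step_den_gt0.
apply: C1D; first exact: smooth1_expflat.
have -> : (fun x => expflat 0 (1 - x)) = (fun x => expflat 0 (-1 * x + 1)).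
  by apply/funext => x; congr expflat; ring.
by apply: C1_affine; exact: smooth1_expflat.
Qed.

Lemma is_derive_step (x : R) : is_derive x 1 step (step' x).
Proof.
have d1 : is_derive x 1 (expflat 0) (expflat 2 x).
  by apply: (is_derive_eq (is_derive_expflat 0 _)); rewrite mul0r subr0.
have d2 : is_derive x 1 (fun y => expflat 0 (1 - y)) (- expflat 2 (1 - x)).
  have -> : (fun x => expflat 0 (1 - x)) = (fun x => expflat 0 (-1 * x + 1)).
    by apply/funext => y; congr expflat; ring.
  have d : is_derive (-1 * x + 1) 1 (expflat 0) (expflat 2 (1 - x)).
    have -> : -1 * x + 1 = 1 - x by ring.
    by apply: (is_derive_eq (is_derive_expflat 0 _)); rewrite mul0r subr0.
  by apply: (is_derive_eq (is_derive1_affine d)); rewrite mulN1r.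
have d3 : is_derive x 1 (fun y => expflat 0 y + expflat 0 (1 - y))
    (expflat 2 x - expflat 2 (1 - x)) by exact: is_deriveD.
have n0 : expflat 0 x + expflat 0 (1 - x) != 0 by rewrite gt_eqF// step_den_gt0.
have d4 : is_derive x 1 (fun y => (expflat 0 y + expflat 0 (1 - y))^-1)
    (- (expflat 0 x + expflat 0 (1 - x)) ^- 2 * (expflat 2 x - expflat 2 (1 - x))).
  apply: DeriveDef; first exact: derivableV.
  by rewrite deriveV// derive_val.
apply: (is_derive_eq (is_deriveM d1 d4)).
rewrite /step' /GRing.scale /=; field.
by rewrite n0.
Qed.

Lemma step_ge0 x : 0 <= step x.
Proof. by rewrite divr_ge0 ?expflat_ge0// ltW// step_den_gt0. Qed.

Lemma step_le1 x : step x <= 1.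
Proof. by rewrite ler_pdivrMr ?step_den_gt0// mul1r lerDl expflat_ge0. Qed.

Lemma step_le0 x : x <= 0 -> step x = 0.
Proof. by move=> x0; rewrite /step expflat_le0// mul0r. Qed.

Lemma step_ge1 x : 1 <= x -> step x = 1.
Proof.
move=> x1; rewrite /step (@expflat_le0 0 (1 - x)) ?subr_le0// addr0 divff// gt_eqF//.
by rewrite expflat_gt0// (lt_le_trans ltr01).
Qed.

Lemma step'_ge0 x : 0 <= step' x.
Proof. by rewrite divr_ge0 ?sqr_ge0// addr_ge0// mulr_ge0// expflat_ge0. Qed.

Lemma step'_le0 x : x <= 0 -> step' x = 0.
Proof. by move=> x0; rewrite /step' !(expflat_le0 _ x0) !mul0r addr0 mul0r. Qed.

Lemma step'_ge1 x : 1 <= x -> step' x = 0.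
Proof.
move=> x1; rewrite /step' !(@expflat_le0 _ (1 - x)) ?subr_le0//.
by rewrite !mulr0 addr0 mul0r.
Qed.

(** By the symmetry x <-> 1 - x it is enough to treat x <= 1/2. With p = 1/x >= 2 >= q = 1/(1 - x),
    the claim reduces to p^2 + q^2 <= 8 exp(p - q), and exp(p - q) >= (1 + (p - q)/2)^2 >= p^2/4. *)
Lemma step'_le8 x : step' x <= 8.
Proof.
have [/step'_le0->//|x0] := leP x 0.
have [/step'_ge1->//|x1] := leP 1 x.
rewrite ler_pdivrMr ?exprn_gt0 ?step_den_gt0//.
have key y z : 0 < y -> 0 < z -> y + z = 1 -> y <= z ->
    expflat 2 y * expflat 0 z + expflat 0 y * expflat 2 z <= 8 * (expflat 0 y + expflat 0 z) ^+ 2.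
  move=> y0 z0 yz1 yz; rewrite !expflat_gt0E// !expr0 !mul1r.
  set p := y^-1; set q := z^-1.
  have p2 : 2 <= p by rewrite /p -[2]invrK lef_pV2 ?posrE ?invr_gt0//; lra.
  have q2 : q <= 2 by rewrite /q -[2]invrK lef_pV2 ?posrE ?invr_gt0//; lra.
  have q0 : 0 < q by rewrite invr_gt0.
  set a := expR (- p); set b := expR (- q).
  have a0 : 0 < a by exact: expR_gt0.
  have b0 : 0 < b by exact: expR_gt0.
  suff ab : a * (p ^+ 2 + q ^+ 2) <= 8 * b by nra.
  have bE : b = a * expR (p - q) by rewrite /a /b -expRD; congr expR; ring.
  rewrite bE mulrCA ler_pM2l//.
  have pq : 0 <= (p - q) / 2 by lra.
  have h : (1 + (p - q) / 2) ^+ 2 <= expR (p - q).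
    have -> : expR (p - q) = expR ((p - q) / 2) ^+ 2.
      by rewrite -expRM_natl; congr expR; field.
    by rewrite lerXn2r ?nnegrE ?expR_ge0 ?addr_ge0// expR_ge1Dx.
  nra.
have [x2|x2] := leP x (1 - x); first by apply: key => //; lra.
rewrite addrC [X in _ * X ^+ 2]addrC [X in X + _]mulrC [X in _ + X]mulrC; apply: key; lra.
Qed.

End Step.

(** * Divided differences *)

Section Integrals.
Context {R : realType}.
Local Notation mu := (@lebesgue_measure R).

Lemma continuous_integrable (k : R -> R) (a b : R) : continuous k ->
  mu.-integrable `[a, b] (EFin \o k).
Proof.
move=> ck; apply: continuous_compact_integrable; first exact: segment_compact.
exact: continuous_subspaceT.
Qed.

(** Joint continuity bounds the derivative on a compact rectangle around t0, and this constant
    serves as the dominating function. *)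
Lemma is_derive_Rintegral (a b t0 : R) (k dk : R -> R -> R) :
  (forall t, continuous (k t)) ->
  (forall t s, `|t - t0| < 1 -> is_derive t 1 (k ^~ s) (dk t s)) ->
  continuous (fun p : R * R => dk p.1 p.2) ->
  is_derive t0 1 (fun t => \int[mu]_(s in `[a, b]) k t s)
    (\int[mu]_(s in `[a, b]) dk t0 s).
Proof.
move=> ck kdk cdk.
have It0 : `]t0 - 1, t0 + 1[%classic t0 by rewrite /= in_itv /=; apply/andP; split; lra.
have I1 t : `]t0 - 1, t0 + 1[%classic t -> `|t - t0| < 1.
  by rewrite /= in_itv /= ltr_distl => /andP[? ?]; apply/andP; split; lra.
have cK : compact (`[t0 - 1, t0 + 1]%classic `*` `[a, b]%classic).
  by apply: compact_setX; exact: segment_compact.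
have [C [_ HC']] := compact_bounded (continuous_compact (continuous_subspaceT cdk) cK).
have HC M p : C < M -> (`[t0 - 1, t0 + 1]%classic `*` `[a, b]%classic) p ->
    `|dk p.1 p.2| <= M.
  by move=> CM Kp; apply: (HC' _ CM); exists p.
pose M := `|C + 1|.
have HM t s : `]t0 - 1, t0 + 1[%classic t -> `[a, b]%classic s -> `|dk t s| <= M.
  move=> It Is; apply: (HC M (t, s)).
    by rewrite (lt_le_trans _ (ler_norm _))// ltrDl.
  by split => //; exact: subset_itv_oo_cc.
have dkE t s : `]t0 - 1, t0 + 1[%classic t -> partial1of2 k t s = dk t s.
  by move=> It; rewrite partial1of2E; have := kdk t s (I1 _ It) => ?; rewrite derive_val.
have mB : measurable `[a, b]%classic by exact: measurable_itv.
have ik t : `]t0 - 1, t0 + 1[%classic t -> mu.-integrable `[a, b] (EFin \o k t).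
  by move=> _; exact: continuous_integrable.
have dk1 t s : `]t0 - 1, t0 + 1[%classic t -> `[a, b]%classic s -> derivable (k ^~ s) t 1.
  by move=> It _; have := kdk t s (I1 _ It) => ?; exact: ex_derive.
have iG : mu.-integrable `[a, b] (EFin \o (fun=> M)).
  by apply: continuous_integrable => x; exact: cst_continuous.
have GM t s : `]t0 - 1, t0 + 1[%classic t -> `[a, b]%classic s -> `|partial1of2 k t s| <= M.
  by move=> It Is; rewrite dkE//; exact: HM.
have G0 (s : R) : 0 <= M by exact: normr_ge0.
apply: DeriveDef.
  exact: (@derivable_under_integral R _ _ mu k _ mB _ _ _ It0 ik dk1 _ G0 iG GM).
rewrite -derive1E (@differentiation_under_integral R _ _ mu k _ mB _ _ _ It0 ik dk1 _ G0 iG GM)//.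
by apply: eq_Rintegral => s Is; rewrite dkE.
Qed.

Lemma Rintegral_bound (k : R -> R) (C : R) : continuous k ->
  (forall s, 0 <= s <= 1 -> `|k s| <= C) ->
  `|\int[mu]_(s in `[0, 1]) k s| <= C.
Proof.
move=> ck kC.
apply: (@le_trans _ _ (\int[mu]_(s in `[0, 1]) `|k s|)).
  by apply: le_normr_Rintegral; [exact: measurable_itv|exact: continuous_integrable].
apply: (@le_trans _ _ (\int[mu]_(s in `[0, 1]) (fun=> C) s)).
  have c1 : continuous (fun s => `|k s|).
    by move=> x; apply: continuous_comp; [exact: ck|exact: norm_continuous].
  have c2 : continuous (fun _ : R => C) by move=> x; exact: cst_continuous.
  apply: le_Rintegral; [exact: measurable_itv|exact: continuous_integrable c1|exact: continuous_integrable c2|].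
  by move=> x; rewrite /= in_itv /= => /kC.
rewrite Rintegral_cst//=.
by rewrite lebesgue_measure_itv /= lte_fin ltr01 /= subr0 mulr1.
Qed.

Lemma Rintegral_FTC2 (F f : R -> R) (a b : R) : a < b ->
  (forall x : R, is_derive x 1 F (f x)) -> continuous f ->
  \int[mu]_(x in `[a, b]) f x = F b - F a.
Proof.
move=> ab dF cf; rewrite /Rintegral (@continuous_FTC2 _ f F)//.
- exact: continuous_subspaceT.
- have cF := is_derive_continuous dF.
  split => [x _||]; first exact: ex_derive.
    exact/cvg_at_right_filter/cF.
  exact/cvg_at_left_filter/cF.
- by move=> x _; rewrite (is_derive_derive1 dF).
Qed.

End Integrals.

Section DividedDifference.
Context {R : realType}.
Local Notation mu := (@lebesgue_measure R).
Implicit Types f g : R -> R.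

(** The node comes first, so that [divdiff x f] is again a function of one variable and higher
    divided differences arise by iteration. *)
Definition divdiff (x : R) f (y : R) : R :=
  if y == x then derive1 f x else (f y - f x) / (y - x).

Lemma divdiffE x f y : (y - x) * divdiff x f y = f y - f x.
Proof.
rewrite /divdiff; case: eqVneq => [->|yx]; first by rewrite !subrr mul0r.
by rewrite mulrC divfK// subr_eq0.
Qed.

Lemma divdiff_diag x f : divdiff x f x = derive1 f x.
Proof. by rewrite /divdiff eqxx. Qed.

(** Hermite's integral formula f[x, y] = \int_0^1 f'(x + s (y - x)) ds, differentiated m times in y.
    It makes smoothness across the diagonal visible. *)
Definition divdiff_jet (x : R) f (m : nat) (y : R) : R :=
  \int[mu]_(s in `[0, 1]) (s ^+ m * derive1n m.+1 f (x + s * (y - x))).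

Lemma divdiff_integrand_continuous x f m : smooth1 f ->
  continuous (fun p : R * R => p.2 ^+ m * derive1n m.+1 f (x + p.2 * (p.1 - x))).
Proof.
move=> sf p; apply: cvgM.
  apply: (@cvg_comp _ _ _ snd (fun s : R => s ^+ m)); first exact: cvg_snd.
  exact: exprn_continuous.
apply: (@cvg_comp _ _ _ (fun p : R * R => x + p.2 * (p.1 - x)) (derive1n m.+1 f) _
   (nbhs (x + p.2 * (p.1 - x)))); last exact/smooth1_continuous/smooth1_derive1n.
apply: cvgD; first exact: cvg_cst.
apply: cvgM; first exact: cvg_snd.
by apply: cvgB; [exact: cvg_fst|exact: cvg_cst].
Qed.

Lemma divdiff_integrand_continuous2 x f m y : smooth1 f ->
  continuous (fun s : R => s ^+ m * derive1n m.+1 f (x + s * (y - x))).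
Proof.
move=> sf s; apply: cvgM; first exact: exprn_continuous.
apply: (@cvg_comp _ _ _ (fun s : R => x + s * (y - x)) (derive1n m.+1 f) _
   (nbhs (x + s * (y - x)))); last exact/smooth1_continuous/smooth1_derive1n.
apply: cvgD; first exact: cvg_cst.
by apply: cvgM; [exact: cvg_id|exact: cvg_cst].
Qed.

Lemma is_derive_divdiff_jet x f m (y : R) : smooth1 f ->
  is_derive y 1 (divdiff_jet x f m) (divdiff_jet x f m.+1 y).
Proof.
move=> sf.
apply: (@is_derive_Rintegral _ 0 1 y (fun y s => s ^+ m * derive1n m.+1 f (x + s * (y - x)))
  (fun y s => s ^+ m.+1 * derive1n m.+2 f (x + s * (y - x)))).
- by move=> t; exact: divdiff_integrand_continuous2.
- move=> t s _.
  have d1 : is_derive t 1 (fun y => derive1n m.+1 f (s * y + (x - s * x)))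
     (s * derive1n m.+2 f (s * t + (x - s * x))).
    exact/is_derive1_affine/smooth1_is_derive1n.
  have E u : x + s * (u - x) = s * u + (x - s * x) by ring.
  rewrite E exprSr -mulrA.
  under eq_fun do rewrite E.
  exact: (@is_deriveZ _ _ _ (fun y => derive1n m.+1 f (s * y + (x - s * x)))).
- exact: divdiff_integrand_continuous.
Qed.

Lemma divdiff_jet0 x f : smooth1 f -> divdiff_jet x f 0 = divdiff x f.
Proof.
move=> sf; apply/funext => y; rewrite /divdiff_jet /divdiff.
case: eqVneq => [->|yx].
  rewrite subrr (@eq_Rintegral _ _ _ mu _ (fun=> derive1 f x)); last first.
    by move=> s _; rewrite expr0 mul1r mulr0 addr0.
  rewrite Rintegral_cst//=.
  by rewrite lebesgue_measure_itv /= lte_fin ltr01 /= subr0 mulr1.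
have dF (s : R) : is_derive s 1 (fun s => (y - x)^-1 * f ((y - x) * s + x))
    (s ^+ 0 * derive1n 1 f (x + s * (y - x))).
  have d1 : is_derive s 1 (fun s => f ((y - x) * s + x)) ((y - x) * derive1 f ((y - x) * s + x)).
    exact/is_derive1_affine/smooth1_is_derive.
  apply: (is_derive_eq (is_deriveZ _ d1)).
  rewrite /GRing.scale /= mulrA mulVf ?subr_eq0// expr0 !mul1r.
  by congr (derive1 f _); ring.
rewrite (Rintegral_FTC2 ltr01 dF); last exact: divdiff_integrand_continuous2.
by rewrite mulr1 mulr0 add0r subrK -mulrBr mulrC.
Qed.

Lemma derive1n_divdiff x f m : smooth1 f -> derive1n m (divdiff x f) = divdiff_jet x f m.
Proof.
move=> sf; elim: m => [|m IH]; first by rewrite divdiff_jet0.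
rewrite derive1nS IH; apply: is_derive_derive1 => y; exact: is_derive_divdiff_jet.
Qed.

Lemma smooth1_divdiff x f : smooth1 f -> smooth1 (divdiff x f).
Proof.
move=> sf; rewrite -divdiff_jet0//.
suff H k m : C1 k (divdiff_jet x f m) by move=> k; exact: H.
elim: k m => [//|k IH] m.
by apply: C1_intro (IH m.+1) => y; exact: is_derive_divdiff_jet.
Qed.

(** The integrand is evaluated on the segment from x to y, which stays in the ball. Iterated, the
    bound controls divided differences of any order uniformly in the nodes. *)
Lemma divdiff_bound x f m r C y : smooth1 f ->
  (forall z, `|z| <= r -> `|derive1n m.+1 f z| <= C) ->
  `|x| <= r -> `|y| <= r -> `|derive1n m (divdiff x f) y| <= C.
Proof.
move=> sf fC xr yr; rewrite derive1n_divdiff//.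
apply: Rintegral_bound; first exact: divdiff_integrand_continuous2.
move=> s /andP[s0 s1]; rewrite normrM -[leRHS]mul1r ler_pM//.
  by rewrite normrX exprn_ile1// ger0_norm.
apply: fC; have -> : x + s * (y - x) = (1 - s) * x + s * y by ring.
apply: (le_trans (ler_normD _ _)); rewrite !normrM (ger0_norm s0) ger0_norm ?subr_ge0//.
have := ler_wpM2l s0 yr; have : (1 - s) * `|x| <= (1 - s) * r by rewrite ler_wpM2l// subr_ge0.
  lra.
Qed.

Lemma divdiff_lin x f g (a b : R) : smooth1 f -> smooth1 g ->
  divdiff x (fun y => a * f y + b * g y) =
  (fun y => a * divdiff x f y + b * divdiff x g y).
Proof.
move=> sf sg; apply/funext => y; rewrite /divdiff; case: eqVneq => _; last by ring.
have df := smooth1_is_derive sf x; have dg := smooth1_is_derive sg x.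
rewrite derive1E.
have d : is_derive x 1 (fun y => a * f y + b * g y) (a * derive1 f x + b * derive1 g x).
  by apply: (@is_deriveD _ _ _ (fun y => a * f y) (fun y => b * g y)); exact: is_deriveZ.
by rewrite derive_val.
Qed.

(** The recursion (x - y) f[x, y, z] = f[x, z] - f[y, z], including all confluent cases; it drives
    the perturbation formula [moi_sub]. *)
Lemma divdiff_divdiff x y f : smooth1 f ->
  (fun z => (x - y) * divdiff x (divdiff y f) z) = (fun z => divdiff x f z - divdiff y f z).
Proof.
move=> sf; apply/funext => z.
have [->|xy] := eqVneq x y; first by rewrite !subrr mul0r.
have xy0 : x - y != 0 by rewrite subr_eq0.
have yx0 : y - x != 0 by rewrite subr_eq0 eq_sym.
have [->|zx] := eqVneq z x.
  (* For z = x, the identity (z - y) f[y, z] = f(z) - f(y) is differentiated at x. *)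
  have E : (fun z => (z - y) * divdiff y f z) = (fun z => f z - f y).
    by apply/funext => u; exact: divdiffE.
  have d1 : is_derive x 1 (fun z => f z - f y) (derive1 f x).
    have df := smooth1_is_derive sf x.
    by apply: (is_derive_eq (is_deriveB df (is_derive_cst _ _ _))); rewrite subr0.
  have d2 : is_derive x 1 (fun z => (z - y) * divdiff y f z)
      ((x - y) * derive1 (divdiff y f) x + divdiff y f x).
    have dd := smooth1_is_derive (smooth1_divdiff y sf) x.
    have dB : is_derive x 1 (fun z => z - y) 1.
      by apply: (is_derive_eq (is_deriveB (is_derive_id _ _) (is_derive_cst _ _ _))); rewrite subr0.
    by apply: (is_derive_eq (is_deriveM dB dd)); rewrite /GRing.scale /= mulr1.
  rewrite !divdiff_diag; apply/eqP; rewrite -subr_eq0 opprB addrA subr_eq0; apply/eqP.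
  rewrite -(@derive_val _ _ _ _ _ _ _ d2) E.
  by rewrite derive_val.
rewrite {1}/divdiff (negbTE zx).
have zx0 : z - x != 0 by rewrite subr_eq0.
have xE : divdiff y f x = (f x - f y) / (x - y) by rewrite /divdiff (negbTE xy).
have [->|zy] := eqVneq z y.
  rewrite divdiff_diag xE /divdiff [y == x]eq_sym (negbTE xy).
  by field; rewrite xy0 yx0.
rewrite /divdiff (negbTE zx) (negbTE zy) (negbTE xy).
have zy0 : z - y != 0 by rewrite subr_eq0.
by field; rewrite xy0 zx0 zy0.
Qed.

End DividedDifference.

(** * Multiple operator integrals *)

Section SpectralProjections.
Context {R : realType} {n : nat}.
Implicit Types A B H V : 'M[R]_n.

(** An arbitrary choice, with no regularity in A. All later estimates rest on algebraic identities
    that hold for any choice. *)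
Definition spectral_pair A : 'M[R]_n * 'rV[R]_n :=
  xget (1%:M, 0) [set p | orthogonal_mx p.1 /\ A = p.1 *m diag_mx p.2 *m p.1^T].

Definition eigval A (i : 'I_n) : R := (spectral_pair A).2 0 i.

Definition eigproj A (i : 'I_n) : 'M[R]_n :=
  (spectral_pair A).1 *m delta_mx i i *m (spectral_pair A).1^T.

Lemma spectral_pairP A : A^T = A ->
  orthogonal_mx (spectral_pair A).1 /\
  A = (spectral_pair A).1 *m diag_mx (spectral_pair A).2 *m (spectral_pair A).1^T.
Proof.
move=> sA; have [U [d [oU AE]]] := spectral_theorem sA.
suff : [set p : 'M[R]_n * 'rV[R]_n | orthogonal_mx p.1 /\ A = p.1 *m diag_mx p.2 *m p.1^T]
  (spectral_pair A) by [].
by apply: xgetPex; exists (U, d).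
Qed.

Lemma sum_eigproj A : A^T = A -> \sum_i eigproj A i = 1%:M.
Proof.
move=> /spectral_pairP[oU _]; rewrite /eigproj -mulmx_suml -mulmx_sumr.
have -> : \sum_i delta_mx i i = 1%:M :> 'M[R]_n.
  by rewrite -diag_const_mx diag_mx_sum_delta; apply: eq_bigr => i _; rewrite mxE scale1r.
by rewrite mulmx1 orthogonal_mxC.
Qed.

Lemma mul_diag_delta (d : 'rV[R]_n) i : diag_mx d *m delta_mx i i = d 0 i *: delta_mx i i.
Proof.
apply/matrixP => a b; rewrite mul_diag_mxE !mxE.
by case: eqVneq => [->|_]//; rewrite /= !mulr0.
Qed.

Lemma mul_delta_diag (d : 'rV[R]_n) i : delta_mx i i *m diag_mx d = d 0 i *: delta_mx i i.
Proof.
apply/matrixP => a b; rewrite mul_mx_diagE !mxE mulrC.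
by case: (b =P i) => [->|_]//; rewrite andbF !mulr0.
Qed.

Lemma mulmx_eigproj A i : A^T = A -> A *m eigproj A i = eigval A i *: eigproj A i.
Proof.
move=> /spectral_pairP[oU AE]; rewrite {1}AE /eigproj -!mulmxA (mulmxA _^T) oU mul1mx.
by rewrite (mulmxA (diag_mx _)) mul_diag_delta -scalemxAl -scalemxAr.
Qed.

Lemma eigproj_mulmx A i : A^T = A -> eigproj A i *m A = eigval A i *: eigproj A i.
Proof.
move=> /spectral_pairP[oU AE]; rewrite {2}AE /eigproj -!mulmxA (mulmxA _^T) oU mul1mx.
by rewrite (mulmxA (delta_mx _ _)) mul_delta_diag -scalemxAl -scalemxAr.
Qed.

Lemma frobenius_delta i j : frobenius (delta_mx i j : 'M[R]_n) = 1.
Proof.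
rewrite /frobenius mxdot_sqr (bigD1 i)//= (bigD1 j)//= !big1 ?addr0.
- by rewrite !mxE !eqxx expr1n sqrtr1.
- by move=> k ki; rewrite big1// => l _; rewrite !mxE (negbTE ki) expr0n.
- by move=> k kj; rewrite !mxE (negbTE kj) andbF expr0n.
Qed.

Lemma frobenius_eigproj A i : A^T = A -> frobenius (eigproj A i) = 1.
Proof.
move=> /spectral_pairP[oU _].
rewrite frobenius_orthogonal_r; last exact: orthogonal_tr.
by rewrite frobenius_orthogonal_l// frobenius_delta.
Qed.

Lemma eigval_le A i : A^T = A -> `|eigval A i| <= frobenius A.
Proof.
move=> sA; have [_ _] := spectral_pairP sA.
rewrite -[leLHS]mulr1 -(frobenius_eigproj i sA) -frobeniusZ -mulmx_eigproj//.
by rewrite (le_trans (frobeniusM _ _))// frobenius_eigproj// mulr1.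
Qed.

(* The multiple operator integral with symbol the k-th divided difference of f:
   for s = [:: (H1, A1); ...; (Hk, Ak)] it is the sum of
   f[a0, ..., ak] P0 H1 P1 ... Hk Pk over the spectral resolutions of A, A1, ..., Ak. *)
Fixpoint moi (f : R -> R) A (s : seq ('M[R]_n * 'M[R]_n)) : 'M[R]_n :=
  \sum_i eigproj A i *m
    match s with
    | [::] => (f (eigval A i))%:M
    | p :: s' => p.1 *m moi (divdiff (eigval A i) f) p.2 s'
    end.

Arguments moi : simpl never.

(** The right factor of a summand as a function of the eigenvalue, so that empty and nonempty slot
    lists are treated alike. *)
Definition moi_factor (f : R -> R) (s : seq ('M[R]_n * 'M[R]_n)) (x : R) : 'M[R]_n :=
  match s with
  | [::] => (f x)%:M
  | p :: s' => p.1 *m moi (divdiff x f) p.2 s'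
  end.

Lemma moiE f A s : moi f A s = \sum_i eigproj A i *m moi_factor f s (eigval A i).
Proof. by case: s. Qed.

Lemma moi_lin (f g : R -> R) (a b : R) A s : smooth1 f -> smooth1 g ->
  moi (fun x => a * f x + b * g x) A s = a *: moi f A s + b *: moi g A s.
Proof.
elim: s f g A => [|p s IH] f g A sf sg; rewrite !moiE /= !scaler_sumr -big_split /=;
  apply: eq_bigr => i _; rewrite !scalemxAr -mulmxDr; congr (_ *m _).
  by rewrite raddfD /= -!scale_scalar_mx.
by rewrite divdiff_lin// IH; [rewrite mulmxDr -!scalemxAr|exact: smooth1_divdiff..].
Qed.

(** Raising the order of the divided difference divides the increment of the factor by x - y; no
    case distinction x = y is needed. *)
Lemma moi_factorB f s (x y : R) : smooth1 f ->
  (x - y) *: match s with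
    | [::] => (divdiff x f y)%:M
    | p :: s' => p.1 *m moi (divdiff y (divdiff x f)) p.2 s'
    end = moi_factor f s x - moi_factor f s y.
Proof.
move=> sf; case: s => [|p s] /=.
  rewrite scale_scalar_mx -raddfB /= -[x - y]opprB mulNr divdiffE opprB.
  by [].
rewrite scalemxAr -mulmxBr; congr (_ *m _).
have sx := smooth1_divdiff x sf; have sy := smooth1_divdiff y sf.
(* The recursion is padded with [0 * f z] so that [moi_lin] applies to both sides. *)
have E : (fun z => (x - y) * divdiff y (divdiff x f) z + 0 * f z) =
    (fun z => 1 * divdiff x f z + (-1) * divdiff y f z).
  have := divdiff_divdiff y x sf => /(congr1 (fun h z => - h z)) /= E.
  apply/funext => z; move/(congr1 (fun h => h z)): E => /= E.
  have -> : (x - y) * divdiff y (divdiff x f) z = - ((y - x) * divdiff y (divdiff x f) z) by ring.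
  rewrite E; ring.
have := congr1 (fun h => moi h p.2 s) E; rewrite /= !moi_lin//; last exact: smooth1_divdiff.
by rewrite scale0r addr0 scale1r scaleN1r.
Qed.

(** The perturbation formula. If P_i and Q_j are the spectral projections of B and A, then P_i (B -
    A) Q_j = (b_i - a_j) P_i Q_j, and [moi_factorB] absorbs the factor b_i - a_j. A difference thus
    becomes an integral with one more slot, which carries B - A. *)
Lemma moi_sub f A B s : smooth1 f -> A^T = A -> B^T = B ->
  moi f B s - moi f A s = moi f B ((B - A, A) :: s).
Proof.
move=> sf sA sB; rewrite [RHS]moiE /=.
(* Into each of the two terms the resolution of the identity of the other matrix is inserted. *)
transitivity (\sum_i \sum_j (eigproj B i *m eigproj A j) *m
    (moi_factor f s (eigval B i) - moi_factor f s (eigval A j))).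
  under eq_bigr do under eq_bigr do rewrite mulmxBr.
  under eq_bigr do rewrite sumrB.
  rewrite sumrB; congr (_ - _).
    rewrite moiE; apply: eq_bigr => i _.
    by rewrite -mulmx_suml -mulmx_sumr sum_eigproj// mulmx1.
  rewrite exchange_big /= moiE; apply: eq_bigr => i _.
  by rewrite -mulmx_suml -mulmx_suml sum_eigproj// mul1mx.
apply: eq_bigr => i _; rewrite mulmxA moiE mulmx_sumr; apply: eq_bigr => j _.
rewrite [RHS]mulmxA [eigproj B i *m (B - A)]mulmxBr mulmxBl eigproj_mulmx// -(mulmxA _ A) mulmx_eigproj//.
rewrite -scalemxAl -scalemxAr -scalerBl -scalemxAl scalemxAr; congr (_ *m _).
by rewrite -moi_factorB//; case: s.
Qed.

Lemma moiZ f A c V B s : moi f A ((c *: V, B) :: s) = c *: moi f A ((V, B) :: s).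
Proof.
rewrite !moiE scaler_sumr; apply: eq_bigr => i _ /=.
by rewrite -scalemxAl -scalemxAr.
Qed.

Definition insert_all V : seq 'M[R]_n -> seq (seq 'M[R]_n) :=
  fix loop Hs := if Hs is H :: Hs' then (V :: Hs) :: map (cons H) (loop Hs') else [:: [:: V]].

Definition moi_diag f A (Hs : seq 'M[R]_n) := moi f A [seq (H, A) | H <- Hs].

(** The Leibniz rule: A occurs as base matrix in each of the gaps between the Hs and at both ends,
    and by [moi_sub] moving one occurrence inserts V in that gap. *)
Definition moi_deriv f A V Hs := \sum_(L <- insert_all V Hs) moi_diag f A L.

Lemma moi_diag_cons f A H Hs : moi_diag f A (H :: Hs) =
  \sum_i eigproj A i *m (H *m moi_diag (divdiff (eigval A i) f) A Hs).
Proof. by []. Qed.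

Lemma moi_deriv_cons f A V H Hs :
  moi_deriv f A V (H :: Hs) = moi_diag f A [:: V, H & Hs] +
   \sum_i eigproj A i *m (H *m moi_deriv (divdiff (eigval A i) f) A V Hs).
Proof.
rewrite /moi_deriv [insert_all _ (_ :: _)]/= big_cons big_map; congr (_ + _).
under eq_bigr do rewrite moi_diag_cons.
rewrite exchange_big; apply: eq_bigr => i _.
by rewrite -mulmx_sumr -mulmx_sumr.
Qed.

Lemma moi_derivZ f A c V Hs : moi_deriv f A (c *: V) Hs = c *: moi_deriv f A V Hs.
Proof.
elim: Hs f => [|H Hs IH] f.
  by rewrite /moi_deriv /= !big_seq1 /moi_diag /= moiZ.
rewrite !moi_deriv_cons scalerDr /moi_diag /= moiZ; congr (_ + _).
rewrite scaler_sumr; apply: eq_bigr => i _.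
by rewrite IH -!scalemxAr.
Qed.

Definition frobenius_prod (s : seq ('M[R]_n * 'M[R]_n)) : R := \prod_(p <- s) frobenius p.1.

Lemma frobenius_prod_ge0 s : 0 <= frobenius_prod s.
Proof. by apply: prodr_ge0 => p _; exact: frobenius_ge0. Qed.

Lemma frobenius_prod_cons H B s :
  frobenius_prod ((H, B) :: s) = frobenius H * frobenius_prod s.
Proof. by rewrite /frobenius_prod big_cons. Qed.

Lemma frobenius_prod_nil : frobenius_prod [::] = 1.
Proof. by rewrite /frobenius_prod big_nil. Qed.

Lemma frobenius_scalar c : frobenius (c%:M : 'M[R]_n) <= n%:R * `|c|.
Proof.
rewrite -[c%:M]mulmx1 mul_scalar_mx frobeniusZ mulrC ler_wpM2r//.
rewrite -ler_sqr ?nnegrE ?frobenius_ge0// frobenius_sqr /mxdot trmx1 mulmx1 mxtrace1.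
by rewrite -natrX ler_nat; case: (n) => // k; rewrite -mulnn leq_pmulr.
Qed.

Lemma frobenius_sum_eigproj A (F : 'I_n -> 'M[R]_n) c : A^T = A ->
  (forall i, frobenius (F i) <= c) ->
  frobenius (\sum_i eigproj A i *m F i) <= n%:R * c.
Proof.
move=> sA Fc; apply: (le_trans (frobenius_sum _ _ _)).
apply: (@le_trans _ _ (\sum_(i < n) c)).
  apply: ler_sum => i _; apply: (le_trans (frobeniusM _ _)).
  by rewrite frobenius_eigproj// mul1r.
by rewrite sumr_const card_ord mulr_natl.
Qed.

Definition in_ball (r : R) A := A^T = A /\ frobenius A <= r.

(** The directions agree and only the base matrices may differ. With s' = s it merely says that the
    base matrices lie in the ball. *)
Fixpoint slots_close (d r : R) (s' s : seq ('M[R]_n * 'M[R]_n)) : Prop :=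
  match s', s with
  | [::], [::] => True
  | p' :: t', p :: t => [/\ p'.1 = p.1, in_ball r p'.2, in_ball r p.2,
      frobenius (p'.2 - p.2) <= d & slots_close d r t' t]
  | _, _ => False
  end.

Lemma slots_close_refl d r s' s : 0 <= d -> slots_close d r s' s -> slots_close d r s s.
Proof.
move=> d0; elim: s' s => [|p' t' IH] [|p t] //= [_ _ bp _ /IH tt].
by split => //; rewrite subrr frobenius0.
Qed.

(** Each slot costs one derivative of f. Every sum over the n projections, all of norm 1,
    contributes a factor n, and one more comes from the norm of a scalar matrix. *)
Lemma moi_bound f A s r C d : smooth1 f -> in_ball r A -> slots_close d r s s ->
  (forall z, `|z| <= r -> `|derive1n (size s) f z| <= C) ->
  frobenius (moi f A s) <= n%:R ^+ (size s).+2 * C * frobenius_prod s.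
Proof.
have E k (x y : R) : n%:R ^+ k.+1 * x * y = n%:R * (n%:R ^+ k * x * y).
  by rewrite exprS !mulrA.
elim: s f A => [|[H B] s IH] f A sf [sA Ar] ss fC; rewrite moiE E;
  apply: frobenius_sum_eigproj => // i.
  rewrite frobenius_prod_nil mulr1 expr1; apply: (le_trans (frobenius_scalar _)).
  rewrite ler_wpM2l//; apply: fC; apply: le_trans Ar; exact: eigval_le.
case: ss => _ [sB Br] _ _ ss; apply: (le_trans (frobeniusM _ _)).
rewrite frobenius_prod_cons mulrCA ler_wpM2l ?frobenius_ge0//.
apply: IH => //; first exact: smooth1_divdiff.
move=> z zr; apply: divdiff_bound zr => //.
by apply: le_trans Ar; exact: eigval_le.
Qed.

(** The base matrices are exchanged one at a time, each at the price of one application of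
    [moi_sub], which explains the number of terms. *)
Lemma moi_lipschitz f A' A s' s r C d : smooth1 f -> 0 <= d ->
  in_ball r A' -> in_ball r A -> frobenius (A' - A) <= d -> slots_close d r s' s ->
  (forall z, `|z| <= r -> `|derive1n (size s).+1 f z| <= C) ->
  frobenius (moi f A' s' - moi f A s) <=
    (size s).+1%:R * (n%:R ^+ (size s).+3 * C * frobenius_prod s * d).
Proof.
move=> sf d0; elim: s' s f A' A sf => [|[H' B'] s' IH] [|[H B] s] f A' A sf bA' bA dA // ss fC.
  have [[sA' rA'] [sA rA]] := (bA', bA).
  rewrite moi_sub// mul1r.
  have := @moi_bound f A' [:: (A' - A, A)] r C d sf bA'.
  rewrite frobenius_prod_cons frobenius_prod_nil !mulr1 => H.
  apply: (le_trans (H _ fC)); first by split => //; rewrite subrr frobenius0.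
  have C0 : 0 <= C by apply: le_trans (fC 0 _); rewrite ?normr0// (le_trans _ rA)// frobenius_ge0.
  by rewrite ler_wpM2l// mulr_ge0// exprn_ge0.
have [[sA' rA'] [sA rA]] := (bA', bA).
have C0 : 0 <= C by apply: le_trans (fC 0 _); rewrite ?normr0// (le_trans _ rA)// frobenius_ge0.
case: ss => HH bB' bB dB ss; have {}HH : H' = H := HH; subst H'.
(* The inner base matrices are exchanged while A' is kept, and then A' is replaced by A. *)
have -> : moi f A' ((H, B') :: s') - moi f A ((H, B) :: s) =
    \sum_i eigproj A' i *m (H *m (moi (divdiff (eigval A' i) f) B' s' - moi (divdiff (eigval A' i) f) B s))
    + moi f A' [:: (A' - A, A), (H, B) & s].
  rewrite -moi_sub// addrA; congr (_ - _); rewrite !moiE -big_split /=.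
  apply: eq_bigr => i _; rewrite -mulmxDr -mulmxDr.
  by rewrite subrK.
apply: (le_trans (frobeniusD _ _)).
rewrite -[size ((H, B) :: s)]/((size s).+1).
rewrite -[(size s).+2%:R]natr1 mulrDl mul1r; apply: lerD.
  have E (x y z : R) : n%:R ^+ (size s).+4 * x * y * z = n%:R * (n%:R ^+ (size s).+3 * x * y * z).
    by rewrite exprS !mulrA.
  rewrite E mulrCA; apply: frobenius_sum_eigproj => // i.
  apply: (le_trans (frobeniusM _ _)).
  have h := IH s (divdiff (eigval A' i) f) B' B (smooth1_divdiff _ sf) bB' bB dB ss.
  apply: (@le_trans _ _ (frobenius H * ((size s).+1%:R * (n%:R ^+ (size s).+3 * C * frobenius_prod s * d)))).
    rewrite ler_wpM2l ?frobenius_ge0//; apply: h => z zr; apply: divdiff_bound zr => //.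
    by apply: le_trans rA'; exact: eigval_le.
  rewrite frobenius_prod_cons.
  by rewrite le_eqVlt; apply/orP; left; apply/eqP; ring.
have := @moi_bound f A' [:: (A' - A, A), (H, B) & s] r C d sf bA'.
rewrite !frobenius_prod_cons => h.
apply: (le_trans (h _ fC)).
  split => //; first by rewrite subrr frobenius0.
  split => //; first by rewrite subrr frobenius0.
  exact: slots_close_refl ss.
have X0 : 0 <= n%:R ^+ (size s).+4 * C * (frobenius H * frobenius_prod s).
  apply: mulr_ge0; last by apply: mulr_ge0; [exact: frobenius_ge0|exact: frobenius_prod_ge0].
  by apply: mulr_ge0 => //; apply: exprn_ge0; exact: ler0n.
apply: le_trans (ler_wpM2l X0 dA).
rewrite -[size [:: _, _ & s]]/((size s).+2).
by rewrite le_eqVlt; apply/orP; left; apply/eqP; ring.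
Qed.

Lemma slots_close_diag Hs A' A r : in_ball r A' -> in_ball r A ->
  slots_close (frobenius (A' - A)) r [seq (H, A') | H <- Hs] [seq (H, A) | H <- Hs].
Proof. by move=> bA' bA; elim: Hs => [|H Hs IH] //=; split. Qed.

(** K must be chosen before f, since the induction replaces f by its divided differences at the
    eigenvalues of A. *)
Lemma moi_taylor Hs : exists2 K : R, 0 <= K & forall f A' A r C, smooth1 f ->
  in_ball r A' -> in_ball r A ->
  (forall z, `|z| <= r -> `|derive1n (size Hs).+2 f z| <= C) ->
  frobenius (moi_diag f A' Hs - moi_diag f A Hs - moi_deriv f A (A' - A) Hs)
    <= K * C * frobenius (A' - A) ^+ 2.
Proof.
elim: Hs => [|H Hs [K K0 IH]].
  exists (2 * n%:R ^+ 4) => [|f A' A r C sf bA' bA fC]; first by apply: mulr_ge0 => //; apply: exprn_ge0; exact: ler0n.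
  have [[sA' rA'] [sA rA]] := (bA', bA).
  rewrite /moi_diag /moi_deriv /= big_seq1 /moi_diag /= moi_sub//.
  have := @moi_lipschitz f A' A [:: (A' - A, A)] [:: (A' - A, A)] r C (frobenius (A' - A)) sf
    (frobenius_ge0 _) bA' bA (lexx _) _ fC.
  rewrite frobenius_prod_cons frobenius_prod_nil mulr1 => h; apply: (le_trans (h _)).
    by split => //; rewrite subrr frobenius0 frobenius_ge0.
  rewrite -[size [:: _]]/1%N.
  by rewrite le_eqVlt; apply/orP; left; apply/eqP; ring.
(* [frobenius_prod] reads only the directions; the base matrices 0 are placeholders. *)
exists (n%:R * (frobenius H * K) + (size Hs).+3%:R * (n%:R ^+ (size Hs).+4.+1 * frobenius_prod [seq (H, 0 : 'M[R]_n) | H <- H :: Hs])).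
  apply: addr_ge0.
    by apply: mulr_ge0 => //; apply: mulr_ge0 => //; exact: frobenius_ge0.
  apply: mulr_ge0 => //; apply: mulr_ge0; last exact: frobenius_prod_ge0.
  by apply: exprn_ge0; exact: ler0n.
move=> f A' A r C sf bA' bA fC; have [[sA' rA'] [sA rA]] := (bA', bA).
set d := frobenius (A' - A).
pose s := [seq (H, A) | H <- Hs]; pose s' := [seq (H, A') | H <- Hs].
have ss : slots_close d r s' s by exact: slots_close_diag.
(* The remainder splits into that of the inner integral, with the first projection frozen at A, and
   a difference of integrals that already contain A' - A. The latter is quadratic by
   [moi_lipschitz]. *)
have -> : moi_diag f A' (H :: Hs) - moi_diag f A (H :: Hs) - moi_deriv f A (A' - A) (H :: Hs) =
    \sum_i eigproj A i *m (H *m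
      (moi_diag (divdiff (eigval A i) f) A' Hs - moi_diag (divdiff (eigval A i) f) A Hs
        - moi_deriv (divdiff (eigval A i) f) A (A' - A) Hs)) +
    (moi f A' [:: (A' - A, A), (H, A') & s'] - moi f A [:: (A' - A, A), (H, A) & s]).
  rewrite moi_deriv_cons opprD addrA; rewrite -moi_sub//.
  under [X in _ = X + _]eq_bigr do rewrite !mulmxBr.
  rewrite !sumrB.
  have -> : moi_diag f A (H :: Hs) = \sum_i eigproj A i *m (H *m moi_diag (divdiff (eigval A i) f) A Hs).
    by rewrite /moi_diag /= moiE.
  have -> : moi f A ((H, A') :: s') = \sum_i eigproj A i *m (H *m moi_diag (divdiff (eigval A i) f) A' Hs).
    by rewrite /moi_diag moiE.
  rewrite /moi_diag /= -/s -/s'.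
  set a := moi f A' _; set b := \sum_i _; set c := \sum_i _; set e := moi f A _; set g := \sum_i _.
  by apply/matrixP => i j; rewrite !mxE; ring.
apply: (le_trans (frobeniusD _ _)); rewrite mulrDl mulrDl; apply: lerD.
  rewrite -!mulrA; apply: frobenius_sum_eigproj => // i.
  apply: (le_trans (frobeniusM _ _)); rewrite ler_wpM2l ?frobenius_ge0//.
  rewrite mulrA; apply: IH bA' bA _; first exact: smooth1_divdiff.
  by move=> z zr; apply: divdiff_bound zr => //; apply: le_trans rA; exact: eigval_le.
have ss2 : slots_close d r [:: (A' - A, A), (H, A') & s'] [:: (A' - A, A), (H, A) & s].
  by split => //; rewrite subrr frobenius0 frobenius_ge0.
have := @moi_lipschitz f A' A _ _ r C d sf (frobenius_ge0 _) bA' bA (lexx _) ss2.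
rewrite -[size [:: _, _ & s]]/((size s).+2) size_map => /(_ fC); move/le_trans; apply.
have -> : frobenius_prod [:: (A' - A, A), (H, A) & s] =
    d * frobenius_prod [seq (H, 0 : 'M[R]_n) | H <- H :: Hs].
  by rewrite !frobenius_prod_cons /frobenius_prod !big_map.
by rewrite le_eqVlt; apply/orP; left; apply/eqP; ring.
Qed.

End SpectralProjections.

(** * Functions of a matrix of class C^k *)

Section MatrixDifferential.
Context {R : realType}.

Lemma is_derive_line (V : normedModType R) (F : V -> R) (Y v : V) (t l : R) :
  is_derive (t *: v + Y) v F l -> is_derive t 1 (fun t => F (t *: v + Y)) l.
Proof.
move=> dF; apply: is_derive_cvg.
have E (h : R) : h *: (1 : R) + t = h + t by rewrite /GRing.scale /= mulr1.
under eq_fun do rewrite E scalerDl -addrA.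
have <- := @derive_val _ _ _ _ _ _ _ dF.
exact: (@ex_derive _ _ _ _ _ _ _ dF).
Qed.

Lemma is_derive_of_line (V : normedModType R) (F : V -> R) (Y v : V) (l : R) :
  is_derive (0 : R) 1 (fun t : R => F (t *: v + Y)) l -> is_derive Y v F l.
Proof.
move=> dF; apply: is_derive_cvg.
have -> : (fun h : R => h^-1 *: (F (h *: v + Y) - F Y)) =
    (fun h : R => h^-1 *: (F ((h *: (1 : R) + 0) *: v + Y) - F ((0 : R) *: v + Y))).
  by apply/funext => h; rewrite addr0 scale0r add0r /GRing.scale /= mulr1.
have <- := @derive_val _ _ _ _ _ _ _ dF.
exact: (@ex_derive _ _ _ _ _ _ _ dF).
Qed.

Lemma mvt_line (V : normedModType R) (F : V -> R) (Y v : V) (h : R) :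
  (forall t, derivable F (t *: v + Y) v) ->
  exists2 t, `|t| <= `|h| & F (h *: v + Y) - F Y = h * 'D_v F (t *: v + Y).
Proof.
move=> dF; pose u t := F (t *: v + Y).
have du (t : R) : is_derive t 1 u ('D_v F (t *: v + Y)).
  by apply: is_derive_line; exact/derivableP.
have cu := is_derive_continuous du.
have u0 : u 0 = F Y by rewrite /u scale0r add0r.
have [h0|h0|->] := ltgtP h 0; last first.
- by exists 0; rewrite // scale0r add0r subrr mul0r.
- have [t] := MVT h0 (fun x _ => du x) (continuous_subspaceT cu).
  rewrite in_itv /= => /andP[t0 th] E; exists t; first by rewrite !gtr0_norm// ltW.
  by rewrite -u0 -/(u h) E subr0 mulrC.
- have [t] := MVT h0 (fun x _ => du x) (continuous_subspaceT cu).
  rewrite in_itv /= => /andP[t0 th] E; exists t.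
    by rewrite !ltr0_norm// lerN2 ltW.
  by rewrite -u0 -/(u h) -opprB E sub0r mulrN opprK mulrC.
Qed.

Context {n : nat}.
Implicit Types F G : 'M[R]_n -> R.

Lemma continuous_sumr (T : topologicalType) (I : Type) (r : seq I) (F : I -> T -> R) :
  (forall i, continuous (F i)) -> continuous (fun x => \sum_(i <- r) F i x).
Proof.
move=> cF; elim: r => [|i r IH].
  have -> : (fun x => \sum_(i <- [::]) F i x) = (fun=> 0) by apply/funext => x; rewrite big_nil.
  by move=> x; exact: cvg_cst.
have -> : (fun x => \sum_(j <- i :: r) F j x) = (fun x => F i x + \sum_(j <- r) F j x).
  by apply/funext => x; rewrite big_cons.
by move=> x; apply: cvgD; [exact: cF|exact: IH].
Qed.

Lemma mxdot_linear_for (C : 'M[R]_n) : linear_for *:%R (mxdot C : 'M[R]_n -> R^o).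
Proof. by move=> a X Y; rewrite mxdotDr mxdotZr. Qed.

Lemma continuous_mxdot (C : 'M[R]_n) : continuous (mxdot C).
Proof.
move=> X; have -> : mxdot C = (fun Y => \sum_i \sum_j C i j * Y i j) by apply/funext => Y; exact: mxdotE.
move: X; apply: continuous_sumr => i; apply: continuous_sumr => j X.
apply: (@continuousM R 'M[R]_n (fun=> C i j) (fun Y => Y i j) X); first exact: cst_continuous.
exact: coord_continuous.
Qed.

Lemma differentiable_mxdot_approx F (X C : 'M[R]_n) :
  (forall e, 0 < e -> \forall H \near (0 : 'M[R]_n),
     `|F (H + X) - F X - mxdot C H| <= e * `|H|) -> differentiable F X.
Proof.
move=> FC.
pose L : {linear 'M[R]_n -> R^o} := HB.pack (mxdot C : 'M[R]_n -> R^o)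
  (GRing.isLinear.Build R 'M[R]_n R^o _ (mxdot C : 'M[R]_n -> R^o) (mxdot_linear_for C)).
have cL : continuous L by exact: continuous_mxdot.
have FL : F \o shift X = cst (F X) + L +o_ (0 : 'M[R]_n) id.
  apply/eqaddoP => e e0; apply: filterS (FC _ e0) => H.
  by rewrite /= opprD addrA.
apply/diff_locallyP; rewrite (diff_unique cL FL); split=> //.
Qed.

(** X + H is reached one coordinate at a time, with the mean value theorem on each leg and
    continuity of the partial derivatives at X. *)
Lemma differentiable_of_partials F X :
  (forall Y i j, derivable F Y (delta_mx i j)) ->
  (forall i j, continuous (fun Y => 'D_(delta_mx i j) F Y)) ->
  differentiable F X.
Proof.
move=> dF cF; pose E (p : 'I_n * 'I_n) : 'M[R]_n := delta_mx p.1 p.2.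
pose C : 'M[R]_n := \matrix_(i, j) 'D_(delta_mx i j) F X.
pose part (s : seq ('I_n * 'I_n)) (H : 'M[R]_n) := \sum_(p <- s) H p.1 p.2 *: E p.
have Hp (H : 'M[R]_n) p : `|H p.1 p.2| <= `|H|.
  rewrite [leRHS]/Num.norm /= mx_normrE.
  by have := le_bigmax 0 (fun ij : 'I_n * 'I_n => `|H ij.1 ij.2|) p.
have E1 p : `|E p| <= 1.
  apply: le_trans (mx_norm_le_frobenius _) _.
  by rewrite frobenius_delta.
have part_le s H : `|part s H| <= (size s)%:R * `|H|.
  elim: s => [|p s IH]; first by rewrite /part big_nil normr0 mul0r.
  rewrite /part big_cons -/(part s H) (le_trans (ler_normD _ _))//=.
  rewrite -addn1 natrD mulrDl mul1r addrC lerD// normrZ -[leRHS]mulr1 ler_pM//.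
have key s e : 0 < e -> \forall H \near (0 : 'M[R]_n),
    `|F (part s H + X) - F X - \sum_(p <- s) H p.1 p.2 * C p.1 p.2| <= (size s)%:R * e * `|H|.
  move=> e0; elim: s => [|p s IH].
    near=> H; rewrite /part !big_nil add0r subrr subr0 normr0 !mul0r//.
  have [d /= d0 dC] : exists2 d : R, 0 < d & forall Y, `|X - Y| < d -> `|C p.1 p.2 - 'D_(E p) F Y| <= e.
    have /cvgrPdist_le/(_ e e0)/nbhs_ballP[d /= d0 dC] := cF p.1 p.2 X.
    exists d => // Y XY; rewrite mxE; apply: dC.
    by rewrite -ball_normE /=.
  near=> H.
  have [t th tE] := @mvt_line _ F (part s H + X) (E p) (H p.1 p.2) (fun t => dF _ _ _).
  have -> : part (p :: s) H + X = H p.1 p.2 *: E p + (part s H + X).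
    by rewrite /part big_cons addrA.
  rewrite big_cons.
  have -> : F (H p.1 p.2 *: E p + (part s H + X)) - F X -
     (H p.1 p.2 * C p.1 p.2 + \sum_(p <- s) H p.1 p.2 * C p.1 p.2) =
     H p.1 p.2 * ('D_(E p) F (t *: E p + (part s H + X)) - C p.1 p.2) +
     (F (part s H + X) - F X - \sum_(p <- s) H p.1 p.2 * C p.1 p.2).
    by rewrite mulrBr -tE; ring.
  rewrite (le_trans (ler_normD _ _))//= -(addn1 (size s)) natrD mulrDl mulrDl mul1r addrC lerD//.
    by near: H; exact: IH.
  rewrite normrM mulrC ler_pM// distrC; apply: dC.
  rewrite addrA opprD addrCA subrr addr0 normrN.
  apply: (@le_lt_trans _ _ ((size s).+1%:R * `|H|)).
    rewrite (le_trans (ler_normD _ _))// -addn1 natrD mulrDl mul1r addrC lerD//.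
    by rewrite normrZ -[leRHS]mulr1 ler_pM// (le_trans th).
  rewrite mulrC -ltr_pdivlMr//.
  by near: H; apply: (@pseudometric_normed_Zmodule.nbhs0_lt R 'M[R]_n); rewrite divr_gt0.
apply: (@differentiable_mxdot_approx _ _ C) => e e0.
pose s := enum {: 'I_n * 'I_n}.
have s0 : 0 < (size s).+1%:R :> R by [].
have es : 0 < e / (size s).+1%:R by rewrite divr_gt0.
apply: filterS (key s _ es) => H.
have -> : part s H = H.
  rewrite /part big_enum /= [RHS]matrix_sum_delta pair_big /=.
  by [].
have -> : \sum_(p <- s) H p.1 p.2 * C p.1 p.2 = mxdot C H.
  rewrite big_enum /= mxdotE pair_big /=.
  by apply: eq_bigr => p _; rewrite mulrC.
move=> h; apply: (le_trans h); rewrite ler_wpM2r//.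
rewrite mulrCA ger_pMr// ler_pdivrMr// mul1r ler_nat//.
Unshelve. all: by end_near. Qed.

End MatrixDifferential.

Section CfinCalculus.
Context {R : realType}.

Lemma is_derive_val (V W : normedModType R) (F : V -> W) x v l :
  is_derive x v F l -> 'D_v F x = l.
Proof. by move=> dF; exact: derive_val. Qed.

Section OneDim.
Context {n : nat}.
Implicit Types F G : 'M[R]_n -> R.

Lemma derive_differentiable_sum F X V : differentiable F X ->
  'D_V F X = \sum_i \sum_j V i j * 'D_(delta_mx i j) F X.
Proof.
move=> dF; rewrite deriveE// {1}[V]matrix_sum_delta linear_sum; apply: eq_bigr => i _.
by rewrite linear_sum; apply: eq_bigr => j _; rewrite linearZ deriveE.
Qed.

Lemma Cfin_differentiable k F : Cfin k.+1 F -> forall X, differentiable F X.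
Proof. by case. Qed.

Lemma Cfin_derive k F V : Cfin k.+1 F -> Cfin k (fun X => 'D_V F X).
Proof. by case=> _ /(_ V). Qed.

Lemma Cfin_continuous k F : Cfin k F -> continuous F.
Proof.
by case: k => [//|k] [dF _] X; exact: differentiable_continuous.
Qed.

Lemma CfinS k F : Cfin k.+1 F -> Cfin k F.
Proof.
elim: k F => [|k IH] F CF; first exact: Cfin_continuous CF.
by split=> [|V]; [exact: Cfin_differentiable CF|apply: IH; exact: Cfin_derive].
Qed.

Lemma Cfin_is_derive k F X V : Cfin k.+1 F -> is_derive X V F ('D_V F X).
Proof. by move=> /Cfin_differentiable dF; apply/derivableP/diff_derivable. Qed.

Lemma Cfin_cst k c : Cfin k (fun _ : 'M[R]_n => c).
Proof.
elim: k c => [|k IH] c; first by move=> X; exact: cst_continuous.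
split=> [X|V]; first exact: differentiable_cst.
have -> : (fun X : 'M[R]_n => 'D_V (fun=> c) X) = (fun=> 0).
  by apply/funext => X; exact: derive_cst.
exact: IH.
Qed.

Lemma CfinD k F G : Cfin k F -> Cfin k G -> Cfin k (fun X => F X + G X).
Proof.
elim: k F G => [|k IH] F G CF CG; first by move=> X; apply: (@continuousD _ _ _ F G X); [exact: CF|exact: CG].
split=> [X|V].
  by apply: (@differentiableD _ _ _ F G); [case: CF|case: CG].
have -> : (fun X => 'D_V (fun X => F X + G X) X) = (fun X => 'D_V F X + 'D_V G X).
  apply/funext => X; have dF := Cfin_is_derive X V CF; have dG := Cfin_is_derive X V CG.
  by rewrite (is_derive_val (is_deriveD dF dG)).
by apply: IH; exact: Cfin_derive.
Qed.

Lemma CfinM k F G : Cfin k F -> Cfin k G -> Cfin k (fun X => F X * G X).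
Proof.
elim: k F G => [|k IH] F G CF CG.
  by move=> X; apply: (@continuousM R 'M[R]_n F G X); [exact: CF|exact: CG].
split=> [X|V].
  by apply: (@differentiableM _ _ F G); [case: CF|case: CG].
have -> : (fun X => 'D_V (fun X => F X * G X) X) = (fun X => F X * 'D_V G X + G X * 'D_V F X).
  apply/funext => X; have dF := Cfin_is_derive X V CF; have dG := Cfin_is_derive X V CG.
  by rewrite (is_derive_val (is_deriveM dF dG)).
by apply: CfinD; apply: IH; (exact: Cfin_derive || exact: CfinS).
Qed.

Lemma CfinZ k F c : Cfin k F -> Cfin k (fun X => c * F X).
Proof. by move=> CF; apply: CfinM => //; exact: Cfin_cst. Qed.

Lemma CfinB k F G : Cfin k F -> Cfin k G -> Cfin k (fun X => F X - G X).
Proof.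
move=> CF CG; apply: CfinD => //.
by under eq_fun do rewrite -mulN1r; exact: CfinZ.
Qed.

Lemma Cfin_sum k (I : Type) (r : seq I) (F : I -> 'M[R]_n -> R) :
  (forall i, Cfin k (F i)) -> Cfin k (fun X => \sum_(i <- r) F i X).
Proof.
move=> CF; elim: r => [|i r IH].
  have -> : (fun X => \sum_(i <- [::]) F i X) = (fun=> 0) by apply/funext => x; rewrite big_nil.
  exact: Cfin_cst.
have -> : (fun X => \sum_(j <- i :: r) F j X) = (fun X => F i X + \sum_(j <- r) F j X).
  by apply/funext => x; rewrite big_cons.
exact: CfinD.
Qed.

(** Reduces the Fréchet condition in [Cfin] to partial derivatives, so that inductions on k need
    only formulas for directional derivatives. *)
Lemma Cfin_intro k F :
  (forall X i j, derivable F X (delta_mx i j)) ->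
  (forall i j, Cfin k (fun X => 'D_(delta_mx i j) F X)) -> Cfin k.+1 F.
Proof.
move=> dF CF.
have dfF X : differentiable F X.
  by apply: differentiable_of_partials => // i j; exact: Cfin_continuous.
split=> [//|V].
have -> : (fun X => 'D_V F X) = (fun X => \sum_i \sum_j V i j * 'D_(delta_mx i j) F X).
  by apply/funext => X; exact: derive_differentiable_sum.
by apply: Cfin_sum => i; apply: Cfin_sum => j; exact: CfinZ.
Qed.

Lemma Cfin_is_derive_intro k F (G : 'M[R]_n -> 'M[R]_n -> R) :
  (forall X V, is_derive X V F (G V X)) -> (forall V, Cfin k (G V)) -> Cfin k.+1 F.
Proof.
move=> dF CG; apply: Cfin_intro => [X i j|i j]; first exact: ex_derive.
have -> : (fun X => 'D_(delta_mx i j) F X) = G (delta_mx i j) by apply/funext => X; rewrite derive_val.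
exact: CG.
Qed.

Lemma Cfin_coord k i j : Cfin k (fun X : 'M[R]_n => X i j).
Proof.
case: k => [|k]; first exact: coord_continuous.
apply: (@Cfin_is_derive_intro _ _ (fun V _ => V i j)) => [X V|V]; last exact: Cfin_cst.
apply: (@is_derive_quadratic _ _ _ _ _ _ 0) => h _.
by rewrite !mxE mul0r addrK subrr normr0.
Qed.

Lemma is_derive_comp1 (u : R -> R) u' F X V : differentiable F X ->
  is_derive (F X) 1 u u' -> is_derive X V (fun X => u (F X)) ('D_V F X * u').
Proof.
move=> dF du; have dfu : differentiable u (F X) by apply/derivable1_diffP; exact: ex_derive.
have duF := @differentiable_comp _ _ _ _ F u X dF dfu.
apply: DeriveDef; first exact: diff_derivable.
rewrite (deriveE _ duF) (@diff_comp _ _ _ _ F u X dF dfu) /= (deriveE _ dF).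
rewrite -(is_derive_val du) -derive1E derive1E'//.
by rewrite -[X in 'd u _ X = _]mulr1 [LHS]linearZ.
Qed.

Lemma Cfin_comp1 k (u : R -> R) F : smooth1 u -> Cfin k F -> Cfin k (fun X => u (F X)).
Proof.
elim: k u F => [|k IH] u F su CF.
  by move=> X; apply: continuous_comp; [exact: CF|exact: smooth1_continuous].
apply: (@Cfin_is_derive_intro _ _ (fun V X => 'D_V F X * derive1 u (F X))) => [X V|V].
  by apply: is_derive_comp1; [exact: Cfin_differentiable CF X|exact: smooth1_is_derive].
apply: CfinM; first exact: Cfin_derive.
by apply: IH; [exact: smooth1_derive1|exact: CfinS].
Qed.

End OneDim.

Lemma differentiable_mx m n (V : normedModType R) (Phi : V -> 'M[R]_(m, n)) X :
  (forall i j, differentiable (fun X => Phi X i j) X) -> differentiable Phi X.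
Proof.
move=> dP.
have -> : Phi = \sum_i \sum_j (fun X => Phi X i j *: (delta_mx i j : 'M[R]_(m, n))).
  apply/funext => Y; rewrite fct_sumE [LHS]matrix_sum_delta; apply: eq_bigr => i _.
  by rewrite fct_sumE.
apply: differentiable_sum => i; apply: differentiable_sum => j.
exact: differentiableZl.
Qed.

Lemma continuous_mx (T : topologicalType) m n (Phi : T -> 'M[R]_(m, n)) :
  (forall i j, continuous (fun X => Phi X i j)) -> continuous Phi.
Proof.
move=> cP X A [P PX PA].
have : \forall Y \near X, forall i j, P i j (Phi Y i j).
  by do 2 (apply: filter_forall => ?); exact: cP.
by apply: filterS => Y PY; exact: PA.
Qed.

Lemma diff_mxE m n (V : normedModType R) (Phi : V -> 'M[R]_(m, n)) X v i j :
  differentiable Phi X -> 'd Phi X v i j = 'D_v (fun X => Phi X i j) X.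
Proof.
move=> dP; rewrite -deriveE// derive_mx ?mxE//.
exact: diff_derivable.
Qed.

Lemma derive_compE m n (F : 'M[R]_n -> R) (Phi : 'M[R]_m -> 'M[R]_n) X V :
  (forall i j, differentiable (fun X => Phi X i j) X) -> differentiable F (Phi X) ->
  differentiable (fun X => F (Phi X)) X /\
  'D_V (fun X => F (Phi X)) X =
    \sum_i \sum_j 'D_V (fun X => Phi X i j) X * 'D_(delta_mx i j) F (Phi X).
Proof.
move=> /differentiable_mx dP dF.
have dFP := @differentiable_comp _ _ _ _ Phi F X dP dF; split => //.
rewrite (deriveE _ dFP) (@diff_comp _ _ _ _ Phi F X dP dF) /= -deriveE//.
rewrite derive_differentiable_sum//.
by apply: eq_bigr => i _; apply: eq_bigr => j _; rewrite diff_mxE.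
Qed.

Lemma Cfin_comp k m n (F : 'M[R]_n -> R) (Phi : 'M[R]_m -> 'M[R]_n) :
  (forall i j, Cfin k (fun X => Phi X i j)) -> Cfin k F -> Cfin k (fun X => F (Phi X)).
Proof.
elim: k F => [|k IH] F CP CF.
  by move=> X; apply: continuous_comp; [exact: continuous_mx|exact: CF].
have dP X i j : differentiable (fun X => Phi X i j) X by exact: Cfin_differentiable (CP i j) X.
have dF X : differentiable F X by exact: Cfin_differentiable CF X.
split=> [X|V]; first by have [] := derive_compE 0 (dP X) (dF (Phi X)).
have -> : (fun X => 'D_V (fun X => F (Phi X)) X) = fun X =>
    \sum_i \sum_j 'D_V (fun X => Phi X i j) X * 'D_(delta_mx i j) F (Phi X).
  by apply/funext => X; have [] := derive_compE V (dP X) (dF (Phi X)).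
apply: Cfin_sum => i; apply: Cfin_sum => j; apply: CfinM; first exact: Cfin_derive.
by apply: (IH (fun Y => 'D_(delta_mx i j) F Y)) => [a b|]; [exact: CfinS (CP a b)|exact: Cfin_derive].
Qed.

Lemma Cfin_leq n k q (F : 'M[R]_n -> R) : (k <= q)%N -> Cfin q F -> Cfin k F.
Proof.
move=> kq; rewrite -(subnK kq); elim: (q - k)%N => [//|l IH].
by rewrite addSn => /CfinS.
Qed.

(** Lets finite and infinite p be handled by one argument. *)
Lemma Csmooth_Cfin n (p : option nat) (F : 'M[R]_n -> R) :
  Csmooth p F <-> forall k, (if p is Some q then (k <= q)%N else true) -> Cfin k F.
Proof.
case: p => [q|] /=; split => [CF k|CF].
- by move=> kq; exact: Cfin_leq CF.
- exact: CF.
- by move=> _; exact: CF.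
- by move=> k; exact: CF.
Qed.

End CfinCalculus.

(** * Functions of the singular values *)

Section FunctionalCalculus.
Context {R : realType}.

Lemma smooth1_bounded (f : R -> R) m r : smooth1 f ->
  exists C, forall z, `|z| <= r -> `|derive1n m f z| <= C.
Proof.
move=> sf; have cf : continuous (derive1n m f) by exact/smooth1_continuous/smooth1_derive1n.
have [C [_ HC]] := compact_bounded (continuous_compact (continuous_subspaceT cf) (@segment_compact _ (- r) r)).
exists (C + 1) => z zr; apply: (HC (C + 1)); first by rewrite ltrDl.
by exists z => //=; rewrite in_itv /= -ler_norml.
Qed.

Context {n : nat}.
Implicit Types X Y V : 'M[R]_n.

Lemma near_frobenius X d : 0 < d -> \forall Y \near X, frobenius (Y - X) < d.
Proof.
move=> d0; apply/nbhs_normP; exists (d / (n%:R + 1)).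
  by rewrite /= divr_gt0// ltr_wpDl.
move=> Y /=; rewrite ltr_pdivlMr ?ltr_wpDl// => XY.
apply: le_lt_trans XY; rewrite frobenius_distC; apply: (le_trans (frobenius_le_mx_norm _)).
by rewrite mulrC ler_wpM2l// lerDl.
Qed.

Lemma nbhs_frobeniusP X (A : set 'M[R]_n) : nbhs X A <->
  exists2 d, 0 < d & forall Y, frobenius (Y - X) < d -> A Y.
Proof.
split=> [/nbhs_normP[d /= d0 dA]|[d d0 dA]]; last first.
  by apply: (@filterS _ (nbhs X) (nbhs_filter X) _ _ _ (near_frobenius X d0)) => Y; exact: dA.
exists d => // Y YX; apply: dA => /=.
by apply: le_lt_trans YX; rewrite frobenius_distC mx_norm_le_frobenius.
Qed.

Lemma continuous_at_lipschitz (F : 'M[R]_n -> R) X K :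
  (forall Y, frobenius (Y - X) <= 1 -> `|F Y - F X| <= K * frobenius (Y - X)) ->
  {for X, continuous F}.
Proof.
move=> FK; apply/(@cvgrPdist_le _ _ _ (nbhs X) (nbhs_filter X)) => e e0.
have K1 : 0 < `|K| + 1 by rewrite ltr_wpDl.
have d0 : 0 < Num.min 1 (e / (`|K| + 1)) by rewrite lt_min ltr01 divr_gt0.
apply: (@filterS _ (nbhs X) (nbhs_filter X) _ _ _ (near_frobenius X d0)) => Y; rewrite lt_min => /andP[Y1 Ye].
rewrite distrC; apply: (le_trans (FK _ (ltW Y1))).
move: Ye; rewrite ltr_pdivlMr// => Ye.
have := ler_norm K; have := frobenius_ge0 (Y - X); nra.
Qed.

(** The spectral theorem needs symmetric arguments, whereas [Cfin] concerns functions on the whole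
    matrix space; this linear retraction mediates. *)
Definition symm X : 'M[R]_n := 2^-1 *: (X + X^T).

Lemma symmT X : (symm X)^T = symm X.
Proof. by rewrite /symm linearZ /= linearD /= trmxK addrC. Qed.

Lemma symm_id X : X^T = X -> symm X = X.
Proof. by move=> sX; rewrite /symm sX; apply/matrixP => i j; rewrite !mxE; field. Qed.

Lemma symmB X Y : symm (X - Y) = symm X - symm Y.
Proof. by apply/matrixP => i j; rewrite !mxE; ring. Qed.

Lemma symmD X Y : symm (X + Y) = symm X + symm Y.
Proof. by apply/matrixP => i j; rewrite !mxE; ring. Qed.

Lemma symmZ c X : symm (c *: X) = c *: symm X.
Proof. by apply/matrixP => i j; rewrite !mxE; ring. Qed.

Lemma frobenius_symm X : frobenius (symm X) <= frobenius X.
Proof.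
rewrite /symm frobeniusZ ger0_norm; last by rewrite invr_ge0.
have := frobeniusD X X^T; rewrite frobenius_tr; lra.
Qed.

(** Derivatives of these integrals are sums of integrals with one more slot, so the induction on k
    runs over all Hs at once. Continuity comes from [moi_lipschitz], the derivative from
    [moi_taylor]. *)
Lemma Cfin_moi k f Hs a b : smooth1 f ->
  Cfin k (fun X => moi_diag f (symm X) Hs a b).
Proof.
move=> sf; elim: k Hs => [|k IH] Hs.
  move=> X.
  have [C HC] := smooth1_bounded (size Hs).+1 (frobenius X + 1) sf.
  pose s0 := [seq (H, symm X) | H <- Hs].
  apply: (@continuous_at_lipschitz _ _ ((size s0).+1%:R * (n%:R ^+ (size s0).+3 * C * frobenius_prod s0))) => Y YX.
  have bX : in_ball (frobenius X + 1) (symm X).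
    by split; [exact: symmT|apply: (le_trans (frobenius_symm _)); rewrite lerDl].
  have bY : in_ball (frobenius X + 1) (symm Y).
    split; [exact: symmT|apply: (le_trans (frobenius_symm _))].
    by rewrite -[Y](subrK X) addrC (le_trans (frobeniusD _ _))// lerD2l.
  have ss := slots_close_diag Hs bY bX.
  have := @moi_lipschitz _ _ f _ _ _ _ _ C _ sf (frobenius_ge0 _) bY bX (lexx _) ss.
  rewrite size_map => /(_ HC) h.
  have := frobenius_coord (moi f (symm Y) [seq (H, symm Y) | H <- Hs] - moi f (symm X) [seq (H, symm X) | H <- Hs]) a b.
  rewrite [X in `|X| <= _]mxE [X in `|_ + X|]mxE => h2; apply: (le_trans h2); apply: (le_trans h).
  rewrite -[leRHS]mulrA; apply: ler_wpM2l => //.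
  have C0 : 0 <= C by apply: le_trans (HC 0 _); rewrite ?normr0// addr_ge0// frobenius_ge0.
  apply: ler_wpM2l; last by rewrite -symmB frobenius_symm.
  apply: mulr_ge0; last exact: frobenius_prod_ge0.
  by apply: mulr_ge0 => //; apply: exprn_ge0; exact: ler0n.
apply: (@Cfin_is_derive_intro _ _ _ _ (fun V X => moi_deriv f (symm X) (symm V) Hs a b)).
  move=> X V; have [K K0 HK] := @moi_taylor R n Hs.
  have [C HC] := smooth1_bounded (size Hs).+2 (frobenius X + frobenius V) sf.
  apply: (@is_derive_quadratic _ _ _ _ _ _ (K * C * frobenius V ^+ 2)) => h h1.
  have bX : in_ball (frobenius X + frobenius V) (symm X).
    split; [exact: symmT|apply: (le_trans (frobenius_symm _))].
    by rewrite lerDl frobenius_ge0.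
  have bY : in_ball (frobenius X + frobenius V) (symm (h *: V + X)).
    split; [exact: symmT|apply: (le_trans (frobenius_symm _))].
    rewrite addrC (le_trans (frobeniusD _ _))// lerD2l frobeniusZ.
    by rewrite -[leRHS]mul1r ler_wpM2r// frobenius_ge0.
  have := HK f _ _ _ C sf bY bX HC.
  have -> : symm (h *: V + X) - symm X = h *: symm V by rewrite symmD symmZ addrK.
  rewrite moi_derivZ => H.
  have := frobenius_coord (moi_diag f (symm (h *: V + X)) Hs - moi_diag f (symm X) Hs - h *: moi_deriv f (symm X) (symm V) Hs) a b.
  rewrite [X in `|X| <= _]mxE [X in `|X + _|]mxE [X in `|_ + X + _|]mxE [X in `|_ + X|]mxE [X in `|_ - X|]mxE.
  move=> h2; apply: (le_trans h2); apply: (le_trans H).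
  have C0 : 0 <= C by apply: le_trans (HC 0 _); rewrite ?normr0// addr_ge0// frobenius_ge0.
  have hV : frobenius (h *: symm V) ^+ 2 <= frobenius V ^+ 2 * h ^+ 2.
    rewrite frobeniusZ exprMn real_normK ?num_real// mulrC; apply: ler_wpM2r; first exact: sqr_ge0.
    by rewrite lerXn2r ?nnegrE ?frobenius_ge0 ?frobenius_symm.
  rewrite -[leRHS]mulrA; apply: ler_wpM2l => //.
  exact: mulr_ge0.
move=> V; rewrite /moi_deriv.
have -> : (fun X => (\sum_(L <- insert_all (symm V) Hs) moi_diag f (symm X) L) a b) =
    (fun X => \sum_(L <- insert_all (symm V) Hs) moi_diag f (symm X) L a b).
  by apply/funext => X; rewrite summxE.
exact: Cfin_sum.
Qed.

Definition fcalc (f : R -> R) (A : 'M[R]_n) : 'M[R]_n := moi f A [::].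

(** Independence of the chosen decomposition: the transition matrix N intertwines the two diagonal
    matrices, so N i j can be nonzero only if the eigenvalues e_i and d_j agree, and then their
    images under f agree as well. *)
Lemma fcalc_spectral f V (d : 'rV[R]_n) : orthogonal_mx V ->
  fcalc f (V *m diag_mx d *m V^T) = V *m diag_mx (map_mx f d) *m V^T.
Proof.
move=> oV; set A := V *m diag_mx d *m V^T.
have sA : A^T = A by rewrite /A !trmx_mul trmxK tr_diag_mx mulmxA.
have [oU AE] := spectral_pairP sA.
set U := (spectral_pair A).1 in oU AE; set e := (spectral_pair A).2 in AE.
have -> : fcalc f A = U *m diag_mx (map_mx f e) *m U^T.
  rewrite diag_mx_sum_delta mulmx_sumr mulmx_suml /fcalc moiE; apply: eq_bigr => i _ /=.
  by rewrite mul_mx_scalar /eigproj -/U mxE -scalemxAr -scalemxAl.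
pose N := U^T *m V.
have dN : diag_mx e *m N = N *m diag_mx d.
  have : U^T *m A *m V = U^T *m A *m V by [].
  rewrite {1}AE /A !mulmxA oU mul1mx -(mulmxA _ V^T V) oV mulmx1.
  by rewrite -(mulmxA (diag_mx e)).
have fN : diag_mx (map_mx f e) *m N = N *m diag_mx (map_mx f d).
  apply/matrixP => i j; move/matrixP/(_ i j) : dN.
  rewrite !mul_diag_mxE !mul_mx_diagE 2![map_mx _ _ _ _]mxE.
  have [->|N0] := eqVneq (N i j) 0; first by rewrite !mulr0 !mul0r.
  by rewrite mulrC => /(mulfI N0) ->; rewrite mulrC.
have -> : U *m diag_mx (map_mx f e) *m U^T = U *m (diag_mx (map_mx f e) *m N) *m V^T.
  by rewrite /N -!mulmxA (orthogonal_mxC oV) mulmx1.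
by rewrite fN /N !mulmxA (orthogonal_mxC oU) mul1mx.
Qed.

(** The odd function s h(s^2) applied to the singular values. Writing it through X^T X avoids square
    roots, so smoothness of h is enough. *)
Definition svcalc (h : R -> R) (X : 'M[R]_n) : 'M[R]_n := X *m fcalc h (X^T *m X).

Lemma svcalc_svd h (U V : 'M[R]_n) (x : 'rV[R]_n) : orthogonal_mx U -> orthogonal_mx V ->
  svcalc h (U *m diag_mx x *m V^T) =
  U *m diag_mx (map_mx (fun s => s * h (s ^+ 2)) x) *m V^T.
Proof.
move=> oU oV; rewrite /svcalc.
have -> : (U *m diag_mx x *m V^T)^T *m (U *m diag_mx x *m V^T) =
    V *m diag_mx (map_mx (fun s => s ^+ 2) x) *m V^T.
  rewrite !trmx_mul trmxK tr_diag_mx !mulmxA -(mulmxA _ U^T U) oU mulmx1.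
  congr (_ *m _); rewrite -mulmxA; congr (_ *m _); apply/matrixP => i j.
  by rewrite mul_diag_mxE !diag_mxE !mxE expr2 mulrA.
rewrite fcalc_spectral// !mulmxA -(mulmxA _ V^T V) oV mulmx1.
congr (_ *m _); rewrite -mulmxA; congr (_ *m _); apply/matrixP => i j.
by rewrite mul_diag_mxE !diag_mxE !mxE mulrA.
Qed.

Lemma Cfin_svcalc k h i j : smooth1 h -> Cfin k (fun X => svcalc h X i j).
Proof.
move=> sh.
have -> : (fun X => svcalc h X i j) =
    (fun X => \sum_l X i l * moi_diag h (symm (X^T *m X)) [::] l j).
  apply/funext => X; rewrite mxE; apply: eq_bigr => l _.
  by rewrite symm_id// trmx_mul trmxK.
apply: Cfin_sum => l; apply: CfinM; first exact: Cfin_coord.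
apply: (@Cfin_comp _ _ _ _ (fun Y => moi_diag h (symm Y) [::] l j) (fun X => X^T *m X)).
  move=> a b.
  have -> : (fun X => (X^T *m X) a b) = (fun X => \sum_l X l a * X l b).
    by apply/funext => X; rewrite mxE; apply: eq_bigr => c _; rewrite mxE.
  by apply: Cfin_sum => c; apply: CfinM; exact: Cfin_coord.
exact: Cfin_moi.
Qed.

End FunctionalCalculus.

(** * Lipschitz estimates through singular value decompositions *)

Section Lipschitz.
Context {R : realType} {n : nat}.
Implicit Types X Y V : 'M[R]_n.

(* With w = ((N + M)/2)^2 and w' = ((N - M)/2)^2 the two sides differ termwise by
   (p_i^2 - q_j^2) (N_ij^2 - M_ij^2) / 2, which sums to 0. *)
Lemma sum_sqr_orthogonal_pair (M N : 'M[R]_n) (p q : 'I_n -> R) :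
  orthogonal_mx M -> orthogonal_mx N ->
  \sum_i \sum_j (p i * N i j - M i j * q j) ^+ 2 =
  \sum_i \sum_j ((p i - q j) ^+ 2 * ((N i j + M i j) / 2) ^+ 2 +
                 (p i + q j) ^+ 2 * ((N i j - M i j) / 2) ^+ 2).
Proof.
move=> oM oN; apply/eqP; rewrite -subr_eq0 -sumrB; apply/eqP.
under eq_bigr do rewrite -sumrB.
transitivity (\sum_i \sum_j (p i ^+ 2 / 2 * N i j ^+ 2 - p i ^+ 2 / 2 * M i j ^+ 2)
   - \sum_i \sum_j (q j ^+ 2 / 2 * N i j ^+ 2 - q j ^+ 2 / 2 * M i j ^+ 2)).
  rewrite -sumrB; apply: eq_bigr => i _; rewrite -sumrB; apply: eq_bigr => j _.
  by field.
rewrite [X in _ - X]exchange_big /= !big1 ?subrr// => i _.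
  by rewrite sumrB -!mulr_sumr !orthogonal_col_sqr// subrr.
by rewrite sumrB -!mulr_sumr !orthogonal_row_sqr// subrr.
Qed.

(** The weights are nonnegative and depend only on the singular vectors, so an inequality between
    singular values passes termwise to the matrices. *)
Lemma frobenius_svd_sub (U V U' V' : 'M[R]_n) (x y : 'rV[R]_n) :
  orthogonal_mx U -> orthogonal_mx V -> orthogonal_mx U' -> orthogonal_mx V' ->
  frobenius (U *m diag_mx x *m V^T - U' *m diag_mx y *m V'^T) ^+ 2 =
  \sum_i \sum_j ((x 0 i - y 0 j) ^+ 2 * (((V^T *m V') i j + (U^T *m U') i j) / 2) ^+ 2 +
                 (x 0 i + y 0 j) ^+ 2 * (((V^T *m V') i j - (U^T *m U') i j) / 2) ^+ 2).
Proof.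
move=> oU oV oU' oV'.
have oM : orthogonal_mx (U^T *m U') by exact/orthogonal_mul/oU'/orthogonal_tr.
have oN : orthogonal_mx (V^T *m V') by exact/orthogonal_mul/oV'/orthogonal_tr.
rewrite -(sum_sqr_orthogonal_pair (fun i => x 0 i) (fun j => y 0 j) oM oN).
rewrite -(frobenius_orthogonal_l _ (orthogonal_tr oU)) -(frobenius_orthogonal_r _ oV').
rewrite frobenius_sqr mxdot_sqr; apply: eq_bigr => i _; apply: eq_bigr => j _.
congr (_ ^+ 2).
rewrite mulmxBr mulmxBl !mulmxA oU mul1mx -(mulmxA _ V'^T V') oV' mulmx1 -(mulmxA (diag_mx x)).
by rewrite mxE mul_diag_mxE [X in _ + X]mxE mul_mx_diagE.
Qed.

(** X and [svcalc h X] share their singular vectors, hence their weights in [frobenius_svd_sub]. The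
    terms with x_i + y_j are differences between x_i and -y_j, where oddness enters. *)
Lemma svcalc_lipschitz (h : R -> R) (L : R) :
  (forall s t, `|s * h (s ^+ 2) - t * h (t ^+ 2)| <= L * `|s - t|) ->
  forall X Y, frobenius (svcalc h X - svcalc h Y) <= L * frobenius (X - Y).
Proof.
move=> hL X Y.
have L0 : 0 <= L by have := hL 1 0; rewrite subr0 normr1 mulr1; exact: le_trans.
have [U [V [x [oU oV ->]]]] := singular_value_decomposition X.
have [U' [V' [y [oU' oV' ->]]]] := singular_value_decomposition Y.
rewrite -ler_sqr ?nnegrE ?mulr_ge0 ?frobenius_ge0// exprMn !svcalc_svd//.
rewrite !frobenius_svd_sub// mulr_sumr; apply: ler_sum => i _.
rewrite mulr_sumr; apply: ler_sum => j _; rewrite mulrDr.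
have sq a b : `|a| <= L * `|b| -> a ^+ 2 <= L ^+ 2 * b ^+ 2.
  move=> ab; rewrite -exprMn; rewrite -(real_normK (num_real a)) -(real_normK (num_real (L * b))).
  by rewrite lerXn2r ?nnegrE// normrM (ger0_norm L0).
apply: lerD; rewrite [leRHS]mulrA ler_wpM2r ?sqr_ge0//; apply: sq; rewrite !mxE.
  exact: hL.
have := hL (x 0 i) (- y 0 j); rewrite sqrrN mulNr opprK.
by rewrite opprK.
Qed.

End Lipschitz.

(** * The cut-off of small singular values *)

Section Cutoff.
Context {R : realType}.

(** The affine map sends t^2 to 0 and (2t)^2 to 1. The variable y stands for the square of a
    singular value. *)
Definition cutoff (t y : R) : R := step ((3 * t ^+ 2)^-1 * y + (- 3^-1)).

Lemma smooth1_cutoff t : smooth1 (cutoff t).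
Proof. by move=> k; apply: C1_affine; exact: smooth1_step. Qed.

Definition cutoff' (t y : R) : R := (3 * t ^+ 2)^-1 * step' ((3 * t ^+ 2)^-1 * y + (- 3^-1)).

Lemma is_derive_cutoff t (y : R) : is_derive y 1 (cutoff t) (cutoff' t y).
Proof. exact/is_derive1_affine/is_derive_step. Qed.

Lemma cutoff_ge0 t y : 0 <= cutoff t y.
Proof. exact: step_ge0. Qed.

Lemma cutoff_le1 t y : cutoff t y <= 1.
Proof. exact: step_le1. Qed.

Lemma cutoff_eq0 t y : 0 < t -> y <= t ^+ 2 -> cutoff t y = 0.
Proof.
move=> t0 yt; apply: step_le0; rewrite subr_le0.
by rewrite ler_pdivrMl ?mulr_gt0 ?exprn_gt0// mulrAC divff// mul1r.
Qed.

Lemma cutoff_eq1 t y : 0 < t -> (2 * t) ^+ 2 <= y -> cutoff t y = 1.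
Proof.
move=> t0 yt; apply: step_ge1; rewrite lerBrDr.
rewrite ler_pdivlMl ?mulr_gt0 ?exprn_gt0//; apply: le_trans yt.
rewrite exprMn; have := sqr_ge0 t; lra.
Qed.

Lemma cutoff'_eq0 t y : 0 < t -> (2 * t) ^+ 2 <= y -> cutoff' t y = 0.
Proof.
move=> t0 yt; rewrite /cutoff' step'_ge1 ?mulr0// lerBrDr.
rewrite ler_pdivlMl ?mulr_gt0 ?exprn_gt0//; apply: le_trans yt.
rewrite exprMn; have := sqr_ge0 t; lra.
Qed.

Lemma cutoff'_ge0 t y : 0 <= cutoff' t y.
Proof. by rewrite mulr_ge0 ?step'_ge0// invr_ge0 mulr_ge0// sqr_ge0. Qed.

(** Where the derivative does not vanish, y <= 4 t^2, while [cutoff'] is at most 8 / (3 t^2); t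
    cancels. *)
Lemma cutoff'_bound t y : 0 < t -> y * cutoff' t y <= 32 / 3.
Proof.
move=> t0; have [ty|ty] := leP ((2 * t) ^+ 2) y.
  by rewrite cutoff'_eq0// mulr0.
have [y0|y0] := leP y 0.
  by apply: (@le_trans _ _ 0) => //; rewrite mulr_le0_ge0// cutoff'_ge0.
have t20 : 0 < 3 * t ^+ 2 by rewrite mulr_gt0 ?exprn_gt0.
apply: (@le_trans _ _ ((2 * t) ^+ 2 * ((3 * t ^+ 2)^-1 * 8))).
  rewrite ler_pM ?(ltW y0) ?(ltW ty) ?cutoff'_ge0//.
  by rewrite /cutoff' ler_wpM2l ?step'_le8// invr_ge0 ltW.
by rewrite le_eqVlt; apply/orP; left; apply/eqP; field; rewrite gt_eqF.
Qed.

Definition phi (t s : R) : R := s * cutoff t (s ^+ 2).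

Lemma is_derive_phi t (s : R) :
  is_derive s 1 (phi t) (cutoff t (s ^+ 2) + 2 * (s ^+ 2 * cutoff' t (s ^+ 2))).
Proof.
have d1 : is_derive s 1 (fun s => s ^+ 2) (2 * s).
  apply: DeriveDef; first exact: exprn_derivable.
  by rewrite exp_derive /GRing.scale /= expr1 mulr1 mulr_natl.
have d2 : is_derive s 1 (fun s => cutoff t (s ^+ 2)) (cutoff' t (s ^+ 2) * (2 * s)).
  exact: (@is_derive1_comp _ (cutoff t) (fun s => s ^+ 2) _ _ _ (is_derive_cutoff t _)).
apply: (is_derive_eq (is_deriveM (is_derive_id s 1) d2)).
by rewrite /GRing.scale /=; ring.
Qed.

(** The derivative lies between 0 and 1 + 2 * 32 / 3 = 67 / 3 < 23. *)
Lemma phi_lipschitz t (a b : R) : 0 < t -> `|phi t a - phi t b| <= 23 * `|a - b|.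
Proof.
move=> t0; have cphi := is_derive_continuous (is_derive_phi t).
have main x y : x < y -> `|phi t y - phi t x| <= 23 * `|y - x|.
  move=> xy; have [c _ ->] := MVT xy (fun x _ => is_derive_phi t x) (continuous_subspaceT cphi).
  rewrite normrM ler_wpM2r// ger0_norm.
    have := cutoff_le1 t (c ^+ 2); have := cutoff'_bound (c ^+ 2) t0; lra.
  rewrite addr_ge0 ?cutoff_ge0// mulr_ge0// mulr_ge0 ?sqr_ge0 ?cutoff'_ge0//.
have [ab|ba|->] := ltgtP a b; last by rewrite !subrr normr0 mulr0.
  by rewrite distrC (distrC a); exact: main.
exact: main.
Qed.

Lemma phi_dist t s : 0 < t -> `|phi t s - s| <= 2 * t.
Proof.
move=> t0; rewrite /phi -[X in _ - X]mulr1 -mulrBr normrM.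
have [ts|ts] := leP (2 * t) `|s|.
  rewrite cutoff_eq1 ?subrr ?normr0 ?mulr0 ?mulr_ge0 ?(ltW t0)//.
  by rewrite -(real_normK (num_real s)) lerXn2r ?nnegrE// mulr_ge0// ltW.
rewrite -[leRHS]mulr1 ler_pM ?(ltW ts)// distrC ger0_norm ?subr_ge0 ?cutoff_le1//.
by rewrite gerBl cutoff_ge0.
Qed.

Lemma phi_eq0 t s : 0 < t -> `|s| <= t -> phi t s = 0.
Proof.
move=> t0 st; rewrite /phi cutoff_eq0 ?mulr0//.
by rewrite -(real_normK (num_real s)) lerXn2r ?nnegrE// ltW.
Qed.

Lemma phi_id t s : 0 < t -> 2 * t <= `|s| -> phi t s = s.
Proof.
move=> t0 st; rewrite /phi cutoff_eq1 ?mulr1//.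
by rewrite -(real_normK (num_real s)) lerXn2r ?nnegrE// mulr_ge0// ltW.
Qed.

(** Chosen so that s [cutoff_mp t (s^2)] is the derivative of [phi t] at s divided by s, see
    [phi_mpinv]. *)
Definition cutoff_mp (t y : R) : R := y^-1 * cutoff t y + 2 * cutoff' t y.

Lemma smooth1_cutoff_mp t : 0 < t -> smooth1 (cutoff_mp t).
Proof.
move=> t0 k; apply: C1D; last first.
  apply: C1Z; rewrite -(is_derive_derive1 (is_derive_cutoff t)).
  exact: (smooth1_derive1 (smooth1_cutoff t)).
have t20 : 0 < t ^+ 2 by rewrite exprn_gt0.
pose s (z : R) := step ((t ^+ 2)^-1 * z + 0).
(* A smooth substitute for z without zeros: it equals z for z >= t^2, and below t^2 the cut-off
   vanishes, so that dividing by w instead of z changes nothing. *)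
pose w (z : R) := z * s z + t ^+ 2 * (1 + -1 * s z).
have Cs : C1 k s by apply: C1_affine; exact: smooth1_step.
have Cw : C1 k w.
  apply: C1D; first by apply: C1M => //; exact: C1_id.
  by apply: C1Z; apply: C1D; [exact: C1_cst|exact: C1Z].
have s1 z : t ^+ 2 <= z -> s z = 1.
  by move=> tz; rewrite /s step_ge1// addr0 ler_pdivlMl// mulr1.
have w0 z : w z != 0.
  have sz0 : 0 <= s z by exact: step_ge0.
  have sz1 : s z <= 1 by exact: step_le1.
  have [z0|z0] := leP z 0.
    by rewrite /w /s step_le0 ?addr0 ?mulr0 ?add0r ?addr0 ?mulr1 ?gt_eqF// pmulr_rle0 ?invr_gt0.
  have p1 : 0 <= t ^+ 2 * (1 + -1 * s z) by rewrite mulr_ge0 ?(ltW t20)//; lra.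
  have p2 : 0 <= z * s z by rewrite mulr_ge0// ltW.
  have [sz|sz] := eqVneq (s z) 0; first by rewrite /w sz !mulr0 add0r addr0 mulr1 gt_eqF.
  by rewrite gt_eqF// ltr_pwDl// mulr_gt0// lt_def sz.
have -> : (fun y => y^-1 * cutoff t y) = (fun y => (w y)^-1 * cutoff t y).
  apply/funext => y; have [yt|ty] := leP y (t ^+ 2); first by rewrite cutoff_eq0// !mulr0.
  by rewrite /w s1 ?ltW// mulr1 mulN1r subrr mulr0 addr0.
by apply: C1M; [exact: C1V|exact: smooth1_cutoff].
Qed.

Lemma phi_mpinv t (s : R) :
  (cutoff t (s ^+ 2) + 2 * (s ^+ 2 * cutoff' t (s ^+ 2))) * (if s == 0 then 0 else 1 / s) =
  s * cutoff_mp t (s ^+ 2).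
Proof.
rewrite /cutoff_mp; case: eqVneq => [->|s0]; first by rewrite mulr0 mul0r.
by field.
Qed.

End Cutoff.

Section Retraction.
Context {R : realType} {n : nat}.
Implicit Types X Y V : 'M[R]_n.

Definition Theta (t : R) X : 'M[R]_n := svcalc (cutoff t) X.

Lemma Theta_svd t (U V : 'M[R]_n) (x : 'rV[R]_n) : orthogonal_mx U -> orthogonal_mx V ->
  Theta t (U *m diag_mx x *m V^T) = U *m diag_mx (map_mx (phi t) x) *m V^T.
Proof. exact: svcalc_svd. Qed.

Lemma Cfin_Theta k t i j : Cfin k (fun X => Theta t X i j).
Proof. by apply: Cfin_svcalc; exact: smooth1_cutoff. Qed.

Lemma Theta_lipschitz t X Y : 0 < t ->
  frobenius (Theta t X - Theta t Y) <= 23 * frobenius (X - Y).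
Proof.
by move=> t0; apply: svcalc_lipschitz => a b; exact: phi_lipschitz.
Qed.

Lemma Theta_dist t X : 0 < t -> frobenius (Theta t X - X) <= n%:R * (2 * t).
Proof.
move=> t0; have [U [V [x [oU oV ->]]]] := singular_value_decomposition X.
rewrite Theta_svd// -mulmxBl -mulmxBr frobenius_orthogonal_r; last exact: orthogonal_tr.
rewrite frobenius_orthogonal_l// -raddfB /=; apply: (le_trans (frobenius_le_mx_norm _)).
rewrite ler_wpM2l// [leLHS]/Num.norm /= mx_normrE; apply: bigmax_le.
  by rewrite mulr_ge0// ltW.
move=> [i j] _ /=; rewrite diag_mxE !mxE normrM.
rewrite -[leRHS]mulr1 ler_pM//; first exact: phi_dist.
by case: (i == j); rewrite ?normr1 ?normr0.
Qed.

(** The line from X in the direction [mpinvT X] keeps the singular vectors of X fixed, so the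
    derivative is computed on each singular value separately. *)
Lemma is_derive_Theta_mpinvT t X i j : 0 < t ->
  is_derive X (mpinvT X) (fun X => Theta t X i j) (svcalc (cutoff_mp t) X i j).
Proof.
move=> t0.
have [U [V [x [oU oV XE]]]] : is_mpinv X (mpinv X).
  apply: (@xgetPex _ 0 [set Y | is_mpinv X Y]).
  have [U [V [x [oU oV XE]]]] := singular_value_decomposition X.
  by exists (V *m diag_mx (pinv_row x) *m U^T), U, V, x.
move=> YE.
have WE : mpinvT X = U *m diag_mx (pinv_row x) *m V^T.
  by rewrite /mpinvT YE !trmx_mul trmxK tr_diag_mx mulmxA.
pose a k := U i k * V j k.
have entry (d : 'rV[R]_n) : (U *m diag_mx d *m V^T) i j = \sum_k a k * d 0 k.
  by rewrite mxE; apply: eq_bigr => k _; rewrite mul_mx_diagE mxE /a; ring.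
suff : is_derive (0 : R) 1 (fun s : R => Theta t (s *: mpinvT X + X) i j) (svcalc (cutoff_mp t) X i j).
  exact: (@is_derive_of_line R 'M[R]_n (fun X => Theta t X i j)).
have -> : (fun s : R => Theta t (s *: mpinvT X + X) i j) =
   \sum_k (fun s : R => a k * phi t (pinv_row x 0 k * s + x 0 k)).
  apply/funext => s; rewrite fct_sumE WE {1}XE.
  have -> : s *: (U *m diag_mx (pinv_row x) *m V^T) + U *m diag_mx x *m V^T =
      U *m diag_mx (s *: pinv_row x + x) *m V^T.
    by rewrite linearD linearZ /= mulmxDr mulmxDl -scalemxAr -scalemxAl.
  rewrite Theta_svd// entry; apply: eq_bigr => k _.
  by rewrite mxE; congr (_ * phi t _); rewrite mxE [X in X + _]mxE mulrC.
have -> : svcalc (cutoff_mp t) X i j = \sum_k a k *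
     (pinv_row x 0 k * (cutoff t ((x 0 k) ^+ 2) + 2 * ((x 0 k) ^+ 2 * cutoff' t ((x 0 k) ^+ 2)))).
  rewrite {1}XE svcalc_svd// entry; apply: eq_bigr => k _.
  by rewrite !mxE -phi_mpinv [X in _ = _ * X]mulrC.
apply: is_derive_sum => k.
have E : x 0 k = pinv_row x 0 k * 0 + x 0 k by rewrite mulr0 add0r.
have d1 : is_derive (0 : R) 1 (fun s : R => phi t (pinv_row x 0 k * s + x 0 k))
   (pinv_row x 0 k * (cutoff t ((x 0 k) ^+ 2) + 2 * ((x 0 k) ^+ 2 * cutoff' t ((x 0 k) ^+ 2)))).
  by apply: is_derive1_affine; rewrite mulr0 add0r; exact: is_derive_phi.
exact: is_deriveZ.
Qed.

End Retraction.

(** * Projection onto matrices of fixed rank *)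

Section LowRank.
Context {R : realType} {n : nat}.
Implicit Types X Y Z U V : 'M[R]_n.

Lemma rank_diag_le (x : 'rV[R]_n) : (\rank (diag_mx x) <= #|[set i | x 0%R i != 0%R]%SET|)%N.
Proof.
rewrite diag_mx_sum_delta (bigID (fun i => x 0 i != 0)) /= [X in _ + X]big1 ?addr0; last first.
  by move=> i /negPn/eqP ->; rewrite scale0r.
rewrite -sum1_card [X in (_ <= X)%N](eq_bigl (fun i => x 0%R i != 0%R)) => [|i]; last by rewrite inE.
elim/big_ind2 : _ => [|A a B b rA rB|i _].
- by rewrite mxrank0.
- by apply: leq_trans (mxrank_add _ _) _; exact: leq_add.
- by rewrite -mul_scalar_mx (leq_trans (mxrankM_maxr _ _))// mxrank_delta.
Qed.

(** Filling the zero positions by ones makes the matrix invertible, and subadditivity of the rank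
    gives the lower bound. *)
Lemma rank_diag_mx (x : 'rV[R]_n) : \rank (diag_mx x) = #|[set i | x 0%R i != 0%R]%SET|.
Proof.
apply/eqP; rewrite eqn_leq rank_diag_le /=.
pose y : 'rV[R]_n := \row_i (x 0 i == 0)%:R.
have u : diag_mx (x + y) \in unitmx.
  rewrite unitmxE det_diag unitfE; apply/prodf_neq0 => i _.
  by rewrite !mxE; case: (eqVneq (x 0 i) 0) => [->|x0]; rewrite /= ?add0r ?oner_eq0 ?addr0.
have : (n <= \rank (diag_mx x) + \rank (diag_mx y))%N.
  by rewrite -{1}(mxrank_unit u) linearD /= mxrank_add.
have ry : (\rank (diag_mx y) <= #|[set i | x 0%R i == 0%R]%SET|)%N.
  apply: leq_trans (rank_diag_le _) _; apply: subset_leq_card; apply/fintype.subsetP => i.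
  by rewrite !inE mxE; case: (x 0 i == 0) => //=; rewrite eqxx.
have cn : (#|[set i | x 0%R i == 0%R]%SET| + #|[set i | x 0%R i != 0%R]%SET|)%N = n.
  rewrite -[RHS](card_ord n) -(cardsC [set i | x 0 i == 0]%SET); congr (_ + #|pred_of_set _|)%N.
  by apply/setP => i; rewrite !inE.
move=> h; rewrite -(leq_add2l #|[set i | x 0%R i == 0%R]%SET|) cn.
by apply: leq_trans h _; rewrite addnC leq_add2r.
Qed.

Lemma orthogonal_unit U : orthogonal_mx U -> U \in unitmx.
Proof. by move=> /orthogonal_mxC /mulmx1_unit[]. Qed.

Lemma rank_svd U V (x : 'rV[R]_n) : orthogonal_mx U -> orthogonal_mx V ->
  \rank (U *m diag_mx x *m V^T) = #|[set i | x 0%R i != 0%R]%SET|.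
Proof.
move=> oU oV; rewrite mxrankMfree; last by rewrite row_free_unit orthogonal_unit//; exact: orthogonal_tr.
by rewrite eqmxMfull ?row_full_unit ?orthogonal_unit// rank_diag_mx.
Qed.

Definition truncate (B : {set 'I_n}) (x : 'rV[R]_n) : 'rV[R]_n := \row_i (x 0 i * (i \in B)%:R).

Lemma frobenius_diag_sqr (x : 'rV[R]_n) : frobenius (diag_mx x) ^+ 2 = \sum_i x 0 i ^+ 2.
Proof.
rewrite frobenius_sqr mxdot_sqr; apply: eq_bigr => i _.
rewrite (bigD1 i)//= big1 ?addr0; first by rewrite diag_mxE eqxx mulr1.
by move=> j ji; rewrite diag_mxE eq_sym (negbTE ji) mulr0 expr0n.
Qed.

Lemma frobenius_truncate U V (x : 'rV[R]_n) B : orthogonal_mx U -> orthogonal_mx V ->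
  frobenius (U *m diag_mx x *m V^T - U *m diag_mx (truncate B x) *m V^T) ^+ 2 =
  \sum_(i | i \notin B) x 0 i ^+ 2.
Proof.
move=> oU oV; rewrite -mulmxBl -mulmxBr frobenius_orthogonal_r; last exact: orthogonal_tr.
rewrite frobenius_orthogonal_l// -raddfB /= frobenius_diag_sqr (bigID (mem B)) /= big1 ?add0r.
  by apply: eq_bigr => i iB; rewrite !mxE (negbTE iB) mulr0 subr0.
by move=> i iB; rewrite !mxE iB mulr1 subrr expr0n.
Qed.

(* For the projector P onto the row space of Z, |X - Z|^2 = |X P - Z|^2 + |X (1 - P)|^2,
   and the second term dominates the tail of the singular values by a counting argument. *)
Lemma eckart_young U V (x : 'rV[R]_n) (B : {set 'I_n}) (c d : R) Z :
  orthogonal_mx U -> orthogonal_mx V -> 0 <= d < c ->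
  (forall i, i \in B -> c <= `|x 0 i|) -> (forall i, i \notin B -> `|x 0 i| <= d) ->
  \rank Z = #|B| ->
  let X := U *m diag_mx x *m V^T in let Y := U *m diag_mx (truncate B x) *m V^T in
  frobenius (X - Y) <= frobenius (X - Z) /\
  (frobenius (X - Z) <= frobenius (X - Y) -> Z = Y).
Proof.
move=> oU oV /andP[d0 dc] xB xnB rZ X Y.
have [U' [V' [y [oU' oV' ZE]]]] := singular_value_decomposition Z.
pose nz := [set j | y 0 j != 0]%SET.
have cnz : #|nz| = #|B| by rewrite -rZ ZE rank_svd.
pose D : 'rV[R]_n := \row_j (j \in nz)%:R.
pose P := V' *m diag_mx D *m V'^T.
pose N := V^T *m V'.
have oN : orthogonal_mx N by exact/orthogonal_mul/oV'/orthogonal_tr.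
have DD : diag_mx D *m diag_mx D = diag_mx D.
  apply/matrixP => i j; rewrite mul_diag_mxE diag_mxE mxE; case: (i \in nz); by rewrite /= ?mul1r ?mul0r.
have yD : diag_mx y *m diag_mx D = diag_mx y.
  apply/matrixP => i j; rewrite mul_mx_diagE diag_mxE mxE inE.
  by case: eqVneq => [<-|_]; rewrite ?mulr0 ?mul0r// mulr1; case: eqVneq => [->|]; rewrite /= ?mulr1// mulr0.
have ZP : Z *m P = Z.
  by rewrite ZE /P !mulmxA -(mulmxA _ V'^T V') oV' mulmx1 -(mulmxA U') yD.
have PP : P *m P = P.
  by rewrite /P !mulmxA -(mulmxA _ V'^T V') oV' mulmx1 -(mulmxA V') DD.
have PT : P^T = P by rewrite /P !trmx_mul trmxK tr_diag_mx mulmxA.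
have pyth : frobenius (X - Z) ^+ 2 = frobenius (X *m P - Z) ^+ 2 + frobenius (X - X *m P) ^+ 2.
  have -> : X - Z = (X *m P - Z) + (X - X *m P) by rewrite [RHS]addrC addrA subrK.
  suff ab : mxdot (X *m P - Z) (X - X *m P) = 0.
    move: (X *m P - Z) (X - X *m P) ab => a b ab.
    by rewrite !frobenius_sqr mxdotDr !mxdotDl (mxdotC b a) ab addr0 add0r.
  rewrite -{1}ZP -mulmxBl /mxdot trmx_mul PT mxtrace_mulC mulmxA mulmxBl.
  by rewrite -(mulmxA X) PP subrr mul0mx mxtrace0.
pose q i := \sum_(j | j \notin nz) N i j ^+ 2.
pose r i := \sum_(j | j \in nz) N i j ^+ 2.
have qr i : q i = 1 - r i.
  have : 1 = r i + q i by rewrite -(orthogonal_row_sqr i oN) (bigID (mem nz)).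
  by move=> ->; rewrite addrC addKr.
have q0 i : 0 <= q i by apply: sumr_ge0 => j _; exact: sqr_ge0.
have r0 i : 0 <= r i by apply: sumr_ge0 => j _; exact: sqr_ge0.
have tail : frobenius (X - X *m P) ^+ 2 = \sum_i x 0 i ^+ 2 * q i.
  have -> : X - X *m P = U *m (diag_mx x *m N *m diag_mx (const_mx 1 - D)) *m V'^T.
    have P1 : 1%:M - P = V' *m diag_mx (const_mx 1 - D) *m V'^T.
      by rewrite raddfB /= diag_const_mx mulmxBr mulmxBl mulmx1 (orthogonal_mxC oV').
    by rewrite -{1}[X]mulmx1 -mulmxBr P1 /N /X !mulmxA.
  rewrite frobenius_orthogonal_r; last exact: orthogonal_tr.
  rewrite frobenius_orthogonal_l// frobenius_sqr mxdot_sqr; apply: eq_bigr => i _.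
  rewrite (bigID (mem nz)) /= big1 ?add0r => [|j jn].
    rewrite mulr_sumr; apply: eq_bigr => j jn.
    by rewrite mul_mx_diagE mul_diag_mxE !mxE (negbTE jn) subr0 mulr1 exprMn.
  by rewrite mul_mx_diagE !mxE jn subrr mulr0 expr0n.
(* The squares of N have total #|B| over the rows in B and total #|nz| over the columns in nz. These
   cardinals agree, so as much mass leaves the block B x nz along rows as along columns. *)
have sumq : \sum_(i in B) q i = \sum_(i | i \notin B) r i.
  have S1 : \sum_(i in B) q i + \sum_(i in B) r i = #|B|%:R.
    rewrite -big_split /= (eq_bigr (fun=> 1)) ?sumr_const// => i _.
    by rewrite qr subrK.
  have S2 : \sum_(i in B) r i + \sum_(i | i \notin B) r i = #|nz|%:R.
    rewrite -(bigID (mem B) predT) /= exchange_big /=.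
    rewrite (eq_bigr (fun=> 1)) ?sumr_const// => j _.
    exact: orthogonal_col_sqr.
  by move: S1 S2; rewrite cnz => S1 S2; lra.
have q0B : 0 <= \sum_(i in B) q i by apply: sumr_ge0.
have gap : \sum_(i | i \notin B) x 0 i ^+ 2 + (c ^+ 2 - d ^+ 2) * \sum_(i in B) q i <=
    \sum_i x 0 i ^+ 2 * q i.
  rewrite [leRHS](bigID (mem B)) /=.
  have G1 : c ^+ 2 * \sum_(i in B) q i <= \sum_(i in B) x 0 i ^+ 2 * q i.
    rewrite mulr_sumr; apply: ler_sum => i iB; rewrite ler_wpM2r//.
    rewrite -[leRHS]real_normK ?num_real// lerXn2r ?nnegrE//; last exact: xB.
    by rewrite (le_trans d0)// ltW.
  have G2 : \sum_(i | i \notin B) x 0 i ^+ 2 - d ^+ 2 * \sum_(i | i \notin B) r i <=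
      \sum_(i | i \notin B) x 0 i ^+ 2 * q i.
    rewrite mulr_sumr -sumrB; apply: ler_sum => i iB; rewrite qr mulrBr mulr1 lerB// ler_wpM2r//.
    by rewrite -[leLHS]real_normK ?num_real// lerXn2r ?nnegrE//; exact: xnB.
  rewrite mulrBl {2}sumq; lra.
have cd2 : 0 < c ^+ 2 - d ^+ 2.
  by rewrite subr_gt0 ltrXn2r// ?nnegrE// (le_trans d0)// ltW.
have XYE : frobenius (X - Y) ^+ 2 = \sum_(i | i \notin B) x 0 i ^+ 2 by exact: frobenius_truncate.
have XPZ0 : 0 <= frobenius (X *m P - Z) ^+ 2 by exact: sqr_ge0.
split.
  rewrite -ler_sqr ?nnegrE ?frobenius_ge0// pyth tail XYE.
  have : 0 <= (c ^+ 2 - d ^+ 2) * \sum_(i in B) q i by rewrite mulr_ge0// ltW.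
  lra.
move=> XZY; have : frobenius (X - Z) ^+ 2 <= frobenius (X - Y) ^+ 2.
  by rewrite lerXn2r ?nnegrE ?frobenius_ge0.
rewrite pyth tail XYE => le2.
(* Equality forces this leak to vanish: N is block diagonal and Z = X P is the truncation. *)
have qB0 : \sum_(i in B) q i = 0.
  apply/eqP; rewrite eq_le q0B andbT -(ler_pM2l cd2) mulr0; lra.
have XPZ : Z = X *m P.
  apply/esym/eqP; rewrite -subr_eq0 -frobenius_eq0 -sqrf_eq0 eq_le XPZ0 andbT.
  by move: gap; rewrite qB0 mulr0 addr0; lra.
have NB i j : i \in B -> j \notin nz -> N i j = 0.
  move=> iB jn; have /eqP := qB0; rewrite psumr_eq0// => /allP/(_ i (mem_index_enum _)).
  rewrite iB /= psumr_eq0; last by move=> *; exact: sqr_ge0.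
  by move=> /allP/(_ j (mem_index_enum _)); rewrite jn /= sqrf_eq0 => /eqP.
have NnB i j : i \notin B -> j \in nz -> N i j = 0.
  move=> iB jn; have /eqP := qB0; rewrite sumq psumr_eq0// => /allP/(_ i (mem_index_enum _)).
  rewrite iB /= psumr_eq0; last by move=> *; exact: sqr_ge0.
  by move=> /allP/(_ j (mem_index_enum _)); rewrite jn /= sqrf_eq0 => /eqP.
have E : diag_mx x *m N *m diag_mx D = diag_mx (truncate B x) *m N.
  apply/matrixP => i j; rewrite mul_mx_diagE !mul_diag_mxE ![fun_of_matrix (\row__ _) _ _]mxE.
  have [iB|iB] := boolP (i \in B); have [jn|jn] := boolP (j \in nz); rewrite ?mulr1 ?mulr0 ?mul0r//=.
    by rewrite NB// mulr0.
  by rewrite NnB// ?mulr0 ?mul0r.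
rewrite XPZ /X /P /Y !mulmxA -(mulmxA _ V^T V') -/N.
rewrite -[U *m diag_mx x *m N]mulmxA -[U *m _ *m diag_mx D]mulmxA E /N !mulmxA.
by rewrite -(mulmxA _ V' V'^T) (orthogonal_mxC oV') mulmx1.
Qed.

End LowRank.

Section NearStratum.
Context {R : realType} {n : nat}.
Implicit Types X Y Z U V : 'M[R]_n.

(** The weights of [frobenius_svd_sub] average the squared entries of two orthogonal matrices and so
    form a doubly stochastic matrix. *)
Lemma orthogonal_pair_weights (M N : 'M[R]_n) : orthogonal_mx M -> orthogonal_mx N ->
  let w i j := ((N i j + M i j) / 2) ^+ 2 + ((N i j - M i j) / 2) ^+ 2 in
  (forall i, \sum_j w i j = 1) /\ (forall j, \sum_i w i j = 1).
Proof.
move=> oM oN w.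
have wE i j : w i j = 2^-1 * (N i j ^+ 2) + 2^-1 * (M i j ^+ 2) by rewrite /w; field.
split=> i; under eq_bigr do rewrite wE; rewrite big_split /= -!mulr_sumr.
  by rewrite !orthogonal_row_sqr// !mulr1; field.
by rewrite !orthogonal_col_sqr// !mulr1; field.
Qed.

(** Replaces Weyl's perturbation inequality and needs no ordering of the singular values: the doubly
    stochastic weights act as a fractional matching between the singular values of X and X0, whose
    total cost is below d^2. *)
Lemma rank_neighbor (X0 : 'M[R]_n) : exists2 c : R, 0 < c & forall d X,
  0 < d <= c -> frobenius (X - X0) < d ->
  exists (U V : 'M[R]_n) (x : 'rV[R]_n) (B : {set 'I_n}),
    [/\ [/\ orthogonal_mx U, orthogonal_mx V & X = U *m diag_mx x *m V^T],
     #|B| = \rank X0, forall i, i \in B -> c < `|x 0 i| & forall i, i \notin B -> `|x 0 i| < d].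
Proof.
have [U0 [V0 [y [oU0 oV0 XE0]]]] := singular_value_decomposition X0.
pose nz := finset (fun j => y 0 j != 0).
have rX0 : \rank X0 = #|nz| by rewrite XE0 rank_svd.
have [c c0 yc] : exists2 c : R, 0 < c & forall j, j \in nz -> 2 * c <= `|y 0 j|.
  (* Half the least nonzero |y_j|, capped at 1; the cap covers X0 = 0. *)
  exists (\big[Num.min/1]_(j in nz) (`|y 0 j| / 2)).
    by apply: lt_bigmin => // j; rewrite inE => y0; rewrite divr_gt0// normr_gt0.
  move=> j jn; rewrite mulrC -ler_pdivlMr//.
  exact: bigmin_le_cond.
exists c => // d X /andP[d0 dc] Xd.
have [U [V [x [oU oV XE]]]] := singular_value_decomposition X.
pose B := finset (fun i => c < `|x 0 i|).
have oM : orthogonal_mx (U^T *m U0) by exact/orthogonal_mul/oU0/orthogonal_tr.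
have oN : orthogonal_mx (V^T *m V0) by exact/orthogonal_mul/oV0/orthogonal_tr.
pose w i j := (((V^T *m V0) i j + (U^T *m U0) i j) / 2) ^+ 2 + (((V^T *m V0) i j - (U^T *m U0) i j) / 2) ^+ 2.
have [wr wc] : (forall i, \sum_j w i j = 1) /\ (forall j, \sum_i w i j = 1).
  exact: (orthogonal_pair_weights oM oN).
have w0 i j : 0 <= w i j by rewrite addr_ge0 ?sqr_ge0.
pose g i j := (`|x 0 i| - `|y 0 j|) ^+ 2 * w i j.
have g0 i j : 0 <= g i j by rewrite mulr_ge0 ?sqr_ge0.
have hw : \sum_i \sum_j g i j < d ^+ 2.
  apply: (@le_lt_trans _ _ (frobenius (X - X0) ^+ 2)); last first.
    by rewrite ltrXn2r// ?nnegrE ?frobenius_ge0// ltW.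
  rewrite XE XE0 frobenius_svd_sub//; apply: ler_sum => i _; apply: ler_sum => j _.
  have sq (a b : R) : (`|a| - `|b|) ^+ 2 <= (a - b) ^+ 2.
    rewrite -(real_normK (num_real (`|a| - `|b|))) -(real_normK (num_real (a - b))).
    by rewrite lerXn2r ?nnegrE// ler_dist_dist.
  rewrite /g /w mulrDr lerD// ler_wpM2r ?sqr_ge0//.
  by have := sq (x 0 i) (- y 0 j); rewrite normrN opprK.
have far i j : (i \in B) != (j \in nz) -> d ^+ 2 * w i j <= g i j.
  move=> ij; rewrite ler_wpM2r// -(real_normK (num_real (`|x 0 i| - _))) lerXn2r ?nnegrE ?(ltW d0)//.
  apply: (le_trans dc); move: ij; rewrite [i \in B]inE.
  have [jn|jn] := boolP (j \in nz).
    rewrite eqb_id -leNgt => xc; have := yc _ jn => ycj.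
    by rewrite distrC; apply: le_trans (ler_norm _); lra.
  rewrite eqbF_neg negbK => xc.
  move: jn; rewrite inE negbK => /eqP ->; rewrite normr0 subr0 normr_id; exact: ltW.
exists U, V, x, B; split => //.
(* s1 and s2 collect the weights of mismatched pairs. Such pairs are at least d apart, hence s1 + s2
   < 1 and the integers #|B| and #|nz| coincide. *)
- rewrite rX0; pose s1 := \sum_(i in B) \sum_(j | j \notin nz) w i j.
  pose s2 := \sum_(i | i \notin B) \sum_(j in nz) w i j.
  pose s3 := \sum_(i in B) \sum_(j in nz) w i j.
  have s10 : 0 <= s1 by do 2 (apply: sumr_ge0 => ? _).
  have s20 : 0 <= s2 by do 2 (apply: sumr_ge0 => ? _).
  have E1 : #|B|%:R = s3 + s1.
    rewrite -big_split /= -(sumr_const (mem B) (1 : R)); apply: eq_bigr => i _.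
    by rewrite -(wr i) (bigID (mem nz)).
  have E2 : #|nz|%:R = s3 + s2.
    rewrite -(bigID (mem B) predT) /= exchange_big /= -(sumr_const (mem nz) (1 : R)).
    by apply: eq_bigr => j _; rewrite wc.
  have s12 : s1 + s2 < 1.
    rewrite -(@ltr_pM2l _ (d ^+ 2)) ?exprn_gt0// mulr1; apply: le_lt_trans hw.
    rewrite mulrDr [leRHS](bigID (mem B)) /=; apply: lerD; rewrite mulr_sumr; apply: ler_sum => i iB.
      rewrite [leRHS](bigID (mem nz)) /= mulr_sumr -[leLHS]add0r lerD ?sumr_ge0//.
      by apply: ler_sum => j jn; apply: far; rewrite iB (negbTE jn).
    rewrite [leRHS](bigID (mem nz)) /= mulr_sumr -[leLHS]addr0 lerD ?sumr_ge0//.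
    by apply: ler_sum => j jn; apply: far; rewrite (negbTE iB) jn.
  apply/eqP; rewrite eqn_leq; apply/andP; split; rewrite -ltnS -(ltr_nat R) -natr1; lra.
- by move=> i; rewrite inE.
(* A value between d and c in modulus would be at least d away from every |y_j|, and its row of
   weights, of sum 1, would already cost d^2. *)
- move=> i; rewrite inE -leNgt => xc; rewrite ltNge; apply/negP => dx.
  suff : d ^+ 2 <= \sum_i \sum_j g i j by rewrite leNgt hw.
  rewrite (bigD1 i)//= -[leLHS]addr0 lerD//; last by do 2 (apply: sumr_ge0 => ? _).
  rewrite -[leLHS]mulr1 -(wr i) mulr_sumr; apply: ler_sum => j _.
  have [jn|jn] := boolP (j \in nz).
    by apply: far; rewrite jn inE ltNge xc.
  rewrite /g; move: jn; rewrite inE negbK => /eqP ->; rewrite normr0 subr0 real_normK ?num_real//.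
  by rewrite ler_wpM2r// -(real_normK (num_real (x 0 i))) lerXn2r ?nnegrE// ltW.
Qed.

(** The nearest matrix of rank k drops exactly the singular values below d, and [phi t] kills these
    as soon as t >= d. *)
Lemma metric_proj_Mrank k X0 : Mrank R n k X0 -> exists2 c : R, 0 < c & forall d X,
  0 < d <= c -> frobenius (X - X0) < d ->
  exists2 Y, metric_proj (Mrank R n k) X = [set Y] & forall t, d <= t -> Theta t X = Theta t Y.
Proof.
move=> rX0; have [c c0 H] := rank_neighbor X0; exists c => // d X dc Xd.
have /andP[d0 dlec] := dc.
have [U [V [x [B [[oU oV XE] cB xB xnB]]]]] := H d X dc Xd.
rewrite rX0 in cB.
pose Y := U *m diag_mx (truncate B x) *m V^T.
(* a strict gap, since finitely many singular values lie strictly below d *)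
pose e := \big[Num.max/0]_(i | i \notin B) `|x 0 i|.
have ed : e < d by apply: bigmax_lt.
have e0 : 0 <= e by exact: bigmax_ge_id.
have rY : \rank Y = k.
  rewrite rank_svd// -cB; apply: eq_card => i; rewrite inE mxE.
  have [iB|iB] := boolP (i \in B); last by rewrite mulr0 eqxx.
  by rewrite mulr1 -normr_gt0 (lt_trans c0)// xB.
have EY Z : \rank Z = k -> frobenius (X - Y) <= frobenius (X - Z) /\
    (frobenius (X - Z) <= frobenius (X - Y) -> Z = Y).
  rewrite -cB XE /Y => rZ; apply: (eckart_young (c := c) (d := e)) => //.
  - by rewrite e0 (lt_le_trans ed).
  - by move=> i /xB/ltW.
  - by move=> i iB; exact: le_bigmax_cond.
exists Y.
  apply/seteqP; split => [Z [rZ minZ]|_ ->] /=.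
    by have [_ ->] := EY Z rZ; rewrite // minZ.
  by split => [//|Z rZ]; have [] := EY Z rZ.
move=> t dt; have t0 : 0 < t by rewrite (lt_le_trans d0).
rewrite XE /Y !Theta_svd//; congr (_ *m diag_mx _ *m _); apply/rowP => i.
rewrite !mxE; have [iB|iB] := boolP (i \in B); first by rewrite mulr1.
by rewrite mulr0 !phi_eq0 ?normr0 ?(ltW t0)// (le_trans (ltW (xnB _ iB))).
Qed.

(** Deleting one singular value gives a singular matrix at distance |x_i|, so all |x_i| are at least
    2t and [phi t] fixes them. *)
Lemma Theta_id t X d : 0 < t -> 2 * t < d ->
  (forall Z, frobenius (Z - X) < d -> \det Z != 0) -> Theta t X = X.
Proof.
move=> t0 td nd; have [U [V [x [oU oV XE]]]] := singular_value_decomposition X.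
rewrite XE Theta_svd//; congr (_ *m diag_mx _ *m _); apply/rowP => i; rewrite mxE.
apply: phi_id => //; rewrite leNgt; apply/negP => xt.
pose Z := U *m diag_mx (truncate [set~ i] x) *m V^T.
suff : \det Z != 0.
  rewrite /Z !det_mulmx det_diag (bigD1 i)//= mxE !inE eqxx /= mulr0 mul0r mulr0 mul0r.
  by rewrite eqxx.
apply: nd; rewrite frobenius_distC; apply: le_lt_trans td; apply: le_trans (ltW xt).
rewrite -ler_sqr ?nnegrE ?frobenius_ge0// XE frobenius_truncate//.
rewrite (big_pred1 i) ?real_normK ?num_real// => j.
by rewrite !inE negbK.
Qed.

End NearStratum.

(** * Mollification *)

Section Kernels.
Context {R : realType}.
Local Notation mu := (@lebesgue_measure R).

Lemma Rintegral_shift (G : R -> R) (a b t : R) : a <= b -> continuous G ->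
  \int[mu]_(x in `[a + t, b + t]) G x = \int[mu]_(x in `[a, b]) G (x + t).
Proof.
move=> ab cG; rewrite /Rintegral; congr fine.
have d (x : R) : is_derive x 1 (fun x => x + t) 1.
  by apply: (is_derive_eq (is_deriveD (is_derive_id x 1) (is_derive_cst t x 1))); rewrite addr0.
have dE : derive1 (fun x : R => x + t) = fun=> 1 by exact: is_derive_derive1.
have cs : continuous (fun x : R => x + t) by exact: is_derive_continuous d.
rewrite (@integration_by_substitution_increasing _ (fun x => x + t) G a b ab).
- by apply: eq_integral => x _; rewrite /= fctE dE mulr1.
- by move=> x y _ _; rewrite ltrD2r.
- by rewrite dE => x _; exact: cst_continuous.
- by rewrite dE; exact: is_cvg_cst.
- by rewrite dE; exact: is_cvg_cst.
- split => [x _||]; first exact: ex_derive.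
    exact/cvg_at_right_filter/cs.
  exact/cvg_at_left_filter/cs.
- exact: continuous_subspaceT.
Qed.

(* A gap on both sides of the support makes the kernels stable under derivation. *)
Definition smooth_kernel (u : R -> R) :=
  [/\ smooth1 u, forall s, s < 3^-1 -> u s = 0 & forall s, 2 / 3 < s -> u s = 0].

Lemma kernel_derive1 u : smooth_kernel u -> smooth_kernel (derive1 u).
Proof.
move=> [su u0 u1]; split; first exact: smooth1_derive1.
- move=> s s0; rewrite derive1E; apply: is_derive_val.
  apply: (near_eq_is_derive (f := fun=> 0)).
  by near=> y; rewrite u0//; near: y; exact: lt_nbhsl.
- move=> s s0; rewrite derive1E; apply: is_derive_val.
  apply: (near_eq_is_derive (f := fun=> 0)).
  by near=> y; rewrite u1//; near: y; exact: lt_nbhsr.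
Unshelve. all: by end_near. Qed.

Lemma kernelZ c u : smooth_kernel u -> smooth_kernel (fun s => c * u s).
Proof.
move=> [su u0 u1]; split; first by move=> k; apply: C1Z.
- by move=> s /u0 ->; rewrite mulr0.
- by move=> s /u1 ->; rewrite mulr0.
Qed.

(** The derivative of step(3s - 1): a probability density on [0, 1] whose integral follows from the
    fundamental theorem of calculus. *)
Definition bump_kernel (s : R) : R := 3 * step' (3 * s + (- 1)).

Lemma kernel_bump : smooth_kernel bump_kernel.
Proof.
split.
- move=> k; apply: C1Z; apply: C1_affine.
  rewrite -(is_derive_derive1 (@is_derive_step R)); exact: (smooth1_derive1 smooth1_step).
- by move=> s s0; rewrite /bump_kernel step'_le0 ?mulr0//; lra.
- by move=> s s0; rewrite /bump_kernel step'_ge1 ?mulr0//; lra.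
Qed.

Lemma bump_kernel_ge0 s : 0 <= bump_kernel s.
Proof. by rewrite mulr_ge0// step'_ge0. Qed.

Lemma Rintegral_bump_kernel : \int[mu]_(s in `[0, 1]) bump_kernel s = 1.
Proof.
have d (s : R) : is_derive s 1 (fun s => step (3 * s + (- 1))) (bump_kernel s).
  exact/is_derive1_affine/is_derive_step.
rewrite (Rintegral_FTC2 ltr01 d); last by case: kernel_bump => /smooth1_continuous.
by rewrite mulr0 add0r mulr1 step_ge1 ?step_le0 ?subr0//; lra.
Qed.

Lemma continuousMR (f g : R -> R) : continuous f -> continuous g -> continuous (fun s => f s * g s).
Proof. by move=> cf cg x; apply: (@continuousM R R f g x); [exact: cf|exact: cg]. Qed.

Lemma continuousDR (f g : R -> R) : continuous f -> continuous g -> continuous (fun s => f s + g s).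
Proof. by move=> cf cg x; apply: (@continuousD _ _ _ f g x); [exact: cf|exact: cg]. Qed.

Lemma bump_average_bound (g : R -> R) (e : R) : continuous g ->
  (forall s, 0 <= s <= 1 -> `|g s| <= e) ->
  `|\int[mu]_(s in `[0, 1]) (bump_kernel s * g s)| <= e.
Proof.
move=> cg ge; have cb : continuous bump_kernel by case: kernel_bump => /smooth1_continuous.
have c1 := continuousMR cb cg.
apply: (@le_trans _ _ (\int[mu]_(s in `[0, 1]) `|bump_kernel s * g s|)).
  by apply: le_normr_Rintegral; [exact: measurable_itv|exact: continuous_integrable].
apply: (@le_trans _ _ (\int[mu]_(s in `[0, 1]) (bump_kernel s * e))).
  have c2 : continuous (fun s => `|bump_kernel s * g s|).
    by move=> x; apply: cvg_norm; exact: c1.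
  have c3 : continuous (fun s => bump_kernel s * e).
    by apply: continuousMR => //; exact: cst_continuous.
  apply: le_Rintegral; [exact: measurable_itv|exact: continuous_integrable c2|exact: continuous_integrable c3|].
  move=> s; rewrite /= in_itv /= => s01.
  by rewrite normrM ger0_norm ?bump_kernel_ge0// ler_wpM2l ?bump_kernel_ge0// ge.
rewrite RintegralZr//; last exact: continuous_integrable.
by rewrite Rintegral_bump_kernel mul1r.
Qed.

Lemma is_derive_convolution u (phi : R -> R) (t : R) : smooth_kernel u -> continuous phi ->
  is_derive t 1 (fun t => \int[mu]_(s in `[0, 1]) (u s * phi (s + t)))
    (\int[mu]_(s in `[0, 1]) (- derive1 u s * phi (s + t))).
Proof.
move=> ku cphi.
(* After the substitution the domain would depend on t'. Since the kernel vanishes outside [0, 1],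
   it can be enlarged to an interval that is fixed for t' near t. *)
have shift v (t' : R) : smooth_kernel v -> `|t' - t| < 3^-1 ->
    \int[mu]_(s in `[0, 1]) (v s * phi (s + t')) =
    \int[mu]_(s in `[t - 1, t + 2]) (v (1 * s + (- t')) * phi s).
  move=> [sv v0 v1]; rewrite ltr_distl => /andP[tt' t't].
  pose G (s : R) := v (1 * s + (- t')) * phi s.
  have cG : continuous G.
    apply: continuousMR => //.
    have : smooth1 (fun s : R => v (1 * s + (- t'))) by move=> k; exact: C1_affine.
    exact: smooth1_continuous.
  have -> : \int[mu]_(s in `[0, 1]) (v s * phi (s + t')) =
      \int[mu]_(s in `[0, 1]) G (s + t').
    by apply: eq_Rintegral => s _; rewrite /G mul1r addrK.
  rewrite -(Rintegral_shift t' ler01 cG) Rintegral_mkcond [RHS]Rintegral_mkcond.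
  congr Rintegral; apply/funext => s; rewrite /G; rewrite /patch !mem_setE /= !in_itv /= add0r.
  have [h|h] := boolP (t' <= s <= 1 + t'); have [h'|h'] := boolP (t - 1 <= s <= t + 2) => //.
  - by exfalso; move/negP: h'; apply; move/andP: h => [? ?]; apply/andP; split; lra.
  - move: h; rewrite negb_and -!ltNge => /orP[h|h].
      by rewrite v0 ?mul0r//; have : 0 < 3^-1 :> R by []; lra.
    by rewrite v1 ?mul0r//; lra.
have kdu : smooth_kernel (fun s => - derive1 u s).
  by under eq_fun do rewrite -mulN1r; exact/kernelZ/kernel_derive1.
rewrite (shift (fun s => - derive1 u s)) ?subrr ?normr0 ?invr_gt0//.
apply: (near_eq_is_derive
    (f := fun t' => \int[mu]_(s in `[t - 1, t + 2]) (u (1 * s + (- t')) * phi s))).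
  have t3 : 0 < 3^-1 :> R by rewrite invr_gt0.
  have nt : \forall t' \near t, `|t - t'| < 3^-1.
    exact: (@cvgr_dist_lt _ _ _ _ (nbhs_filter t) id t cvg_id).
  by apply: filterS nt => t' tt'; apply/esym/shift; rewrite // distrC.
have [su _ _] := ku.
have cdu : continuous (derive1 u) by exact/smooth1_continuous/smooth1_derive1.
apply: (@is_derive_Rintegral _ (t - 1) (t + 2) t (fun t' s => u (1 * s + (- t')) * phi s)
  (fun t' s => - derive1 u (1 * s + (- t')) * phi s)).
- move=> t'; apply: continuousMR => //.
  have : smooth1 (fun s : R => u (1 * s + (- t'))) by move=> k; exact: C1_affine.
  exact: smooth1_continuous.
- move=> t' s _.
  have E y : 1 * s + - y = -1 * y + s by rewrite mul1r mulN1r addrC.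
  have d1 : is_derive t' 1 (fun y => u (-1 * y + s)) (-1 * derive1 u (-1 * t' + s)).
    exact/is_derive1_affine/smooth1_is_derive.
  rewrite E; under eq_fun do rewrite E mulrC.
  apply: (is_derive_eq (is_deriveZ (phi s) d1)).
  by rewrite /GRing.scale /=; ring.
- move=> p; apply: (@continuousM R (R * R)%type (fun p => - derive1 u (1 * p.2 + - p.1)) (fun p => phi p.2) p).
    apply: (@continuousN _ _ _ (fun p : R * R => derive1 u (1 * p.2 + - p.1))).
    apply: (@continuous_comp _ _ _ (fun p : R * R => 1 * p.2 + - p.1) (derive1 u)); last exact: cdu.
    apply: (@continuousD _ _ _ (fun p : R * R => 1 * p.2) (fun p : R * R => - p.1) p).
      by apply: (@continuousM R (R * R)%type (fun=> 1) snd p); [exact: cst_continuous|exact: cvg_snd].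
    by apply: (@continuousN _ _ _ (@fst R R) p); exact: cvg_fst.
  by apply: (@continuous_comp _ _ _ snd phi); [exact: cvg_snd|exact: cphi].
Qed.

End Kernels.

Section Mollifier.
Context {R : realType} {n : nat}.
Local Notation mu := (@lebesgue_measure R).
Implicit Types (F : 'M[R]_n -> R) (X Y V : 'M[R]_n).

(** Mollification proceeds one direction at a time, so that only integrals over [0, 1] occur. *)
Definition average (u : R -> R) V F X : R :=
  \int[mu]_(s in `[0, 1]) (u s * F (s *: V + X)).

Lemma continuous_affine_joint V :
  continuous (fun p : R * 'M[R]_n => p.1 *: V + p.2).
Proof.
move=> p; apply: (@continuousD _ _ _ (fun p : R * 'M[R]_n => p.1 *: V) snd p).
  by apply: (@continuous_comp _ _ _ fst (fun s : R => s *: V)); [exact: cvg_fst|exact: scalel_continuous].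
exact: cvg_snd.
Qed.

Lemma continuous_line F V X : continuous F -> continuous (fun s : R => F (s *: V + X)).
Proof.
move=> cF s; apply: (@continuous_comp _ _ _ (fun s : R => s *: V + X) F); last exact: cF.
apply: (@continuousD _ _ _ (fun s : R => s *: V) (fun=> X) s); last exact: cst_continuous.
exact: scalel_continuous.
Qed.

Lemma average_integrand_continuous u V F X : smooth_kernel u -> continuous F ->
  continuous (fun s : R => u s * F (s *: V + X)).
Proof.
move=> [su _ _] cF; apply: continuousMR; first exact: smooth1_continuous.
exact: continuous_line.
Qed.

Lemma continuous_average u V F : smooth_kernel u -> continuous F -> continuous (average u V F).
Proof.
move=> ku cF X; have [su _ _] := ku.
have [C HC] := smooth1_bounded 0 1 su.
apply/(@cvgrPdist_le _ _ _ (nbhs X) (nbhs_filter X)) => e e0.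
have C1 : 0 < `|C| + 1 by rewrite ltr_wpDl.
have d0 : 0 < e / (`|C| + 1) by rewrite divr_gt0.
have cov : \forall Y \near X, `[0, 1]%classic `<=`
    (fun s : R => `|F (s *: V + X) - F (s *: V + Y)| <= e / (`|C| + 1)).
  have nc := (compact_near_coveringP _).1 (@segment_compact R 0 1).
  apply: (nc _ (nbhs X) (fun Y s => `|F (s *: V + X) - F (s *: V + Y)| <= e / (`|C| + 1)) (nbhs_filter X)).
  move=> s _; have d2 : 0 < e / (`|C| + 1) / 2 by rewrite divr_gt0.
  have c1 : \forall s' \near s, `|F (s *: V + X) - F (s' *: V + X)| <= e / (`|C| + 1) / 2.
    have := @continuous_line F V X cF s.
    by move=> /(@cvgrPdist_le _ _ _ (nbhs s) (nbhs_filter s))/(_ _ d2).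
  have c2 : \forall p \near (s, X), `|F (s *: V + X) - F (p.1 *: V + p.2)| <= e / (`|C| + 1) / 2.
    have := @continuous_comp _ _ _ _ F (s, X) (@continuous_affine_joint V (s, X)) (cF _).
    by move=> /(@cvgrPdist_le _ _ _ (nbhs (s, X)) (nbhs_filter (s, X)))/(_ _ d2).
  have [[A B] [/= sA XB] AB] := c2.
  exists (A `&` [set s' | `|F (s *: V + X) - F (s' *: V + X)| <= e / (`|C| + 1) / 2], B).
    by split => //=; apply: filterI.
  move=> [s' Y] [/= [As' h1] BY]; have /= h2 := AB (s', Y) (conj As' BY).
  rewrite distrC in h1; have := lerD h1 h2; rewrite -splitr; apply: le_trans.
  by apply: le_trans (ler_normD _ _); rewrite addrA subrK.
apply: filterS cov => Y YF.
rewrite /average -RintegralB; [|exact: measurable_itv|exact/continuous_integrable/average_integrand_continuous|exact/continuous_integrable/average_integrand_continuous].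
apply: Rintegral_bound.
  apply: (@continuousDR _ (fun s => u s * F (s *: V + X)) (fun s => - (u s * F (s *: V + Y)))).
    exact: average_integrand_continuous.
  move=> s; apply: (@continuousN _ _ _ (fun s : R => u s * F (s *: V + Y))).
  exact: average_integrand_continuous.
move=> s s01; rewrite -mulrBr normrM.
apply: (@le_trans _ _ (`|C| * (e / (`|C| + 1)))).
  rewrite ler_pM//; last by apply: YF; rewrite /= in_itv.
  by apply: le_trans (ler_norm _); apply: HC; case/andP: s01 => s0 s1; rewrite ger0_norm.
rewrite mulrA ler_pdivrMr// mulrC ler_wpM2l ?(ltW e0)// lerDl//.
Qed.

Lemma is_derive_average u V W F X : smooth_kernel u -> continuous F ->
  (forall Y, derivable F Y W) -> continuous (fun Y => 'D_W F Y) ->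
  is_derive X W (average u V F) (average u V (fun Y => 'D_W F Y) X).
Proof.
move=> ku cF dF cD; apply: is_derive_of_line.
have E t s : s *: V + (t *: W + X) = t *: W + (s *: V + X) by rewrite addrCA.
have -> : average u V (fun Y => 'D_W F Y) X =
    \int[mu]_(s in `[0, 1]) (u s * 'D_W F (s *: V + (0 *: W + X))).
  by rewrite scale0r add0r.
apply: (@is_derive_Rintegral _ 0 1 0 (fun t s => u s * F (s *: V + (t *: W + X)))
  (fun t s => u s * 'D_W F (s *: V + (t *: W + X)))).
- by move=> t; exact: average_integrand_continuous.
- move=> t s _; rewrite E; under eq_fun do rewrite E.
  by apply: is_deriveZ; apply: is_derive_line; exact/derivableP.
- have [su _ _] := ku; move=> p.
  apply: (@continuousM R (R * R)%type (fun p => u p.2) (fun p => 'D_W F (p.2 *: V + (p.1 *: W + X))) p).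
    by apply: (@continuous_comp _ _ _ snd u); [exact: cvg_snd|exact: smooth1_continuous].
  apply: (@continuous_comp _ _ _ (fun p : R * R => p.2 *: V + (p.1 *: W + X)) (fun Y => 'D_W F Y)); last exact: cD.
  apply: (@continuousD _ _ _ (fun p : R * R => p.2 *: V) (fun p => p.1 *: W + X) p).
    by apply: (@continuous_comp _ _ _ snd (fun s : R => s *: V)); [exact: cvg_snd|exact: scalel_continuous].
  apply: (@continuousD _ _ _ (fun p : R * R => p.1 *: W) (fun=> X) p); last exact: cst_continuous.
  by apply: (@continuous_comp _ _ _ fst (fun s : R => s *: W)); [exact: cvg_fst|exact: scalel_continuous].
Qed.

Lemma is_derive_average_same u r E F X : 0 < r -> smooth_kernel u -> continuous F ->
  is_derive X E (average u (r *: E) F) (average (fun s => - r^-1 * derive1 u s) (r *: E) F X).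
Proof.
move=> r0 ku cF; apply: is_derive_of_line.
have c := continuous_line (V := r *: E) (X := X) cF.
have d := is_derive_convolution (r^-1 * 0 + 0) ku c.
have d2 := is_derive1_affine d.
have -> : (fun t : R => average u (r *: E) F (t *: E + X)) =
    (fun y : R => \int[mu]_(s in `[0, 1]) (u s * F ((s + (r^-1 * y + 0)) *: (r *: E) + X))).
  apply/funext => y; apply: eq_Rintegral => s _; congr (_ * F _).
  by rewrite addr0 scalerDl -addrA; congr (_ + (_ + _)); rewrite scalerA mulrAC mulVf ?mul1r// gt_eqF.
apply: (is_derive_eq d2).
have ic : mu.-integrable `[0, 1] (EFin \o (fun s => - derive1 u s * F ((s + (r^-1 * 0 + 0)) *: (r *: E) + X))).
  have [su _ _] := ku; apply: continuous_integrable; apply: continuousMR.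
    by move=> s; apply: (@continuousN _ _ _ (derive1 u)); exact: (smooth1_continuous (smooth1_derive1 su)).
  by under eq_fun do rewrite scalerDl -addrA; exact: continuous_line.
rewrite /average -RintegralZl//.
by apply: eq_Rintegral => s _; rewrite mulr0 !addr0; ring.
Qed.

Definition coord_dir (p : 'I_n * 'I_n) : 'M[R]_n := delta_mx p.1 p.2.

(** Each direction carries its own kernel, because a derivative is again such a mollification with
    one kernel differentiated. *)
Fixpoint mollify (r : R) (s : seq ((R -> R) * ('I_n * 'I_n))) F : 'M[R]_n -> R :=
  if s is q :: s' then average q.1 (r *: coord_dir q.2) (mollify r s' F) else F.

Fixpoint kernels (s : seq ((R -> R) * ('I_n * 'I_n))) : Prop :=
  if s is q :: s' then smooth_kernel q.1 /\ kernels s' else True.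

Lemma continuous_mollify r s F : kernels s -> continuous F -> continuous (mollify r s F).
Proof.
by elim: s => [//|q s IH] /= [ku ks] cF; apply: continuous_average => //; exact: IH.
Qed.

(** The derivative passes through the outer averages until it meets the one in direction p, whose
    kernel absorbs it; F itself is never differentiated. *)
Lemma is_derive_mollify r s F p : 0 < r -> kernels s -> continuous F -> p \in unzip2 s ->
  exists s', [/\ kernels s', unzip2 s' = unzip2 s &
    forall X, is_derive X (coord_dir p) (mollify r s F) (mollify r s' F X)].
Proof.
move=> r0; elim: s => [//|[u q] s IH] /= [ku ks] cF.
have cs := continuous_mollify (r := r) ks cF.
have [-> _|pq] := eqVneq p q.
  exists ((fun s => - r^-1 * derive1 u s, q) :: s) => /=; split => //.
    by split => //; apply: kernelZ; exact: kernel_derive1.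
  by move=> X; exact: is_derive_average_same.
rewrite inE (negbTE pq) /= => ps; have [s' [ks' ss' ds']] := IH ks cF ps.
exists ((u, q) :: s') => /=; split => //; first by rewrite ss'.
move=> X.
have DE : (fun Y => 'D_(coord_dir p) (mollify r s F) Y) = mollify r s' F.
  by apply/funext => Y; exact: is_derive_val.
rewrite -DE; apply: is_derive_average => //.
by rewrite DE; exact: continuous_mollify.
Qed.

Lemma Cfin_mollify k r s F : 0 < r -> kernels s -> continuous F ->
  (forall p, p \in unzip2 s) -> Cfin k (mollify r s F).
Proof.
move=> r0; elim: k s => [|k IH] s ks cF as'; first exact: continuous_mollify.
apply: Cfin_intro => [X i j|i j]; have [s' [ks' ss' ds']] := is_derive_mollify r0 ks cF (as' (i, j)).
  exact: (@ex_derive _ _ _ _ _ _ _ (ds' X)).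
have -> : (fun X => 'D_(delta_mx i j) (mollify r s F) X) = mollify r s' F.
  by apply/funext => X; exact: (is_derive_val (ds' X)).
by apply: IH => // p; rewrite ss'.
Qed.

Definition bump_kernels (ps : seq ('I_n * 'I_n)) : seq ((R -> R) * ('I_n * 'I_n)) :=
  [seq (@bump_kernel R, p) | p <- ps].

Lemma kernels_bump ps : kernels (bump_kernels ps).
Proof. by elim: ps => [//|p ps IH] /=; split => //; exact: kernel_bump. Qed.

Lemma average_subr V F X (v : R) : continuous F ->
  average (@bump_kernel R) V F X - v = \int[mu]_(s in `[0, 1]) (bump_kernel s * (F (s *: V + X) - v)).
Proof.
move=> cF; have kb := @kernel_bump R; have cb : continuous (@bump_kernel R) by case: kb => /smooth1_continuous.
have vE : v = \int[mu]_(s in `[0, 1]) (bump_kernel s * v).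
  rewrite RintegralZr; [|exact: measurable_itv|exact: continuous_integrable].
  by rewrite Rintegral_bump_kernel mul1r.
rewrite {1}vE.
rewrite /average -RintegralB; [|exact: measurable_itv|exact/continuous_integrable/average_integrand_continuous|]; last first.
  by apply: continuous_integrable; apply: continuousMR => //; exact: cst_continuous.
by apply: eq_Rintegral => s _; rewrite mulrBr.
Qed.

Lemma mollify_bound r ps F X (v e : R) : 0 < r -> continuous F ->
  (forall Y, frobenius (Y - X) <= (size ps)%:R * r -> `|F Y - v| <= e) ->
  `|mollify r (bump_kernels ps) F X - v| <= e.
Proof.
move=> r0 cF; elim: ps X => [|p ps IH] X Fe.
  by apply: Fe; rewrite subrr frobenius0 mul0r.
have cs := continuous_mollify (r := r) (kernels_bump ps) cF.
rewrite [mollify _ _ _]/= average_subr//; apply: bump_average_bound.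
  apply: (@continuousDR _ _ (fun=> - v)); last exact: cst_continuous.
  exact: continuous_line.
move=> s /andP[s0 s1]; apply: IH => Y Ys; apply: Fe.
have -> : Y - X = (Y - (s *: (r *: coord_dir p) + X)) + s *: (r *: coord_dir p).
  by rewrite opprD addrA [RHS]addrAC addrNK.
apply: (le_trans (frobeniusD _ _)); rewrite -[size (p :: ps)]/((size ps).+1) -natr1 mulrDl mul1r lerD//.
rewrite !frobeniusZ frobenius_delta mulr1 !ger0_norm ?(ltW r0)//.
by rewrite ger_pMl.
Qed.

Lemma mollify_lipschitz r ps F (L : R) : 0 < r -> continuous F ->
  (forall X Y, `|F X - F Y| <= L * frobenius (X - Y)) ->
  forall X Y, `|mollify r (bump_kernels ps) F X - mollify r (bump_kernels ps) F Y| <= L * frobenius (X - Y).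
Proof.
move=> r0 cF FL; elim: ps => [//|p ps IH] X Y.
have cs := continuous_mollify (r := r) (kernels_bump ps) cF.
have kb := @kernel_bump R; have cb : continuous (@bump_kernel R) by case: kb => /smooth1_continuous.
set V := r *: coord_dir p; set G := mollify r (bump_kernels ps) F.
rewrite ![mollify _ _ _]/= -/V -/G /average -RintegralB; [|exact: measurable_itv|exact/continuous_integrable/average_integrand_continuous|exact/continuous_integrable/average_integrand_continuous].
have -> : \int[mu]_(s in `[0, 1]) (bump_kernel s * G (s *: V + X) - bump_kernel s * G (s *: V + Y)) =
    \int[mu]_(s in `[0, 1]) (bump_kernel s * (G (s *: V + X) + - G (s *: V + Y))).
  by apply: eq_Rintegral => s _; rewrite mulrBr.
apply: bump_average_bound.
  apply: continuousDR; first exact: continuous_line.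
  by move=> s; apply: (@continuousN _ _ _ (fun s : R => G (s *: V + Y))); exact: continuous_line.
move=> s _; apply: (le_trans (IH _ _)).
by rewrite opprD addrACA subrr add0r.
Qed.

(** v and e are left free: v = f X gives approximation, and v = e = 0 gives vanishing wherever F
    vanishes nearby. *)
Lemma mollifier F (d : R) : continuous F -> 0 < d -> exists G : 'M[R]_n -> R,
  [/\ forall k, Cfin k G,
   forall X v e, (forall Y, frobenius (Y - X) <= d -> `|F Y - v| <= e) -> `|G X - v| <= e &
   forall L, (forall X Y, `|F X - F Y| <= L * frobenius (X - Y)) ->
     forall X Y, `|G X - G Y| <= L * frobenius (X - Y)].
Proof.
move=> cF d0; pose ps := enum {: 'I_n * 'I_n}.
pose r := d / ((size ps)%:R + 1).
have r0 : 0 < r by rewrite divr_gt0// ltr_wpDl.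
exists (mollify r (bump_kernels ps) F); split.
- move=> k; apply: Cfin_mollify => //; first exact: kernels_bump.
  by move=> p; rewrite /unzip2 -map_comp map_id mem_enum.
- move=> X v e FX; apply: mollify_bound => // Y Yr; apply: FX; apply: (le_trans Yr).
  by rewrite /r mulrCA ger_pMr// ler_pdivrMr ?ltr_wpDl// mul1r lerDl.
- by move=> L; exact: mollify_lipschitz.
Qed.

End Mollifier.

(** * Gluing *)

Section Toolbox.
Context {R : realType} {n : nat}.
Implicit Types (F G : 'M[R]_n -> R) (X Y Z V : 'M[R]_n).

Lemma Cfin_prod k (I : Type) (r : seq I) (F : I -> 'M[R]_n -> R) :
  (forall i, Cfin k (F i)) -> Cfin k (fun X => \prod_(i <- r) F i X).
Proof.
move=> CF; elim: r => [|i r IH].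
  have -> : (fun X => \prod_(i <- [::]) F i X) = (fun=> 1) by apply/funext => x; rewrite big_nil.
  exact: Cfin_cst.
have -> : (fun X => \prod_(j <- i :: r) F j X) = (fun X => F i X * \prod_(j <- r) F j X).
  by apply/funext => x; rewrite big_cons.
exact: CfinM.
Qed.

Lemma continuous_det : continuous (fun X => \det X).
Proof.
apply: (@Cfin_continuous _ _ 0%N); apply: Cfin_sum => s; apply: CfinZ.
by apply: Cfin_prod => i; exact: Cfin_coord.
Qed.

(** Heine-Borel is applied to row vectors and carried over by [vec_mx]. *)
Lemma compact_frobenius_ball (r : R) : compact [set X : 'M[R]_n | frobenius X <= r].
Proof.
pose A := [set v : 'rV[R]_(n * n) | frobenius (vec_mx v : 'M[R]_n) <= r].
have cv : continuous (@vec_mx R n n).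
  apply: continuous_mx => i j.
  have -> : (fun v : 'rV[R]_(n * n) => vec_mx v i j) = (fun v => v 0 (mxvec_index i j)).
    by apply/funext => v; rewrite mxE.
  exact: coord_continuous.
have cfro : continuous (@frobenius R n).
  move=> X; apply: (@continuous_at_lipschitz _ _ _ _ 1) => Y _; rewrite mul1r ler_norml.
  have h1 := frobeniusD (Y - X) X; have h2 := frobeniusD (X - Y) Y.
  rewrite !subrK in h1 h2; rewrite frobenius_distC in h2; apply/andP; split; lra.
have -> : [set X : 'M[R]_n | frobenius X <= r] = (@vec_mx R n n) @` A.
  apply/seteqP; split => [X Xr|_ [v vr <-]//].
  by exists (mxvec X); rewrite /A /= mxvecK.
apply: continuous_compact; first exact: continuous_subspaceT.
apply: bounded_closed_compact.
  exists r; split; first exact: num_real.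
  move=> x rx v /= vr; rewrite [leLHS]/Num.norm /= mx_normrE; apply: bigmax_le.
    by apply: le_trans (ltW rx); apply: le_trans vr; exact: frobenius_ge0.
  move=> [i j] _ /=; rewrite ord1; case/mxvec_indexP: j => a b.
  have := frobenius_coord (vec_mx v : 'M[R]_n) a b; rewrite mxE => h.
  by apply: (le_trans h); apply: (le_trans vr); exact: ltW.
have -> : A = (fun v => frobenius (vec_mx v : 'M[R]_n)) @^-1` [set x | x <= r] by [].
apply: closed_comp; last exact: closed_le.
by move=> v _; apply: continuous_comp; [exact: cv|exact: cfro].
Qed.

(** A local property of pairs of nearby points holds on a compact set with one uniform radius. *)
Lemma lebesgue_number (K : set 'M[R]_n) (Q : 'M[R]_n -> 'M[R]_n -> Prop) : compact K ->
  (forall X, K X -> exists2 d, 0 < d &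
     forall Z Y, frobenius (Z - X) < d -> frobenius (Y - X) < d -> Q Z Y) ->
  exists2 d, 0 < d & forall Z Y, K Z -> frobenius (Y - Z) < d -> Q Z Y.
Proof.
move=> cK HQ.
have nc := (compact_near_coveringP _).1 cK.
have : \forall d \near (0 : R)^'+, K `<=` (fun Z => forall Y, frobenius (Y - Z) < d -> Q Z Y).
  apply: (nc R (0 : R)^'+ (fun d Z => forall Y, frobenius (Y - Z) < d -> Q Z Y)).
  move=> X KX; have [d d0 dQ] := HQ X KX.
  have d2 : 0 < d / 2 by rewrite divr_gt0.
  exists ([set Z | frobenius (Z - X) < d / 2], [set e | e < d / 2]).
    by split; [exact: near_frobenius|exact: nbhs_right_lt].
  move=> [Z e] [/= ZX ed] Y YZ; apply: dQ; first by apply: lt_trans ZX _; rewrite ltr_pdivrMr// ltr_pMr// ltr1n.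
  have := frobeniusD (Y - Z) (Z - X); rewrite addrA subrK => h.
  by apply: (le_lt_trans h); rewrite (splitr d) ltrD// (lt_trans YZ).
move=> near0.
have [d /= [d0 dK]] := filter_ex (filterI (nbhs_right_gt (0 : R)) near0).
by exists d => // Z Y KZ YZ; exact: dK.
Qed.

Lemma Cfin_local k F : (forall X, exists2 G, Cfin k G & \forall Y \near X, F Y = G Y) -> Cfin k F.
Proof.
elim: k F => [|k IH] F HF.
  move=> X; have [G CG FG] := HF X.
  have FX : F X = G X by exact: nbhs_singleton FG.
  rewrite /continuous_at FX; apply: cvg_trans (CG X); apply: (@near_eq_cvg _ _ (nbhs X) (nbhs_filter X)).
  by apply: (@filterS _ (nbhs X) (nbhs_filter X) _ _ _ FG) => Y ->.
apply: Cfin_intro => [X i j|i j].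
  have [G CG FG] := HF X; apply: (@near_eq_derivable _ _ _ G).
    by apply: filterS FG => Y ->.
  exact/diff_derivable/(Cfin_differentiable CG).
apply: IH => X; have [G CG FG] := HF X.
exists (fun Y => 'D_(delta_mx i j) G Y); first exact: Cfin_derive.
have := near_join FG; apply: filterS => Y FGY.
exact: near_eq_derive.
Qed.

Lemma Csmooth_local p F :
  (forall X, exists2 G, Csmooth p G & \forall Y \near X, F Y = G Y) -> Csmooth p F.
Proof.
move=> HF; apply/Csmooth_Cfin => k kp; apply: Cfin_local => X.
by have [G CG FG] := HF X; exists G => //; exact: (Csmooth_Cfin p G).1 CG k kp.
Qed.

Lemma lipschitz_derive_bound F X V (K l : R) :
  (\forall Y \near X, `|F Y - F X| <= K * frobenius (Y - X)) -> is_derive X V F l ->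
  `|l| <= K * frobenius V.
Proof.
move=> /nbhs_frobeniusP[d d0 FK] dF; apply/ler_addgt0Pr => e e0.
have H : h^-1 *: (F (h *: V + X) - F X) @[h --> 0^'] --> l.
  have <- := @derive_val _ _ _ _ _ _ _ dF.
  exact: (@ex_derive _ _ _ _ _ _ _ dF).
have N := (cvgrPdist_le _ _).1 H e e0.
have V0 : 0 < frobenius V + 1 by rewrite ltr_wpDl ?frobenius_ge0.
have small : \forall h \near (0 : R)^', `|h| < d / (frobenius V + 1).
  by apply: dnbhs0_lt; rewrite divr_gt0.
have [h [[h0 hl] hd]] := filter_ex (filterI (filterI (nbhs_dnbhs_neq (0 : R)) (N _)) small).
have -> : l = (l - h^-1 *: (F (h *: V + X) - F X)) + h^-1 *: (F (h *: V + X) - F X) by rewrite subrK.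
apply: (le_trans (ler_normD _ _)); rewrite addrC lerD//.
rewrite normrZ normfV ler_pdivrMl ?normr_gt0//.
have E : frobenius (h *: V + X - X) = `|h| * frobenius V by rewrite addrK frobeniusZ.
apply: (le_trans (FK _ _)); last by rewrite E mulrCA.
rewrite E; apply: (@le_lt_trans _ _ (`|h| * (frobenius V + 1))).
  by rewrite ler_wpM2l// lerDl.
by rewrite -ltr_pdivlMr.
Qed.

(** Together with [lipschitz_derive_bound] it allows Lipschitz constants to be estimated pointwise,
    where only one transition of the gluing is active. *)
Lemma lipschitz_of_derive_bound F (K : R) :
  (forall X V, derivable F X V) -> (forall X V, `|'D_V F X| <= K * frobenius V) ->
  forall X Y, `|F X - F Y| <= K * frobenius (X - Y).
Proof.
move=> dF FK X Y.
have [t _] := @mvt_line _ _ F Y (X - Y) 1 (fun t => dF _ _).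
by rewrite scale1r subrK mul1r => ->.
Qed.

Lemma lip_le F (K : R) : (forall X Y, `|F X - F Y| <= K * frobenius (X - Y)) -> (lip F <= K%:E)%E.
Proof.
move=> FK; apply: ge_ereal_sup => _ [[X Y] /= /eqP XY <-]; rewrite lee_fin.
by rewrite ler_pdivrMr ?frobenius_gt0 ?subr_eq0.
Qed.

Lemma lip_lipschitz F X Y (L : R) : lip F = L%:E -> `|F X - F Y| <= L * frobenius (X - Y).
Proof.
move=> LE; have [->|XY] := eqVneq X Y; first by rewrite !subrr normr0 frobenius0 mulr0.
rewrite -ler_pdivrMr ?frobenius_gt0 ?subr_eq0// -lee_fin -LE.
by apply: ereal_sup_ubound; exists (X, Y) => //=; exact/eqP.
Qed.

(** For n = 0 no two matrices differ and the supremum is -oo, whence the hypothesis on n. *)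
Lemma lip_fin F : (0 < n)%N -> lipschitz_continuous F -> exists2 L : R, 0 <= L & lip F = L%:E.
Proof.
move=> n0; rewrite /lipschitz_continuous.
have : (0 <= lip F)%E.
  pose i : 'I_n := Ordinal n0.
  have d0 : (delta_mx i i : 'M[R]_n) <> 0.
    by move/matrixP/(_ i i)/eqP; rewrite !mxE !eqxx /= oner_eq0.
  apply: (@le_trans _ _ (`|F (delta_mx i i) - F 0| / frobenius (delta_mx i i - 0 : 'M[R]_n))%:E).
    by rewrite lee_fin divr_ge0// frobenius_ge0.
  by apply: ereal_sup_ubound; exists (delta_mx i i, 0).
case: (lip F) => [L| |]//; rewrite lee_fin => L0 _; by exists L.
Qed.

End Toolbox.

(** * Interpolation between consecutive approximations *)

Section Interpolate.
Context {R : realType}.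

(** For J <= y <= J + 1 the sum telescopes to a convex combination of a_J and a_(J+1), provided that
    J < N. *)
Definition interpolate (N : nat) (y : R) (a : nat -> R) : R :=
  a 0%N + \sum_(0 <= j < N) step (y - j%:R) * (a j.+1 - a j).

Lemma interpolateE N J y a : (J < N)%N -> J%:R <= y < J.+1%:R ->
  interpolate N y a = (1 - step (y - J%:R)) * a J + step (y - J%:R) * a J.+1.
Proof.
move=> JN /andP[Jy yJ]; rewrite /interpolate (big_cat_nat (n := J.+1))//= big_nat_recr//=.
have -> : \sum_(0 <= j < J) step (y - j%:R) * (a j.+1 - a j) = a J - a 0%N.
  rewrite -telescope_sumr//; apply: eq_big_nat => j /andP[_ jJ].
  rewrite step_ge1 ?mul1r// lerBrDr addrC natr1; apply: le_trans Jy.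
  by rewrite ler_nat.
have -> : \sum_(J.+1 <= j < N) step (y - j%:R) * (a j.+1 - a j) = 0.
  rewrite big_nat_cond big1// => j /andP[/andP[Jj _] _].
  by rewrite step_le0 ?mul0r// subr_le0 (le_trans (ltW yJ))// ler_nat.
by ring.
Qed.

Lemma interpolate_derivE N J y (c : nat -> R) : (J < N)%N -> J%:R <= y < J.+1%:R ->
  \sum_(0 <= j < N) c j * step' (y - j%:R) = c J * step' (y - J%:R).
Proof.
move=> JN /andP[Jy yJ]; rewrite (big_cat_nat (n := J.+1))//= big_nat_recr//=.
rewrite big_nat_cond big1 => [|j /andP[/andP[_ jJ] _]]; last first.
  rewrite step'_ge1 ?mulr0// lerBrDr addrC natr1; apply: le_trans Jy.
  by rewrite ler_nat.
rewrite add0r big_nat_cond big1 ?addr0// => j /andP[/andP[Jj _] _].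
by rewrite step'_le0 ?mulr0// subr_le0 (le_trans (ltW yJ))// ler_nat.
Qed.

End Interpolate.

Section InterpolateFunctions.
Context {R : realType} {n : nat}.
Implicit Types (S : 'M[R]_n -> R) (a : nat -> 'M[R]_n -> R) (X V : 'M[R]_n).

Lemma eq_interpolate N (y : R) (a b : nat -> R) :
  (forall j, (j <= N)%N -> a j = b j) -> interpolate N y a = interpolate N y b.
Proof.
move=> ab; rewrite /interpolate ab//; congr (_ + _); apply: eq_big_nat => j /andP[_ jN].
by rewrite !ab// ltnW.
Qed.

(** The cut N is immaterial beyond y, so near a point one fixed N can replace the discontinuous
    truncation. *)
Lemma interpolate_trunc N (y : R) (c : nat -> R) : 0 <= y -> y < N%:R ->
  interpolate (Num.trunc y).+1 y c = interpolate N y c.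
Proof.
move=> y0 yN; have yJ := truncn_itv y0.
by rewrite !(interpolateE _ _ yJ)// truncn_lt_nat.
Qed.

Lemma Cfin_interpolate k N S a : Cfin k S -> (forall j, Cfin k (a j)) ->
  Cfin k (fun X => interpolate N (S X) (a^~ X)).
Proof.
move=> CS Ca; apply: CfinD => //; apply: Cfin_sum => j; apply: CfinM; last exact: CfinB.
apply: Cfin_comp1; first exact: smooth1_step.
by apply: CfinB => //; exact: Cfin_cst.
Qed.

Lemma is_derive_interpolate N S a X V s b : differentiable S X ->
  is_derive X V S s -> (forall j, is_derive X V (a j) (b j)) ->
  is_derive X V (fun X => interpolate N (S X) (a^~ X))
    (interpolate N (S X) b + \sum_(0 <= j < N) (a j.+1 X - a j X) * s * step' (S X - j%:R)).
Proof.
move=> dS DS Da; elim: N => [|N IH].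
  rewrite /interpolate big_nil addr0 big_nil addr0.
  by under eq_fun do rewrite big_nil addr0; exact: Da.
have E (y : R) c : interpolate N.+1 y c = interpolate N y c + step (y - N%:R) * (c N.+1 - c N).
  by rewrite /interpolate big_nat_recr//= addrA.
under eq_fun do rewrite E; rewrite E big_nat_recr//=.
have dSN : differentiable (fun X => S X - N%:R) X by apply: differentiableB.
have DSN : is_derive X V (fun X => S X - N%:R) s.
  by have := is_deriveB DS (is_derive_cst (N%:R : R) X V); rewrite subr0.
have Dstep := is_derive_comp1 V dSN (is_derive_step (S X - N%:R)).
rewrite (is_derive_val DSN) in Dstep.
have Dab := is_deriveB (Da N.+1) (Da N).
apply: (is_derive_eq (is_deriveD IH (is_deriveM Dstep Dab))).
rewrite (_ : (a N.+1 - a N) X = a N.+1 X - a N X)// /GRing.scale /=.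
by rewrite [(_ - _) * (s * _)]mulrA addrACA addrA -!addrA (addrCA (step _ * _)).
Qed.

Lemma trunc_nbhs S X : continuous S -> (forall Y, 0 <= S Y) ->
  \forall Y \near X, S Y < (Num.trunc (S X)).+2%:R.
Proof.
move=> cS S0; have := truncn_itv (S0 X) => /andP[_ SX].
apply: (cvgr_lt _ (cS X)); apply: (lt_le_trans SX).
by rewrite ler_nat.
Qed.

End InterpolateFunctions.

Section Size.
Context {R : realType} {n : nat}.
Implicit Types (X Y V : 'M[R]_n).

Lemma Cfin_mxdot_self k : Cfin k (fun X => mxdot X X).
Proof.
have -> : (fun X => mxdot X X) = (fun X => \sum_i \sum_j X i j * X i j).
  by apply/funext => X; rewrite mxdotE.
by apply: Cfin_sum => i; apply: Cfin_sum => j; apply: CfinM; exact: Cfin_coord.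
Qed.

Lemma mxdot_subr_sqr X Y :
  mxdot Y Y - mxdot X X = 2 * mxdot X (Y - X) + frobenius (Y - X) ^+ 2.
Proof.
have [D ->] : exists D, Y = D + X by exists (Y - X); rewrite subrK.
by rewrite addrK frobenius_sqr !mxdotDl !mxdotDr (mxdotC D X); ring.
Qed.

Definition height X : R := mxdot (Theta 1 X) (Theta 1 X).

Lemma height_ge0 X : 0 <= height X.
Proof. by rewrite /height -frobenius_sqr sqr_ge0. Qed.

Lemma Cfin_height k : Cfin k height.
Proof.
apply: (@Cfin_comp R k n n (fun X => mxdot X X) (Theta 1)); last exact: Cfin_mxdot_self.
by move=> i j; exact: Cfin_Theta.
Qed.

Lemma derive_height X V : `|'D_V height X| <= 46 * frobenius (Theta 1 X) * frobenius V.
Proof.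
set a := frobenius (Theta 1 X).
have DS := Cfin_is_derive X V (Cfin_height 1).
apply/ler_addgt0Pr => e e0.
pose e' := e / (frobenius V + 1).
have V0 : 0 < frobenius V + 1 by rewrite ltr_wpDl ?frobenius_ge0.
have e'0 : 0 < e' by rewrite divr_gt0.
have : `|'D_V height X| <= (46 * a + e') * frobenius V.
  apply: (lipschitz_derive_bound _ DS).
  (* Within this radius the quadratic term (23 u)^2 is at most e' u. *)
  have d0 : 0 < e' / (23 * 23) by rewrite divr_gt0.
  apply: filterS (near_frobenius X d0) => Y; set u := frobenius (Y - X) => ud.
  pose D := Theta 1 Y - Theta 1 X.
  have D23 : frobenius D <= 23 * u by exact: Theta_lipschitz.
  have -> : height Y - height X = 2 * mxdot (Theta 1 X) D + frobenius D ^+ 2.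
    exact: mxdot_subr_sqr.
  have u0 : 0 <= u by exact: frobenius_ge0.
  have a0 : 0 <= a by exact: frobenius_ge0.
  have D0 := frobenius_ge0 D.
  have cs : `|mxdot (Theta 1 X) D| <= a * frobenius D by exact: mxdot_cauchy_schwarz.
  apply: (le_trans (ler_normD _ _)); rewrite normrM ger0_norm// (@ger0_norm _ (_ ^+ 2)) ?sqr_ge0//.
  have h1 : a * frobenius D <= a * (23 * u) by rewrite ler_wpM2l.
  have h2 : frobenius D ^+ 2 <= (23 * u) ^+ 2 by rewrite ler_sqr ?nnegrE ?mulr_ge0.
  have h3 : (23 * 23) * u * u <= e' * u by rewrite ler_wpM2r// mulrC -ler_pdivlMr// ltW.
  nra.
move=> H; apply: (le_trans H); rewrite mulrDl lerD2l.
rewrite /e' mulrAC ler_pdivrMr// ler_wpM2l ?ltW//.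
by rewrite ltrDl.
Qed.

Lemma frobenius_Theta_height X (j : nat) : height X < j.+1%:R -> frobenius (Theta 1 X) <= j.+1%:R.
Proof.
rewrite /height -frobenius_sqr => h.
rewrite -ler_sqr ?nnegrE ?frobenius_ge0//; apply: (le_trans (ltW h)).
by rewrite -natrX ler_nat expnS expn1 leq_pmulr.
Qed.

Lemma frobenius_height X (j : nat) : height X < j.+1%:R -> frobenius X <= j.+1%:R + n%:R * 2.
Proof.
move=> /frobenius_Theta_height h.
have := frobeniusD (Theta 1 X) (X - Theta 1 X); rewrite addrC subrK => h'.
apply: (le_trans h'); apply: lerD => //.
rewrite frobenius_distC; have := Theta_dist X (ltr01 : (0 : R) < 1).
by rewrite mulr1.
Qed.

(* [mpinvT X] points along the singular directions of [X], where the derivative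
   of [Theta t] is again given by a smooth function of the singular values. *)
Lemma derive_Theta_mpinvT t (G : 'M[R]_n -> R) : 0 < t -> Cfin 1 G ->
  exists2 c : 'M[R]_n -> R, continuous c &
    forall X, is_derive X (mpinvT X) (fun X => G (Theta t X)) (c X).
Proof.
move=> t0 CG.
exists (fun X => \sum_i \sum_j svcalc (cutoff_mp t) X i j * 'D_(delta_mx i j) G (Theta t X)).
  apply: (@Cfin_continuous _ _ 0%N); apply: Cfin_sum => i; apply: Cfin_sum => j.
  apply: CfinM; first by apply: Cfin_svcalc; exact: smooth1_cutoff_mp.
  apply: (@Cfin_comp R 0 n n (fun Y => 'D_(delta_mx i j) G Y) (Theta t)) => [a b|].
    exact: Cfin_Theta.
  exact: Cfin_derive.
move=> X.
have dT i j : differentiable (fun X => Theta t X i j) X.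
  exact: (Cfin_differentiable (Cfin_Theta 1 t i j)).
have [dGT E] := derive_compE (mpinvT X) dT (Cfin_differentiable CG (Theta t X)).
apply: DeriveDef; first exact: diff_derivable.
rewrite E; apply: eq_bigr => i _; apply: eq_bigr => j _.
by rewrite (is_derive_val (is_derive_Theta_mpinvT X i j t0)).
Qed.

End Size.

(** * Approximation on one ball *)

Section Level.
Context {R : realType} {n : nat}.
Implicit Types (f eps F G : 'M[R]_n -> R) (X Y Z : 'M[R]_n) (C B : set 'M[R]_n).

Lemma smooth_approximation p f r : continuous f -> 0 < r ->
  exists G, [/\ Csmooth p G,
    forall X v e, (forall Y, frobenius (Y - X) <= r -> `|f Y - v| <= e) -> `|G X - v| <= e,
    forall L, (forall X Y, `|f X - f Y| <= L * frobenius (X - Y)) ->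
      forall X Y, `|G X - G Y| <= L * frobenius (X - Y)
    & Csmooth p f -> G = f].
Proof.
move=> cf r0; have [Cf|nCf] := pselect (Csmooth p f).
  exists f; split=> // X v e; apply; by rewrite subrr frobenius0 ltW.
have [G [CG Gv GL]] := mollifier cf r0.
by exists G; split=> //; apply/Csmooth_Cfin => k _; exact: CG.
Qed.

(** All requirements at X follow from properties of f at points within a uniform distance d' of X,
    so it is enough that [Theta] and the mollification together reach less than d'. *)
Lemma level_approximation p f eps C B (rho delta : R) :
  continuous f -> continuous eps -> (forall X, 0 < eps X) ->
  set_nbhs (supp f) C -> set_nbhs [set X : 'M[R]_n | \det X = 0] B -> 0 < delta ->
  exists tG : R * ('M[R]_n -> R), [/\ 0 < tG.1, Csmooth p tG.2,
    forall X, frobenius X <= rho ->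
      [/\ `|tG.2 (Theta tG.1 X) - f X| <= eps X / 2,
          ~ C X -> tG.2 (Theta tG.1 X) = 0
        & Csmooth p f -> ~ B X -> tG.2 (Theta tG.1 X) = f X]
    & forall L, 0 <= L -> (forall X Y, `|f X - f Y| <= L * frobenius (X - Y)) ->
       (forall X Y, `|tG.2 X - tG.2 Y| <= L * frobenius (X - Y)) /\
       forall X, `|tG.2 (Theta tG.1 X) - f X| <= L * delta].
Proof.
move=> cf ceps eps0 sfC dB delta0.
pose Q Z Y := [/\ `|f Y - f Z| <= eps Z / 2, ~ C Z -> f Y = 0 & ~ B Z -> \det Y != 0].
have [X KX|d d0 dQ] := @lebesgue_number _ _ _ Q (@compact_frobenius_ball R n rho).
  (* Two steps of eps X / 8 give eps X / 4, which is below eps Z / 2 because eps Z > eps X / 2. *)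
  have e4 : 0 < eps X / 8 by rewrite divr_gt0.
  have N1 : \forall Y \near X, `|f X - f Y| <= eps X / 8.
    exact: ((@cvgrPdist_le _ _ _ (nbhs X) (nbhs_filter X) f (f X)).1 (cf X) _ e4).
  have N2 : \forall Y \near X, eps X / 2 < eps Y.
    by apply: (cvgr_gt _ (ceps X)); rewrite ltr_pdivrMr// ltr_pMr// ltr1n.
  (* Near the support the premise ~ C Z fails; off the support, which is closed, f vanishes locally.
     N4 is the same dichotomy for the determinant. *)
  have N3 : (\forall Z \near X, C Z) \/ (\forall Y \near X, f Y = 0).
    have [sX|nsX] := pselect (supp f X); [by left; exact: sfC|right].
    have : nbhs X (~` supp f).
      by apply: open_nbhs_nbhs; split=> //; apply: closed_openC; exact: closed_closure.
    apply: filterS => Y nY; apply: contrapT => fY; apply: nY; exact: subset_closure.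
  have N4 : (\forall Z \near X, B Z) \/ (\forall Y \near X, \det Y != 0).
    have [dX|dX] := eqVneq (\det X) 0; [by left; exact: dB|right].
    exact: (cvgr_neq0 _ (@continuous_det R n X) dX).
  have N3' : exists A1 A2, [/\ nbhs X A1, nbhs X A2 & forall Z Y, A1 Z -> A2 Y -> ~ C Z -> f Y = 0].
    case: N3 => N3; first by exists [set Z | C Z], setT; split=> //; exact: filterT.
    by exists setT, [set Y | f Y = 0]; split=> //; exact: filterT.
  have N4' : exists A1 A2, [/\ nbhs X A1, nbhs X A2 & forall Z Y, A1 Z -> A2 Y -> ~ B Z -> \det Y != 0].
    case: N4 => N4; first by exists [set Z | B Z], setT; split=> //; exact: filterT.
    by exists setT, [set Y | \det Y != 0]; split=> //; exact: filterT.
  have [A1 [A2 [NA1 NA2 A12]]] := N3'; have [A3 [A4 [NA3 NA4 A34]]] := N4'.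
  have [d d0 H] := (nbhs_frobeniusP X _).1
    (filterI (filterI N1 N2) (filterI (filterI NA1 NA2) (filterI NA3 NA4))).
  exists d => // Z Y ZX YX.
  have [[fZ eZ] [[a1 _] [a3 _]]] := H Z ZX; have [[fY _] [[_ a2] [_ a4]]] := H Y YX.
  split; [|exact: A12|exact: A34].
  have := ler_distD (f X) (f Y) (f Z); rewrite (distrC (f Y) (f X)) => h.
  have := eps0 X; lra.
pose d' := Num.min d delta; have d'0 : 0 < d' by rewrite lt_min d0.
have d'd : d' <= d by rewrite ge_min lexx.
(* [Theta t] moves points by at most n (2t) <= d' / 2 and the mollification reaches d' / 4 further.
   Using n.+1 keeps the quotient meaningful for n = 0 and also gives 2t < d'. *)
pose t := d' / (4 * n.+1%:R); have n0 : 0 < n.+1%:R :> R by rewrite ltr0n.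
have t0 : 0 < t by rewrite divr_gt0// mulr_gt0.
have r0 : 0 < d' / 4 by rewrite divr_gt0.
have [G [CG Gv GL GE]] := smooth_approximation p cf r0.
have nt : n%:R * (2 * t) <= d' / 2.
  have -> : d' / 2 = n.+1%:R * (2 * t) by rewrite /t; field; rewrite addrC natr1 gt_eqF.
  by rewrite ler_wpM2r ?mulr_ge0 ?ltW// ltr_nat.
have t2 : 2 * t < d'.
  apply: (@le_lt_trans _ _ (d' / 2)); last by rewrite ltr_pdivrMr// ltr_pMr// ltr1n.
  rewrite /t; have -> : 2 * (d' / (4 * n.+1%:R)) = (d' / 2) / n.+1%:R by field; rewrite addrC natr1 gt_eqF.
  by rewrite ler_pdivrMr//; apply: ler_peMr; rewrite ?ler1n// ltW// divr_gt0.
have close X Y : frobenius (Y - Theta t X) <= d' / 4 -> frobenius (Y - X) < d'.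
  move=> YT; have := frobeniusD (Y - Theta t X) (Theta t X - X); rewrite addrA subrK.
  have := Theta_dist X t0; lra.
exists (t, G); split=> //= [X Xr|L L0 fL].
  split.
  - apply: Gv => Y /close YX.
    by have [] := dQ X Y Xr (lt_le_trans YX d'd).
  - move=> nC; have : `|G (Theta t X) - 0| <= 0.
      apply: Gv => Y /close YX.
      have [_ /(_ nC) ->] := dQ X Y Xr (lt_le_trans YX d'd).
      by rewrite subrr normr0.
    by rewrite subr0 normr_le0 => /eqP.
  - move=> Cf nB; rewrite (GE Cf) (@Theta_id _ _ _ _ d')// => Z ZX.
    by have [_ _ /(_ nB)] := dQ X Z Xr (lt_le_trans ZX d'd).
split=> [|X]; first exact: GL.
apply: Gv => Y /close YX; apply: (le_trans (fL _ _)).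
by rewrite ler_wpM2l// ltW// (lt_le_trans YX)// ge_min lexx orbT.
Qed.

End Level.

Lemma convex_norm_le (R : realType) (s x y b : R) : 0 <= s <= 1 ->
  `|x| <= b -> `|y| <= b -> `|(1 - s) * x + s * y| <= b.
Proof.
move=> /andP[s0 s1]; rewrite !ler_norml => /andP[x1 x2] /andP[y1 y2].
apply/andP; split; nra.
Qed.

Lemma convex_dist_le (R : realType) (s x y v b : R) : 0 <= s <= 1 ->
  `|x - v| <= b -> `|y - v| <= b -> `|(1 - s) * x + s * y - v| <= b.
Proof.
have -> : (1 - s) * x + s * y - v = (1 - s) * (x - v) + s * (y - v) by ring.
exact: convex_norm_le.
Qed.

(** * The glued function and its properties *)

Section Construction.
Context {R : realType} {n : nat} (t : nat -> R) (G : nat -> 'M[R]_n -> R)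
  (t_gt0 : forall j, 0 < t j).
Implicit Types (f : 'M[R]_n -> R) (X Y V : 'M[R]_n).

Let a j X := G j (Theta (t j) X).

Definition assemble X := interpolate (Num.trunc (height X)).+1 (height X) (a^~ X).

Let g := assemble.

Lemma assembleE X (J := Num.trunc (height X)) :
  exists2 s, 0 <= s <= 1 & g X = (1 - s) * a J X + s * a J.+1 X.
Proof.
exists (step (height X - J%:R)); first by rewrite step_ge0 step_le1.
by rewrite /g /assemble (interpolateE _ _ (truncn_itv (height_ge0 X))).
Qed.

Lemma assemble_near X : \forall Y \near X,
  g Y = interpolate (Num.trunc (height X)).+2 (height Y) (a^~ Y).
Proof.
have := trunc_nbhs X (Cfin_continuous (Cfin_height 0)) (@height_ge0 R n).
apply: filterS => Y hY; exact: interpolate_trunc (height_ge0 Y) hY.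
Qed.

Let Cfin_a k j : Cfin k (G j) -> Cfin k (a j).
Proof.
move=> CG; apply: (@Cfin_comp R k n n (G j) (Theta (t j))) => // i i'.
exact: Cfin_Theta.
Qed.

Lemma Csmooth_assemble p : (forall j, Csmooth p (G j)) -> Csmooth p g.
Proof.
move=> CG; apply: Csmooth_local => X.
eexists; last exact: assemble_near.
apply/Csmooth_Cfin => k kp; apply: Cfin_interpolate => [|j]; first exact: Cfin_height.
by apply: Cfin_a; exact: (Csmooth_Cfin p (G j)).1.
Qed.

Lemma is_derive_assemble X V s b : (forall j, Cfin 1 (G j)) ->
  is_derive X V height s -> (forall j, is_derive X V (a j) (b j)) ->
  forall N, (\forall Y \near X, g Y = interpolate N (height Y) (a^~ Y)) ->
  is_derive X V g (interpolate N (height X) b +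
    \sum_(0 <= j < N) (a j.+1 X - a j X) * s * step' (height X - j%:R)).
Proof.
move=> CG ds db N gN.
apply: (@near_eq_is_derive _ _ _ (fun Y => interpolate N (height Y) (a^~ Y))).
  by apply: filterS gN => Y ->.
apply: is_derive_interpolate => //.
exact: (Cfin_differentiable (Cfin_height 1)).
Qed.

(** The tolerance is tuned to the gluing term: the difference of consecutive levels is at most 2L /
    (2 * 46 * 8 (J + 1)), the derivative of [height] at most 46 (J + 1) |V| and [step'] at most 8,
    with product L |V|. The interpolated derivatives contribute 23 L |V|. *)
Lemma assemble_lipschitz f L : 0 <= L -> (forall j, Cfin 1 (G j)) ->
  (forall j X Y, `|G j X - G j Y| <= L * frobenius (X - Y)) ->
  (forall j X, `|a j X - f X| <= L * (2 * 46 * 8 * j.+1%:R)^-1) ->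
  forall X Y, `|g X - g Y| <= 24 * L * frobenius (X - Y).
Proof.
move=> L0 CG GL af.
have dg X V : is_derive X V g ('D_V g X).
  apply: (@Cfin_is_derive R n 0); exact: (@Csmooth_assemble (Some 1%N)).
apply: lipschitz_of_derive_bound => X V; first exact: (@ex_derive _ _ _ _ _ _ _ (dg X V)).
set J := Num.trunc (height X).
have hX := truncn_itv (height_ge0 X); rewrite -/J in hX.
have [_ hJ] := andP hX.
have da j : is_derive X V (a j) ('D_V (a j) X) by exact: Cfin_is_derive (Cfin_a (CG j)).
have dh : is_derive X V height ('D_V height X) by exact: Cfin_is_derive (Cfin_height 1).
have -> := is_derive_val (is_derive_assemble CG dh da (assemble_near X)).
rewrite (interpolateE _ _ hX)//
  (interpolate_derivE (fun j => (a j.+1 X - a j X) * 'D_V height X) _ hX)//.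
have V0 := frobenius_ge0 V.
have ab j : `|'D_V (a j) X| <= 23 * L * frobenius V.
  apply: (lipschitz_derive_bound _ (da j)); apply: (@filterE _ (nbhs X) (nbhs_filter X)) => Y.
  apply: (le_trans (GL _ _ _)); rewrite (mulrC 23) -mulrA ler_wpM2l//.
  exact: Theta_lipschitz.
have aa : `|a J.+1 X - a J X| <= 2 * (L * (2 * 46 * 8 * J.+1%:R)^-1).
  apply: (le_trans (ler_distD (f X) _ _)); rewrite (distrC (f X)) mulr_natl mulr2n.
  apply: lerD => //; apply: (le_trans (af _ _)); rewrite ler_wpM2l//.
  by rewrite lef_pV2 ?posrE ?mulr_gt0// ler_wpM2l// ler_nat.
have dhb : `|'D_V height X| <= 46 * J.+1%:R * frobenius V.
  apply: (le_trans (derive_height X V)); rewrite ler_wpM2r// ler_wpM2l//.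
  exact: frobenius_Theta_height.
have last : `|(a J.+1 X - a J X) * 'D_V height X * step' (height X - J%:R)| <= L * frobenius V.
  rewrite 2!normrM (ger0_norm (step'_ge0 _)).
  apply: (@le_trans _ _ (2 * (L * (2 * 46 * 8 * J.+1%:R)^-1) * (46 * J.+1%:R * frobenius V) * 8)).
    apply: ler_pM (mulr_ge0 (normr_ge0 _) (normr_ge0 _)) (step'_ge0 _) _ (step'_le8 _).
    by apply: ler_pM.
  rewrite le_eqVlt; apply/orP; left; apply/eqP; field.
  by rewrite addrC natr1 pnatr_eq0.
apply: (le_trans (ler_normD _ _)).
have -> : 24 * L * frobenius V = 23 * L * frobenius V + L * frobenius V by ring.
apply: lerD => //.
by apply: convex_norm_le => //; rewrite step_ge0 step_le1.
Qed.

(** The product is the derivative of g along [mpinvT X]. Although [mpinvT] is discontinuous, the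
    derivatives of all ingredients along it are continuous, and near X they combine by a formula
    with fixed N. *)
Lemma continuous_mpinvT_gradient : (forall j, Cfin 1 (G j)) ->
  continuous (fun X => mxdot (mpinvT X) (gradient g X)).
Proof.
move=> CG.
have [sg csg dsg] := @derive_Theta_mpinvT R n 1 (fun X => mxdot X X) ltr01 (Cfin_mxdot_self 1).
have /choice[b Hb] : forall j, exists b : 'M[R]_n -> R, continuous b /\
    forall X, is_derive X (mpinvT X) (a j) (b X).
  by move=> j; have [b cb db] := derive_Theta_mpinvT (t_gt0 j) (CG j); exists b.
have dg X : differentiable g X.
  by apply: (@Cfin_differentiable R n 0); exact: (@Csmooth_assemble (Some 1%N)).
move=> X; set N := (Num.trunc (height X)).+2.
pose H Y := interpolate N (height Y) (b^~ Y) +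
  \sum_(0 <= j < N) (a j.+1 Y - a j Y) * sg Y * step' (height Y - j%:R).
have cH : continuous H.
  apply: (@Cfin_continuous _ _ 0%N); apply: CfinD.
    by apply: Cfin_interpolate => [|j]; [exact: Cfin_height|exact: (Hb j).1].
  apply: Cfin_sum => j; apply: CfinM.
    apply: CfinM; last exact: csg.
    by apply: CfinB; apply: Cfin_a; exact: CfinS.
  apply: (Cfin_comp1 (u := step')); first by rewrite -(is_derive_derive1 is_derive_step); exact: smooth1_derive1 smooth1_step.
  by apply: CfinB; [exact: Cfin_height|exact: Cfin_cst].
have gH : \forall Y \near X, H Y = mxdot (mpinvT Y) (gradient g Y).
  have := near_join (assemble_near X); apply: filterS => Y gY.
  rewrite mxdotC -gradientP -deriveE//; apply/esym/is_derive_val.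
  by apply: is_derive_assemble => // j; exact: (Hb j).2.
have HX : H X = mxdot (mpinvT X) (gradient g X) by exact: nbhs_singleton gH.
rewrite /continuous_at -HX; apply: cvg_trans (cH X).
exact: (@near_eq_cvg _ _ (nbhs X) (nbhs_filter X) H _ gH).
Qed.

Lemma assemble_Theta X Y : Theta 1 X = Theta 1 Y ->
  (forall j, (j <= (Num.trunc (height X)).+1)%N -> Theta (t j) X = Theta (t j) Y) -> g X = g Y.
Proof.
move=> T1 Tj; have hXY : height X = height Y by rewrite /height T1.
rewrite /g /assemble -hXY; apply: eq_interpolate => j jN.
by rewrite /a Tj.
Qed.

Lemma metric_proj_id (S : set 'M[R]_n) X : S X -> metric_proj S X = [set X].
Proof.
move=> SX; apply/seteqP; split=> [Y [SY /(_ X SX)]|_ ->] /=.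
  rewrite subrr frobenius0 => XY; apply/eqP; rewrite eq_sym -subr_eq0 -frobenius_eq0.
  by rewrite eq_le XY frobenius_ge0.
by split=> // Z _; rewrite subrr frobenius0 frobenius_ge0.
Qed.

Lemma assemble_stratum M : Aplus R n M ->
  exists2 U, set_nbhs M U &
    forall X, U X -> exists2 Y, metric_proj M X = [set Y] & g X = g Y.
Proof.
move=> AM; exists [set X | exists2 Y, metric_proj M X = [set Y] & g X = g Y]; last by [].
case: AM => [[k _ ->]|->] X MX; last first.
  have : \forall Y \near X, 0 < \det Y by exact: (cvgr_gt _ (@continuous_det R n X)).
  by apply: filterS => Y dY; exists Y => //; exact: metric_proj_id.
have [c c0 Hc] := metric_proj_Mrank MX.
set N := (Num.trunc (height X)).+2.
have [d d0 dt] : exists2 d, 0 < d & forall j, (j <= N)%N -> d <= t j.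
  elim: (N) => [|N' [d d0 dt]]; first by exists (t 0%N) => // j; rewrite leqn0 => /eqP ->.
  exists (Num.min d (t N'.+1)) => [|j]; first by rewrite lt_min d0 t_gt0.
  by rewrite leq_eqVlt ge_min => /orP[/eqP ->|jN]; rewrite ?lexx ?orbT// dt.
(* e lies below every scale seen near X: the t_j with j <= N, and the scale 1 used by [height]. *)
have [e e0 [ec e1 ed]] : exists2 e, 0 < e & [/\ e <= c, e <= 1 & e <= d].
  exists (Num.min c (Num.min 1 d)); first by rewrite !lt_min c0 d0 ltr01.
  by rewrite !ge_min !lexx !orbT.
have hN := trunc_nbhs X (Cfin_continuous (Cfin_height 0)) (@height_ge0 R n).
apply: filterS (filterI (near_frobenius X e0) hN) => Y [YX hY].
have e0c : 0 < e <= c by rewrite e0.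
have [Z ZP TZ] := Hc e Y e0c YX; exists Z; first exact: ZP.
apply: assemble_Theta => [|j jN]; apply: TZ => //.
apply: (le_trans ed); apply: dt; apply: (leq_trans jN).
by rewrite truncn_lt_nat// height_ge0.
Qed.

End Construction.

(** All that is needed of the depth: 24 <= 11^2 <= 11^(m+1). *)
Lemma depth_gt0 (R : realType) n m : is_depth (Aplus R n) m -> (0 < m)%N.
Proof.
case=> _; apply; exists (fun=> Mpos R n); split=> // i _.
by right.
Qed.

Theorem theorem6p2 (R : realType) (n : nat) (n_gt0 : (0 < n)%N)
  (p : option nat) (p_gt0 : p <> Some 0%N)
  (m : nat) (m_depth : is_depth (Aplus R n) m)
  (f eps : 'M[R]_n -> R) (f_cont : continuous f) (eps_cont : continuous eps)
  (eps_gt0 : forall X, 0 < eps X)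
  (V1 : set 'M[R]_n) (V1_nbhs : set_nbhs (supp f) V1)
  (V2 : set 'M[R]_n)
  (V2_nbhs : set_nbhs (\bigcup_(k in [set k | (k < n)%N]) Mrank R n k) V2) :
  exists g : 'M[R]_n -> R,
    (forall X, `|f X - g X| < eps X) /\
    (Csmooth p g /\
     (lipschitz_continuous f ->
      lipschitz_continuous g /\ (lip g <= (11 ^+ m.+1)%:E * lip f)%E)) /\
    (forall M, Aplus R n M ->
       exists2 U, set_nbhs M U &
         forall X, U X -> exists2 Y, metric_proj M X = [set Y] & g X = g Y) /\
    (supp g `<=` V1) /\
    (Csmooth p f -> forall X, ~ V2 X -> g X = f X) /\
    continuous (fun X => mxdot (mpinvT X) (gradient g X)).
Proof.
(* The support of g is a closure, so g is made to vanish outside a smaller neighborhood B whose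
   closure lies in V1. *)
have [B fB BV1] := @pseudometric_normal R 'M[R]_n (supp f) (@closed_closure _ _) V1 V1_nbhs.
have detV2 : set_nbhs [set X : 'M[R]_n | \det X = 0] V2.
  move=> X /= dX; apply: V2_nbhs; exists (\rank X) => //=.
  rewrite ltn_neqAle rank_leq_row andbT; apply/negP => rX.
  have : X \in unitmx by rewrite -row_free_unit.
  by rewrite unitmxE unitfE dX eqxx.
pose delta (j : nat) : R := (2 * 46 * 8 * j.+1%:R)^-1.
have delta0 j : 0 < delta j by rewrite invr_gt0 !mulr_gt0.
(* By [frobenius_height] the ball of radius j + 1 + 2n contains all X with height below j + 1. *)
have /choice[tG HtG] := fun j => @level_approximation R n p f eps B V2 (j.+1%:R + n%:R * 2)
  (delta j) f_cont eps_cont eps_gt0 fB detV2 (delta0 j).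
pose t j := (tG j).1; pose G j := (tG j).2.
have t0 j : 0 < t j by have [] := HtG j.
have CG j : Csmooth p (G j) by have [] := HtG j.
have CG1 j : Cfin 1 (G j).
  have := (Csmooth_Cfin p (G j)).1 (CG j) 1%N.
  by case: (p) p_gt0 => [[|q]|] // _; exact.
(* Only the levels J and J + 1 enter g at X, and X lies in the balls of both. *)
have near_f X (J := Num.trunc (height X)) j : j = J \/ j = J.+1 ->
    [/\ `|G j (Theta (t j) X) - f X| <= eps X / 2, ~ B X -> G j (Theta (t j) X) = 0
      & Csmooth p f -> ~ V2 X -> G j (Theta (t j) X) = f X].
  move=> jJ; have [_ _ H _] := HtG j; apply: H.
  have [_ hX] := andP (truncn_itv (height_ge0 X)).
  apply: (le_trans (frobenius_height hX)); rewrite lerD2r ler_nat.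
  by case: jJ => ->.
exists (assemble t G); split; [|split; [|split; [|split; [|split]]]].
- move=> X; have [s s01 ->] := assembleE t G X; set J := Num.trunc _.
  have [a0 _ _] := near_f X J (or_introl erefl).
  have [a1 _ _] := near_f X J.+1 (or_intror erefl).
  rewrite distrC; apply: (le_lt_trans (convex_dist_le s01 a0 a1)).
  by rewrite ltr_pdivrMr// ltr_pMr// ltr1n.
- split=> [|/(lip_fin n_gt0)[L L0 fL]]; first exact: Csmooth_assemble.
  have Lf X Y : `|f X - f Y| <= L * frobenius (X - Y) by exact: lip_lipschitz.
  have gL : (lip (assemble t G) <= (24 * L)%:E)%E.
    apply/lip_le/(assemble_lipschitz t0 (f := f)) => // [j|j X].
      by have [_ _ _ /(_ L L0 Lf)[GL _]] := HtG j; exact: GL.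
    by have [_ _ _ /(_ L L0 Lf)[_ Gf]] := HtG j; exact: Gf.
  split; first by apply: le_lt_trans gL _; rewrite ltry.
  apply: (le_trans gL); rewrite fL -EFinM lee_fin ler_wpM2r//.
  apply: (@le_trans _ _ (11 ^+ 2)); first by rewrite -natrX ler_nat.
  by rewrite ler_weXn2l ?ler1n// ltnS (depth_gt0 m_depth).
- exact: assemble_stratum.
- apply: subset_trans BV1; apply: closure_subset => X /= gX.
  apply: contrapT => nB; apply: gX.
  have [s _ ->] := assembleE t G X; set J := Num.trunc _.
  have [_ /(_ nB) -> _] := near_f X J (or_introl erefl).
  have [_ /(_ nB) -> _] := near_f X J.+1 (or_intror erefl).
  by rewrite !mulr0 addr0.
- move=> Cf X nV2; have [s _ ->] := assembleE t G X; set J := Num.trunc _.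
  have [_ _ /(_ Cf nV2) ->] := near_f X J (or_introl erefl).
  have [_ _ /(_ Cf nV2) ->] := near_f X J.+1 (or_intror erefl).
  by ring.
- exact: continuous_mpinvT_gradient.
Qed.
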